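(* Let $\mu>0$ and $1/3<\lambda<1$, and let $k$ be the symmetric stable density with characteristic function $\phi_k(t)=e^{-|t|^\lambda/\mu}$. Let $X_j=Y_j+Z_j$, $j=1,2,\dots$, be i.i.d. real random variables, where for each $j$ the variables $Y_j$ and $Z_j$ are independent, $Y_j$ has a probability density $f$ on $\mathbb{R}$ and $Z_j$ has density $k$; let $g=k*f$ be the density of $X_j$. Let $f_{nh}$ be the kernel type deconvolution density estimator based on $X_1,\dots,X_n$ with the sinc kernel $w(x)=\sin x/(\pi x)$ and bandwidth $h=h_n>0$, and let $x\in\mathbb{R}$. Then, as $n\to\infty$, $h\to 0$ and $nh\to\infty$, $$ \frac{\sqrt{n}}{h^{(\lambda-1)/2}\,e^{(1/h)^\lambda/\mu}}\,\bigl(f_{nh}(x)-\mathrm{E}\, f_{nh}(x)\bigr)\ \xrightarrow{\ \mathcal{D}\ }\ N(0,\sigma^2), $$ with $$ \sigma^2=\frac{1}{2\pi}\,\frac{\mu}{\lambda}\,g(x). $$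
   Context: The bandwidth $h=h_n$ is a deterministic sequence of positive numbers. The kernel type deconvolution estimator of $f(x)$ with kernel $w$ and bandwidth $h$ is $$ f_{nh}(x)=\frac{1}{2\pi}\int_{-\infty}^{\infty} e^{-itx}\,\frac{\phi_w(ht)\,\phi_{emp}(t)}{\phi_k(t)}\,dt,\qquad \phi_{emp}(t)=\frac1n\sum_{j=1}^n e^{itX_j}, $$ where $\phi_w$ and $\phi_k$ are the characteristic functions (Fourier transforms $\int e^{itx}(\cdot)\,dx$) of $w$ and $k$. For the sinc kernel $w(x)=\sin x/(\pi x)$ one takes $\phi_w(t)=I_{[-1,1]}(t)$. $*$ denotes convolution; $g$ denotes the continuous version $g(x)=\int k(x-y)f(y)\,dy$, with $k$ the continuous version of the stable density. $\xrightarrow{\mathcal{D}}$ denotes convergence in distribution and $N(0,\sigma^2)$ the normal distribution with mean $0$ and variance $\sigma^2$. *)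

(* Defs.v *)
From mathcomp Require Import all_boot all_order all_algebra finmap.
From mathcomp Require Import complex.
From mathcomp Require Import all_classical all_reals all_analysis.

Set Implicit Arguments.
Unset Strict Implicit.
Unset Printing Implicit Defensive.

Import Order.TTheory GRing.Theory Num.Theory.
Import numFieldNormedType.Exports.

Local Open Scope classical_set_scope.
Local Open Scope complex_scope.
Local Open Scope ring_scope.

Section Fourier.
Context {R : realType}.
Implicit Types (f k : R -> R) (h t x : R).

Definition expi t : R[i] := cos t +i* sin t.

Definition cintegral (F : R -> R[i]) : R[i] :=
  (\int[lebesgue_measure]_t complex.Re (F t)) +i*
  (\int[lebesgue_measure]_t complex.Im (F t)).

(* For a probability density this is its characteristic function. *)
Definition fourier f t : R[i] := cintegral (fun x => expi (t * x) * (f x)%:C).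

Definition convolution k f x : R :=
  \int[lebesgue_measure]_y (k (x - y) * f y).

(* The sinc kernel sin x / (pi x) is not Lebesgue integrable, so its transform
   is not given by [fourier]; it is the indicator of [-1, 1] by convention. *)
Definition phi_sinc t : R[i] := (\1_(`[-1, 1] : set R) t : R)%:C.

Definition phi_emp (n : nat) (xs : nat -> R) t : R[i] :=
  n%:R^-1 * \sum_(j < n) expi (t * xs j).

Definition deconvolution (phi_w : R -> R[i]) k (n : nat) h (xs : nat -> R) x :
    R[i] :=
  ((2 * pi)^-1)%:C *
  cintegral (fun t => expi (- (t * x)) *
    (phi_w (h * t) * phi_emp n xs t / fourier k t)).

(* For even k the integrand is conjugated by t -> - t, so the integral is real;
   [Re] only changes the type. *)
Definition sinc_deconvolution k (n : nat) h (xs : nat -> R) x : R :=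
  complex.Re (deconvolution phi_sinc k n h xs x).

End Fourier.

Section Probability.
Context d (T : measurableType d) (R : realType) (P : probability T R).
Local Open Scope ereal_scope.

Definition has_density (X : {RV P >-> R}) (f : R -> R) :=
  [/\ forall x, (0 <= f x)%R,
      measurable_fun setT f &
      forall A : set R, measurable A ->
        distribution P X A = \int[lebesgue_measure]_(x in A) (f x)%:E].

Definition independent2 (X Y : {RV P >-> R}) :=
  forall A B : set R, measurable A -> measurable B ->
    P (X @^-1` A `&` Y @^-1` B) = P (X @^-1` A) * P (Y @^-1` B).

Definition mutually_independent (X : nat -> {RV P >-> R}) :=
  forall (J : {fset nat}) (A : nat -> set R), (forall j, measurable (A j)) ->
    P (\bigcap_(j in [set` J]) (X j @^-1` A j)) =
    \prod_(j <- J) P (X j @^-1` A j).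

Definition identically_distributed (X : nat -> {RV P >-> R}) :=
  forall (i j : nat) (A : set R), measurable A ->
    distribution P (X i) A = distribution P (X j) A.

Definition iid (X : nat -> {RV P >-> R}) :=
  mutually_independent X /\ identically_distributed X.

Definition cvg_in_distribution (F : nat -> T -> R) (law : set R -> \bar R) :=
  (forall n, measurable_fun setT (F n)) /\
  forall y : R, {for y, continuous (fun z : R => law `]-oo, z]%classic)} ->
    P (F n @^-1` `]-oo, y]%classic) @[n --> \oo] --> law `]-oo, y]%classic.

(* [normal_prob] is parametrised by the standard deviation and is not the
   degenerate normal law when that is zero. *)
Definition normal_law (m v : R) (A : set R) : \bar R :=
  if v == 0%R then \d_m A else normal_prob m (Num.sqrt v) A.

End Probability.

(* Main.v *)
(* The estimator is an average of terms V(X_j - x), where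
   V(u) = (1/pi) int_0^(1/h) a(t) cos(tu) dt and a(t) = exp(t^lambda / mu). With A(M) = int_0^M a,
   d/dM (int_0^M a(t) cos(tu) dt)^2 turns the second moment of V(X_j - x) into
   pi^-2 int_0^(1/h) a(t) int_0^t a(s) (psi(t - s) + psi(t + s)) ds dt, where
   psi(r) = E cos(r (X_j - x)). As a(t - s) / a(t) -> 1, with a(s) |psi(s)| <= 1, the inner
   integral is asymptotic to a(t) int_0^oo psi = pi g(x) a(t) by Fourier inversion, and
   int_0^M a^2 ~ M^(1 - lambda) a(M)^2 mu / (2 lambda) by l'Hopital's rule; the tail
   psi(t + s) contributes at most t, which is o(a(t)). The summands are bounded by
   O(A(1/h)), which is negligible against the norming because n h -> oo, and their means are
   O(1/h). A central limit theorem for bounded triangular arrays follows from the characteristic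
   functions, which are handled through the real functions E cos(tS + c); Levy's continuity
   theorem is obtained by smoothing indicators with the Poisson kernel. *)
Require Import Defs.
From mathcomp Require Import all_boot all_order all_algebra finmap.
From mathcomp Require Import complex.
From mathcomp Require Import all_classical all_reals all_analysis.
From mathcomp Require Import measurable_realfun ring lra.

Set Implicit Arguments.
Unset Strict Implicit.
Unset Printing Implicit Defensive.

Import Order.TTheory GRing.Theory Num.Theory.
Import numFieldNormedType.Exports.

Local Open Scope classical_set_scope.
Local Open Scope complex_scope.
Local Open Scope ring_scope.

(** * Real-valued integrals *)

(** The law of the data enters only through psi. Since the characteristic function of k is 1/a, real
    and positive, independence gives |psi| <= 1/a; this one bound makes psi integrable, dominates
    the limit of the inner integral and controls the means, so that f is seen only through g(x). The
    Poisson kernel e/(e^2 + u^2) is chosen because it is the Laplace transform of t |-> cos(tu): its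
    expectation at y - S is an integral of functions E cos(tS + c) against the integrable weight
    exp(-e t). Pointwise convergence of these functions therefore passes to smoothed probabilities
    by dominated convergence, and the tails of the limit law replace a tightness argument. Letting e
    tend to 0 in the same identity yields Fourier inversion. The phase c keeps everything real: the
    addition formula for cos produces a sine, which is again a cosine with phase c - pi/2.
    Independence is given for events only; it is carried over to functions by one transfer lemma
    with signed weights, which replaces one factor of a product at a time. *)

Lemma lebesgue_itv_lty (R : realType) (a b : R) :
  (lebesgue_measure (`[a, b]%classic : set R) < +oo)%E.
Proof. by rewrite lebesgue_measure_itv/=; case: ifP => _; rewrite ?ltry// -EFinB ltry. Qed.

Section integrals.
Context d (T : measurableType d) (R : realType).
Variables (mu : {measure set T -> \bar R}) (D : set T) (mD : measurable D).
Implicit Types f g : T -> R.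

Lemma le_Rintegrable f g : measurable_fun D f ->
  (forall x, D x -> `|f x| <= g x) ->
  mu.-integrable D (EFin \o g) -> mu.-integrable D (EFin \o f).
Proof.
move=> mf fg; apply: le_integrable => //; first exact/measurable_EFinP.
by move=> x Dx /=; rewrite lee_fin (le_trans (fg _ Dx))// ler_norm.
Qed.

Lemma bounded_integrable f (K : R) : (mu D < +oo)%E -> measurable_fun D f ->
  (forall x, D x -> `|f x| <= K) -> mu.-integrable D (EFin \o f).
Proof.
move=> Doo mf fK; apply: measurable_bounded_integrable => //.
exists K; split; first exact: num_real.
by move=> M KM x Dx /=; rewrite (le_trans (fK _ Dx))// ltW.
Qed.

Lemma RintegrableZl (k : R) f : mu.-integrable D (EFin \o f) ->
  mu.-integrable D (EFin \o (fun x => k * f x)).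
Proof. exact: integrableZl. Qed.

Lemma RintegrableD f g : mu.-integrable D (EFin \o f) ->
  mu.-integrable D (EFin \o g) -> mu.-integrable D (EFin \o (fun x => f x + g x)).
Proof. exact: integrableD. Qed.

Lemma RintegrableB f g : mu.-integrable D (EFin \o f) ->
  mu.-integrable D (EFin \o g) -> mu.-integrable D (EFin \o (fun x => f x - g x)).
Proof. exact: integrableB. Qed.

Lemma Rintegral_mulr_indic f :
  \int[mu]_x (f x * \1_D x) = \int[mu]_(x in D) f x.
Proof.
rewrite [RHS]Rintegral_mkcond; apply: eq_Rintegral => x _.
by rewrite patchE indicE; case: ifP; rewrite ?mulr1 ?mulr0.
Qed.

Lemma Rintegrable_mulr_indic f : mu.-integrable D (EFin \o f) ->
  mu.-integrable setT (EFin \o (fun x => f x * \1_D x)).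
Proof.
move=> fi; rewrite (_ : (fun x => _) = f \_ D).
  by rewrite -restrict_EFin; apply/(integrable_mkcond _ mD).1.
by apply/funext => x; rewrite patchE indicE; case: ifP; rewrite ?mulr1 ?mulr0.
Qed.

Lemma Rdominated_cvg (f_ : nat -> T -> R) f g :
  (forall n, measurable_fun D (f_ n)) -> measurable_fun D f ->
  (forall x, D x -> f_ n x @[n --> \oo] --> f x) ->
  mu.-integrable D (EFin \o g) ->
  (forall n x, D x -> `|f_ n x| <= g x) ->
  \int[mu]_(x in D) f_ n x @[n --> \oo] --> \int[mu]_(x in D) f x.
Proof.
move=> mf_ mf f_f ig f_g.
have mf_' n : measurable_fun D (EFin \o f_ n) by exact/measurable_EFinP.
have mf' : measurable_fun D (EFin \o f) by exact/measurable_EFinP.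
have [|| i _ c] := dominated_convergence mD mf_' mf' _ ig.
- by apply: aeW => x Dx; apply: cvg_EFin; [exact: nearW|exact: f_f].
- by apply: aeW => x n Dx /=; rewrite lee_fin f_g.
- apply: fine_cvg; rewrite fineK//; exact: integrable_fin_num.
Qed.

Lemma Rintegral_sum (I : Type) (s : seq I) (h : I -> T -> R) :
  (forall i, mu.-integrable D (EFin \o h i)) ->
  mu.-integrable D (EFin \o (fun x => \sum_(i <- s) h i x)) /\
  \int[mu]_(x in D) (\sum_(i <- s) h i x) = \sum_(i <- s) \int[mu]_(x in D) h i x.
Proof.
move=> ih; elim: s => [|a s [IH1 IH2]].
  rewrite big_nil (_ : (fun _ => _) = cst 0); last first.
    by apply/funext => x; rewrite big_nil.
  by split; [exact: integrable0|rewrite Rintegral_cst ?mul0r].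
rewrite (_ : (fun _ => _) = h a \+ (fun x => \sum_(i <- s) h i x)); last first.
  by apply/funext => x; rewrite big_cons.
split.
  exact: (integrableD mD (ih a) IH1).
by rewrite RintegralD// big_cons IH2.
Qed.

End integrals.

Lemma probability_integrable d (T : measurableType d) (R : realType)
    (P : probability T R) (f : T -> R) (K : R) : measurable_fun setT f ->
  (forall x, `|f x| <= K) -> P.-integrable setT (EFin \o f).
Proof.
move=> mf fK; apply: (@bounded_integrable _ _ _ P setT _ f K) => //.
exact: (le_lt_trans (probability_le1 _ _) (ltry _)).
Qed.

Lemma normr_expectation_le d (T : measurableType d) (R : realType)
    (P : probability T R) (f : T -> R) (K : R) : measurable_fun setT f ->
  (forall x, `|f x| <= K) -> `|\int[P]_w f w| <= K.
Proof.
move=> mf fK; have i := probability_integrable P mf fK.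
apply: (le_trans (le_normr_Rintegral _ _)) => //.
rewrite (_ : K = \int[P]_w K); last first.
  by rewrite Rintegral_cst//= probability_setT mulr1.
apply: le_Rintegral => //.
- exact: integrable_norm.
- exact: (finite_measure_integrable_cst P K measurableT).
Qed.

(** Tonelli makes the integrals of the positive and negative parts measurable as extended reals;
    [fine] is measurable, so parameters with an infinite integral do no harm. *)
Lemma measurable_Rintegral_param d1 d2 (T1 : measurableType d1)
    (T2 : measurableType d2) (R : realType)
    (m2 : {sigma_finite_measure set T2 -> \bar R}) (D : set T2) (f : T1 * T2 -> R) :
  measurable D -> measurable_fun setT f ->
  measurable_fun setT (fun x => \int[m2]_(y in D) f (x, y)).
Proof.
move=> mD mf; pose g z := f z * \1_D z.2.
have mg : measurable_fun setT g.
  by apply: measurable_funM => //; exact: measurableT_comp measurable_snd.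
have mEg : measurable_fun setT (EFin \o g) by exact/measurable_EFinP.
rewrite (_ : (fun x => _) = fun x => fine (\int[m2]_y (EFin \o g) (x, y))%E).
  apply: (measurableT_comp (f := fine)) => //.
  under eq_fun do rewrite integralE.
  apply: emeasurable_funB.
  - have p0 z : (0 <= ((EFin \o g)^\+ z))%E by exact: funepos_ge0.
    apply: eq_measurable_fun (measurable_fun_fubini_tonelli_F (m2 := m2) _ (measurable_funepos mEg) p0).
    by move=> x _; apply: eq_integral => y _; rewrite ?funeposE ?funenegE.
  - have p0 z : (0 <= ((EFin \o g)^\- z))%E by exact: funeneg_ge0.
    apply: eq_measurable_fun (measurable_fun_fubini_tonelli_F (m2 := m2) _ (measurable_funeneg mEg) p0).
    by move=> x _; apply: eq_integral => y _; rewrite ?funeposE ?funenegE.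
by apply/funext => x; rewrite -(Rintegral_mulr_indic m2 D).
Qed.

(** * Fubini for real-valued integrals under a product majorant *)

Section fubini.
Context d1 d2 (T1 : measurableType d1) (T2 : measurableType d2) (R : realType).
Variables (m1 : {sigma_finite_measure set T1 -> \bar R})
  (m2 : {sigma_finite_measure set T2 -> \bar R}).
Variables (D1 : set T1) (mD1 : measurable D1) (D2 : set T2) (mD2 : measurable D2).
Variables (f : T1 * T2 -> R) (a : T1 -> R) (b : T2 -> R).
Hypotheses (mf : measurable_fun setT f)
  (ia : m1.-integrable D1 (EFin \o a)) (ib : m2.-integrable D2 (EFin \o b))
  (fab : forall x y, D1 x -> D2 y -> `|f (x, y)| <= a x * b y).

Let F z := f z * \1_D1 z.1 * \1_D2 z.2.

Let mF : measurable_fun setT F.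
Proof.
apply: measurable_funM; first apply: measurable_funM => //.
- exact: measurableT_comp measurable_fst.
- exact: measurableT_comp measurable_snd.
Qed.

Let F_le x y : `|F (x, y)| <= `|(a \_ D1) x| * `|(b \_ D2) y|.
Proof.
rewrite /F /= !patchE !indicE.
have [/set_mem xD|_] := boolP (x \in D1); last first.
  by rewrite mulr0 mul0r normr0 mul0r.
have [/set_mem yD|_] := boolP (y \in D2); last by rewrite mulr0 !normr0 mulr0.
by rewrite !mulr1 -normrM (le_trans (fab xD yD))// ler_norm.
Qed.

Let ia' : m1.-integrable setT (EFin \o (Num.norm \o (a \_ D1))).
Proof.
by apply: integrable_norm => //; rewrite -restrict_EFin; apply/(integrable_mkcond _ mD1).1.
Qed.

Let ib' : m2.-integrable setT (EFin \o (Num.norm \o (b \_ D2))).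
Proof.
by apply: integrable_norm => //; rewrite -restrict_EFin; apply/(integrable_mkcond _ mD2).1.
Qed.

Let iF : (m1 \x m2)%E.-integrable setT (EFin \o F).
Proof.
apply/integrable12ltyP; first exact/measurable_EFinP.
move: ia' ib' => na nb.
apply: (@le_lt_trans _ _
  (\int[m1]_x (`|(a \_ D1) x|%:E * \int[m2]_y `|(b \_ D2) y|%:E))%E); last first.
  rewrite ge0_integralZr//.
  - apply: lte_mul_pinfty.
    + by apply: integral_ge0 => ? _; rewrite lee_fin.
    + exact: integrable_fin_num na.
    + by rewrite ltey_eq; apply/orP; left; exact: integrable_fin_num nb.
  - by case/integrableP : na.
  - by apply: integral_ge0 => ? _; rewrite lee_fin.
have mn : measurable_fun setT (fun y => `|(b \_ D2) y|%:E).
  by case/integrableP : nb.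
apply: ge0_le_integral => //=.
- by move=> x _; apply: integral_ge0 => ? _; rewrite lee_fin.
- apply: (measurable_fun_fubini_tonelli_F (fun z => `|(F z)%:E|)%E) => //=.
  apply/measurable_EFinP; exact: measurableT_comp.
- apply: emeasurable_funM => //; by case/integrableP : na.
- move=> x _; rewrite -ge0_integralZl//=; apply: ge0_le_integral => //=.
  + apply/measurable_EFinP/measurableT_comp => //.
    by apply: (measurable_fun_pair2 x mF).
  + apply: emeasurable_funM => //; by case/integrableP : na.
  + by move=> y _; rewrite lee_fin.
Qed.

Let Rfubini1 x : \int[m2]_y F (x, y) = ((fun x => \int[m2]_(y in D2) f (x, y)) \_ D1) x.
Proof.
rewrite patchE /F /=; case: ifPn => xD.
  rewrite [RHS]Rintegral_mkcond; apply: eq_Rintegral => y _.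
  by rewrite !indicE xD patchE mulr1; case: ifP; rewrite (mulr1,mulr0).
under eq_Rintegral do rewrite indicE (negbTE xD) mulr0 mul0r.
by rewrite Rintegral_cst// mul0r.
Qed.

Let Rfubini2 y : \int[m1]_x F (x, y) = ((fun y => \int[m1]_(x in D1) f (x, y)) \_ D2) y.
Proof.
rewrite patchE /F /=; case: ifPn => yD.
  rewrite [RHS]Rintegral_mkcond; apply: eq_Rintegral => x _.
  by rewrite !indicE yD patchE mulr1; case: ifP; rewrite (mulr1,mulr0).
under eq_Rintegral do rewrite [X in _ * X]indicE (negbTE yD) mulr0.
by rewrite Rintegral_cst// mul0r.
Qed.

Let iF2 x : m2.-integrable setT (EFin \o (fun y => F (x, y))).
Proof.
apply: (le_Rintegrable _ _ _ (integrableZl measurableT `|(a \_ D1) x| ib')) => //.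
exact: (measurable_fun_pair2 x mF).
Qed.

Let iF1 y : m1.-integrable setT (EFin \o (fun x => F (x, y))).
Proof.
apply: (le_Rintegrable _ _ _ (integrableZr measurableT `|(b \_ D2) y| ia')) => //.
exact: (measurable_fun_pair1 y mF).
Qed.

(** The majorant a(x) b(y) gives more than integrability on the product: every section, not merely
    almost every one, is integrable, so the [fine] around the inner integrals can be undone
    pointwise. The indicators in [F] reduce the rectangle to the whole space. *)
Lemma RFubini : \int[m1]_(x in D1) \int[m2]_(y in D2) f (x, y) =
  \int[m2]_(y in D2) \int[m1]_(x in D1) f (x, y).
Proof.
rewrite Rintegral_mkcond [RHS]Rintegral_mkcond.
under eq_Rintegral do rewrite -Rfubini1.
under [RHS]eq_Rintegral do rewrite -Rfubini2.
rewrite /Rintegral; congr fine.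
transitivity (\int[m1]_x \int[m2]_y (F (x, y))%:E)%E.
  by apply: eq_integral => x _; rewrite fineK//; exact: integrable_fin_num (iF2 x).
transitivity (\int[m2]_y \int[m1]_x (F (x, y))%:E)%E.
  exact: (Fubini iF).
by apply: eq_integral => x _; rewrite fineK//; exact: integrable_fin_num (iF1 x).
Qed.

End fubini.

Import HBNNSimple.

(** * From indicators to bounded measurable functions *)

Section transfer.
Context d1 d2 d (T1 : measurableType d1) (T2 : measurableType d2)
  (U : measurableType d) (R : realType).
Variables (m1 : {measure set T1 -> \bar R}) (m2 : {measure set T2 -> \bar R}).
Variables (G1 : T1 -> R) (G2 : T2 -> R) (X1 : T1 -> U) (X2 : T2 -> U).
Hypotheses (iG1 : m1.-integrable setT (EFin \o G1))
  (iG2 : m2.-integrable setT (EFin \o G2))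
  (mX1 : measurable_fun setT X1) (mX2 : measurable_fun setT X2).
Hypothesis G12 : forall A, measurable A ->
  \int[m1]_w (G1 w * \1_A (X1 w)) = \int[m2]_w (G2 w * \1_A (X2 w)).

Let iGF d' (T' : measurableType d') (m : {measure set T' -> \bar R}) (G : T' -> R)
    (X : T' -> U) (F : U -> R) (K : R) : m.-integrable setT (EFin \o G) ->
  measurable_fun setT X -> measurable_fun setT F -> (forall x, `|F x| <= K) ->
  m.-integrable setT (EFin \o (fun w => G w * F (X w))).
Proof.
move=> iG mX mF FK.
have mG : measurable_fun setT G by case/integrableP : iG => /measurable_EFinP.
apply: (le_Rintegrable _ _ _ (integrable_norm (integrableZr measurableT K iG))) => //.
  by apply: measurable_funM => //; exact: measurableT_comp mX.
by move=> x _ /=; rewrite !normrM ler_wpM2l// (le_trans (FK _))// ler_norm.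
Qed.

Let transfer_sfun (F : {nnsfun U >-> R}) :
  \int[m1]_w (G1 w * F (X1 w)) = \int[m2]_w (G2 w * F (X2 w)).
Proof.
have FE d' (T' : measurableType d') (m : {measure set T' -> \bar R}) (G : T' -> R)
    (X : T' -> U) : m.-integrable setT (EFin \o G) -> measurable_fun setT X ->
    \int[m]_w (G w * F (X w)) = \sum_(y <- fset_set (range F))
      y * \int[m]_w (G w * \1_(F @^-1` [set y]) (X w)).
  move=> iG mX.
  have i1 y : m.-integrable setT (EFin \o (fun w => G w * \1_(F @^-1` [set y]) (X w))).
    apply: (iGF (F := \1_(F @^-1` [set y])) (K := 1)) => //.
    by move=> x; rewrite indicE; case: (_ \in _); rewrite ?normr1 ?normr0.
  under [RHS]eq_bigr do rewrite -RintegralZl//.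
  rewrite -(proj2 (Rintegral_sum _ _ _)); last 2 first.
  - by [].
  - by move=> y; exact: (integrableZl measurableT y (i1 y)).
  apply: eq_Rintegral => w _; rewrite fimfunE fsbig_finite//= mulr_sumr.
  by apply: eq_bigr => y _; rewrite mulrCA.
rewrite !FE//; apply: eq_bigr => y _; rewrite G12//.
Qed.

Let transfer_ge0 (F : U -> R) (K : R) : measurable_fun setT F -> (forall x, 0 <= F x <= K) ->
  \int[m1]_w (G1 w * F (X1 w)) = \int[m2]_w (G2 w * F (X2 w)).
Proof.
move=> mF FK; have mEF : measurable_fun setT (EFin \o F) by exact/measurable_EFinP.
have F0 x : setT x -> (0 <= (F x)%:E)%E by rewrite lee_fin; case/andP: (FK x).
pose g := nnsfun_approx measurableT mEF.
have gF x : g n x @[n --> \oo] --> F x.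
  by have /fine_cvgP[_] := cvg_nnsfun_approx measurableT mEF F0 (x := x) I.
have gK n x : `|g n x| <= K.
  rewrite ger0_norm// -lee_fin; apply: (@le_trans _ _ (F x)%:E).
    by rewrite /g nnsfun_approxE; exact: le_approx.
  by rewrite lee_fin; case/andP: (FK x).
(* The weight G has no sign, so monotone approximation of F is followed by dominated convergence,
   with majorant |G K|. *)
have lim d' (T' : measurableType d') (m : {measure set T' -> \bar R}) (G : T' -> R)
    (X : T' -> U) : m.-integrable setT (EFin \o G) -> measurable_fun setT X ->
    \int[m]_w (G w * g n (X w)) @[n --> \oo] --> \int[m]_w (G w * F (X w)).
  move=> iG mX.
  have mG : measurable_fun setT G by case/integrableP : iG => /measurable_EFinP.
  apply: (@Rdominated_cvg _ _ _ m _ _ _ _ (Num.norm \o (fun w => G w * K))) => //.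
  - by move=> n; apply: measurable_funM => //; exact: measurableT_comp.
  - by apply: measurable_funM => //; exact: measurableT_comp.
  - by move=> w _; apply: cvgM; [exact: cvg_cst|exact: gF].
  - exact: (integrable_norm (integrableZr measurableT K iG)).
  - by move=> n w _; rewrite /= !normrM ler_wpM2l// (le_trans (gK _ _))// ler_norm.
have := lim _ _ m1 G1 X1 iG1 mX1; under eq_cvg do rewrite transfer_sfun.
by move=> /cvg_unique; apply; [exact: norm_hausdorff|exact: lim].
Qed.

(** [G12] says that the signed measures with densities [G1] and [G2] have the same image on U;
    equality extends from indicators to simple functions, to limits, and to signed F after a shift
    by K. With G a density it is a change of variables; with G a random factor it exchanges one
    factor of an expectation for its mean. *)
Lemma Rintegral_transfer (F : U -> R) (K : R) : measurable_fun setT F ->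
  (forall x, `|F x| <= K) ->
  \int[m1]_w (G1 w * F (X1 w)) = \int[m2]_w (G2 w * F (X2 w)).
Proof.
move=> mF FK.
have split_int d' (T' : measurableType d') (m : {measure set T' -> \bar R}) (G : T' -> R)
    (X : T' -> U) : m.-integrable setT (EFin \o G) -> measurable_fun setT X ->
    \int[m]_w (G w * F (X w)) = \int[m]_w (G w * (F (X w) + K)) - \int[m]_w G w * K.
  move=> iG mX; have iGK := integrableZr measurableT K iG.
  rewrite -RintegralZr// -RintegralB//.
  - by apply: eq_Rintegral => w _; rewrite mulrDr addrK.
  - apply: (iGF (F := fun x => F x + K) (K := K + K)) => //.
      exact: measurable_funD.
    move=> x; rewrite (le_trans (ler_normD _ _))// lerD//.
    by rewrite ger0_norm// (le_trans _ (FK x)).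
rewrite !split_int//; congr (_ - _ * _).
- apply: (@transfer_ge0 (fun x => F x + K) (K + K)).
    exact: measurable_funD.
  move=> x; have := FK x; rewrite ler_norml => /andP[F1 F2].
  by rewrite -lerBlDr sub0r F1 lerD2r.
- have := G12 measurableT.
  under eq_Rintegral do rewrite indicE in_setT mulr1.
  by under [X in _ = X]eq_Rintegral do rewrite indicE in_setT mulr1.
Qed.
End transfer.

(** * Levy's continuity theorem *)

Lemma norm_squeeze0 (R : realType) (T : Type) (F : set_system T) (FF : Filter F)
    (f g : T -> R) : (\forall x \near F, `|f x| <= g x) ->
  g x @[x --> F] --> (0 : R) -> f x @[x --> F] --> (0 : R).
Proof.
move=> fg g0; apply: (@squeeze_cvgr _ _ _ _ (fun x => - g x) g) => //.
- by near=> x; rewrite -ler_norml; near: x.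
- by rewrite -[X in _ --> X]oppr0; exact: cvgN.
Unshelve. all: by end_near. Qed.

(** * The Poisson kernel and its primitive *)

Section poisson_kernel.
Context {R : realType}.
Notation mu := (@lebesgue_measure R).
Implicit Types e u t a b : R.

Lemma is_derive_mulrl (c t : R) : is_derive t (1:R) (fun s : R => c * s) c.
Proof.
have D := @is_deriveZ R R R id c t 1 1 _.
by apply: is_derive_eq; rewrite /GRing.scale /= mulr1.
Qed.

Lemma is_derive_comp_lin (f df : R -> R) (c t : R) :
  (forall x : R, is_derive x (1:R) f (df x)) ->
  is_derive t (1:R) (fun s : R => f (c * s)) (c * df (c * t)).
Proof.
by move=> H; rewrite mulrC; apply: is_derive1_comp; exact: is_derive_mulrl.
Qed.

Lemma is_derive_expMN e t :
  is_derive t (1:R) (fun s => expR (- e * s)) (- e * expR (- e * t)).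
Proof. exact: (@is_derive_comp_lin expR expR). Qed.

Lemma is_derive_continuous (f : R -> R) (x df : R) :
  is_derive x (1:R) f df -> {for x, continuous f}.
Proof. by case=> /derivable1_diffP /differentiable_continuous. Qed.

Lemma ge0_FTC2y (f F : R -> R) (a l : R) :
  (forall x : R, is_derive x (1:R) F (f x)) -> continuous f ->
  (forall x, a <= x -> 0 <= f x) -> F x @[x --> +oo] --> l ->
  (\int[mu]_(x in `[a, +oo[) (f x)%:E = (l - F a)%:E)%E.
Proof.
move=> dF cf f0 Fl; rewrite (ge0_continuous_FTC2y f0 _ Fl)//.
- exact: continuous_subspaceT.
- exact: cvg_at_right_filter (is_derive_continuous (dF a)).
- by move=> x _; rewrite derive1E derive_val.
Qed.

Lemma RFTC2 (f F : R -> R) (a b : R) : a <= b ->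
  (forall x : R, a <= x <= b -> is_derive x (1:R) F (f x)) ->
  {within `[a, b], continuous f} ->
  \int[mu]_(x in `[a, b]) f x = F b - F a.
Proof.
rewrite le_eqVlt => /predU1P[<- _ _|ab dF cf].
  by rewrite set_itv1 Rintegral_set1 subrr.
rewrite /Rintegral (continuous_FTC2 ab cf (F := F))//.
- split.
  + by move=> x /[!in_itv]/= /andP[ax xb]; have [|//] := dF x; rewrite !ltW.
  + by apply: cvg_at_right_filter; apply: is_derive_continuous (dF a _); rewrite lexx ltW.
  + by apply: cvg_at_left_filter; apply: is_derive_continuous (dF b _); rewrite lexx ltW.
- move=> x /[!in_itv]/= /andP[ax xb].
  by have D : is_derive x (1:R) F (f x); [apply: dF; rewrite !ltW|rewrite derive1E derive_val].
Qed.

Lemma cvg_expMN e : 0 < e -> expR (- e * t) @[t --> +oo] --> (0 : R).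
Proof.
move=> e0; under eq_fun do rewrite mulNr.
apply: (@cvg_comp _ _ _ (fun t => e * t) (fun t => expR (- t)) _ +oo); last exact: cvgr_expR.
by apply: gt0_cvgMry => //; exact: cvg_id.
Qed.

Lemma integral_expR e : 0 < e ->
  (\int[mu]_(t in `[0%R, +oo[) (expR (- e * t))%:E = (e^-1)%:E)%E.
Proof.
move=> e0.
have D (x : R) : is_derive x (1:R) (fun t => - e^-1 * expR (- e * t)) (expR (- e * x)).
  have dexp := is_derive_expMN e x.
  apply: is_derive_eq; rewrite /GRing.scale /=.
  by field; rewrite gt_eqF.
rewrite (ge0_FTC2y D (l := 0)).
- by rewrite mulr0 expR0 mulr1 sub0r opprK.
- by move=> x; exact: is_derive_continuous (is_derive_expMN e x).
- by move=> t _; exact: expR_ge0.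
- rewrite -[X in _ --> X](mulr0 (- e^-1)).
  by apply: cvgM; [exact: cvg_cst|exact: cvg_expMN].
Qed.

Lemma integrable_expR e : 0 < e ->
  mu.-integrable `[0%R, +oo[ (EFin \o (fun t => expR (- e * t))).
Proof.
move=> e0; apply/integrableP; split.
  apply/measurable_EFinP; apply: measurable_funTS.
  apply: continuous_measurable_fun => x.
  exact: is_derive_continuous (is_derive_expMN e x).
under eq_integral do rewrite /= ger0_norm ?expR_ge0//.
by rewrite integral_expR ?ltry.
Qed.

(** [ge0_FTC2y] wants a nonnegative integrand, so 1 + cos is integrated in place of cos and the
    integral of the exponential is subtracted afterwards. *)
Lemma integral_expR_cos e u : 0 < e ->
  \int[mu]_(t in `[0, +oo[) (expR (- e * t) * cos (u * t)) = e / (e ^+ 2 + u ^+ 2).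
Proof.
move=> e0.
have D0 : e ^+ 2 + u ^+ 2 != 0 by rewrite gt_eqF// ltr_pwDl// ?exprn_gt0// sqr_ge0.
pose f t := expR (- e * t) * (1 + cos (u * t)).
pose F t := expR (- e * t) * (- e^-1 + (u * sin (u * t) - e * cos (u * t)) / (e ^+ 2 + u ^+ 2)).
have dcos t : is_derive t (1:R) (fun s => cos (u * s)) (u * - sin (u * t)).
  exact: (@is_derive_comp_lin cos (fun x => - sin x)).
have dsin t : is_derive t (1:R) (fun s => sin (u * s)) (u * cos (u * t)).
  exact: (@is_derive_comp_lin sin cos).
have dexp := is_derive_expMN e.
have cf : continuous f.
  move=> t; apply: cvgM; first exact: is_derive_continuous (dexp t).
  apply: cvgD; first exact: cvg_cst.
  exact: is_derive_continuous (dcos t).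
have If : (\int[mu]_(t in `[0%R, +oo[) (f t)%:E = (e^-1 + e / (e ^+ 2 + u ^+ 2))%:E)%E.
  have D (x : R) : is_derive x (1:R) F (f x).
    rewrite /F /f; apply: is_derive_eq.
    rewrite /GRing.scale /=.
    by field; rewrite D0 gt_eqF.
  rewrite (ge0_FTC2y D cf (l := 0)).
  - rewrite /F !mulr0 expR0 sin0 cos0 mulr0 mul1r mulr1 !sub0r mulNr.
    by congr EFin; ring.
  - by move=> t _; rewrite mulr_ge0 ?expR_ge0// -lerBlDl sub0r cos_geN1.
  - pose K := e^-1 + (`|u| + e) / (e ^+ 2 + u ^+ 2).
    have FK t : `|F t| <= K * expR (- e * t).
      rewrite /F normrM ger0_norm ?expR_ge0// mulrC ler_wpM2r ?expR_ge0//.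
      rewrite (le_trans (ler_normD _ _))// normrN ger0_norm ?invr_ge0 ?(ltW e0)// /K lerD2l.
      rewrite normrM [X in _ * X <= _]ger0_norm ?invr_ge0 ?addr_ge0 ?sqr_ge0//.
      rewrite ler_wpM2r ?invr_ge0 ?addr_ge0 ?sqr_ge0//.
      rewrite (le_trans (ler_normB _ _))// !normrM lerD//.
        by rewrite ler_piMr// sin_max.
      by rewrite (gtr0_norm e0) ler_piMr ?cos_max// ltW.
    apply: (@norm_squeeze0 _ _ _ _ F (fun t => K * expR (- e * t))); first exact: nearW.
    rewrite -[X in _ --> X](mulr0 K).
    by apply: cvgM; [exact: cvg_cst|exact: cvg_expMN].
have fE t : expR (- e * t) * cos (u * t) = f t - expR (- e * t) by rewrite /f; ring.
under eq_Rintegral do rewrite fE.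
rewrite RintegralB//; last 2 first.
- apply/integrableP; split.
    apply/measurable_EFinP; apply: measurable_funTS.
    exact: continuous_measurable_fun.
  under eq_integral do rewrite /= ger0_norm ?mulr_ge0 ?expR_ge0// -?lerBlDl ?sub0r ?cos_geN1//.
  by rewrite If ltry.
- exact: integrable_expR.
by rewrite /Rintegral If integral_expR//=; ring.
Qed.

Lemma continuous_poisson_kernel e : 0 < e -> continuous (fun u => e / (e ^+ 2 + u ^+ 2)).
Proof.
move=> e0 u; apply: cvgM; first exact: cvg_cst.
apply: cvgV; first by rewrite gt_eqF// ltr_pwDl// ?exprn_gt0// sqr_ge0.
by apply: cvgD; [exact: cvg_cst|exact: exprn_continuous].
Qed.

Lemma poisson_kernel_le e u : 0 < e -> 0 <= e / (e ^+ 2 + u ^+ 2) <= e^-1.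
Proof.
move=> e0; have e2 : 0 < e ^+ 2 by rewrite exprn_gt0.
have eu : 0 < e ^+ 2 + u ^+ 2 by rewrite ltr_pwDl// sqr_ge0.
apply/andP; split; first by rewrite divr_ge0 ?(ltW e0) ?(ltW eu).
rewrite ler_pdivrMr//.
have -> : e^-1 * (e ^+ 2 + u ^+ 2) = e + u ^+ 2 / e by field; rewrite gt_eqF.
by rewrite lerDl divr_ge0 ?sqr_ge0// ltW.
Qed.

Lemma integral_poisson_kernel e a b s : 0 < e -> a <= b ->
  \int[mu]_(y in `[a, b]) (e / (e ^+ 2 + (y - s) ^+ 2)) =
  atan ((b - s) / e) - atan ((a - s) / e).
Proof.
move=> e0 ab; apply: (@RFTC2 _ (fun y => atan ((y - s) / e))) => //.
- move=> y _.
  have D : is_derive y (1:R) (fun y : R => (y - s) / e) (e^-1).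
    by apply: is_derive_eq; rewrite /GRing.scale /=; ring.
  apply: (@is_derive_eq _ _ _ _ _ _ _ _ (is_derive1_comp (is_derive1_atan _) D)).
  have eu : e ^+ 2 + (y - s) ^+ 2 != 0 by rewrite gt_eqF// ltr_pwDl// ?exprn_gt0// sqr_ge0.
  by field; rewrite ?eu ?gt_eqF.
- apply: continuous_subspaceT => y.
  apply: (@continuous_comp _ _ _ (fun y => y - s) (fun u => e / (e ^+ 2 + u ^+ 2))).
    by apply: cvgB; [exact: cvg_id|exact: cvg_cst].
  exact: continuous_poisson_kernel.
Qed.

End poisson_kernel.

Section levy.
Context {R : realType}.
Notation mu := (@lebesgue_measure R).

(** The closing arithmetic of the continuity theorem. The F's are values of the limit distribution
    function: at y, slightly to its left and right, and far out on both sides. The q's are masses of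
    intervals under the limit law, [p1] and [p2] those of slightly larger intervals under S n, and p
    is the probability of S n <= y. *)
Lemma squeeze_arith (Fy F1 F2 Fa Fb q1 q2 p1 p2 p k : R) :
  `|Fy - F1| < k -> `|Fy - F2| < k -> Fa < k -> 1 - Fb < k ->
  q1 - k <= p1 -> q2 - k <= p2 -> F1 - Fa <= q1 -> Fb - F2 <= q2 ->
  p1 <= p -> p2 + p <= 1 -> `|Fy - p| <= 3 * k.
Proof. by rewrite !ltr_norml ler_norml => /andP[? ?] /andP[? ?] *; apply/andP; split; lra. Qed.

Section preimages.
Context d (T : measurableType d) (P : probability T R) (S : {RV P >-> R}).
Implicit Types A B : set R.

Lemma measurable_preimage A : measurable A -> measurable (S @^-1` A).
Proof. by move=> mA; rewrite -[X in measurable X]setTI; exact: measurable_funP. Qed.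

Lemma prob_fin_num A : measurable A -> P (S @^-1` A) \is a fin_num.
Proof. by move=> mA; rewrite fin_num_measure//; exact: measurable_preimage. Qed.

Lemma prob_le A B : measurable A -> measurable B -> A `<=` B ->
  fine (P (S @^-1` A)) <= fine (P (S @^-1` B)).
Proof.
move=> mA mB AB; rewrite fine_le ?prob_fin_num// le_measure ?inE//;
  [exact: measurable_preimage|exact: measurable_preimage|by move=> w; exact: AB].
Qed.

Lemma prob_setU_le A B : measurable A -> measurable B ->
  fine (P (S @^-1` (A `|` B))) <= fine (P (S @^-1` A)) + fine (P (S @^-1` B)).
Proof.
move=> mA mB; rewrite -lee_fin EFinD !fineK ?prob_fin_num//; last exact: measurableU.
by rewrite preimage_setU measureU2//; exact: measurable_preimage.
Qed.

Lemma prob_disjoint_le1 A B : measurable A -> measurable B -> A `&` B = set0 ->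
  fine (P (S @^-1` A)) + fine (P (S @^-1` B)) <= 1.
Proof.
move=> mA mB AB; rewrite -lee_fin EFinD !fineK ?prob_fin_num// -measureU//.
- by apply: probability_le1; apply: measurableU; exact: measurable_preimage.
- exact: measurable_preimage.
- exact: measurable_preimage.
- by rewrite -preimage_setI AB preimage_set0.
Qed.

Lemma integrable_indic_comp A : measurable A ->
  P.-integrable setT (EFin \o (fun w => \1_A (S w))).
Proof.
move=> mA; apply: (@probability_integrable _ _ _ P _ 1).
  by apply: (measurableT_comp (f := (\1_A : R -> R))) => //; exact: measurable_indic.
by move=> w; rewrite indicE; case: (_ \in _) => /=; rewrite ?normr1 ?normr0.
Qed.

Lemma Rintegral_indic_comp A : measurable A ->
  \int[P]_w \1_A (S w) = fine (P (S @^-1` A)).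
Proof.
move=> mA; rewrite /Rintegral; congr fine.
rewrite (_ : (fun w => _) = (fun w => (\1_(S @^-1` A) w)%:E)); last first.
  by apply/funext => w; rewrite !indicE; congr (_%:R%:E); apply/idP/idP; rewrite !inE.
by rewrite integral_indic// ?setIT//; exact: measurable_preimage.
Qed.

End preimages.

Lemma measurable_cos_affine d (T : measurableType d) (P : probability T R)
  (S : {RV P >-> R}) (t c : R) : measurable_fun setT (fun w => cos (t * S w + c)).
Proof.
apply: (measurableT_comp (f := cos)).
  by apply: continuous_measurable_fun; exact: continuous_cos.
by apply: measurable_funD => //; apply: measurable_funM.
Qed.

Section smoothing.
Context d (T : measurableType d) (P : probability T R) (S : {RV P >-> R}).

(** The kernel is written as a Laplace transform of a cosine and the expectation is taken inside.
    The form cos(- t S + t y) exhibits a frequency and a phase, the shape in which convergence will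
    be assumed. *)
Lemma expectation_poisson_kernel (e y : R) : 0 < e ->
  \int[P]_w (e / (e ^+ 2 + (y - S w) ^+ 2)) =
  \int[mu]_(t in `[0, +oo[) (expR (- e * t) * \int[P]_w cos (- t * S w + t * y)).
Proof.
move=> e0.
have E (t s : R) : (y - s) * t = - t * s + t * y by ring.
under eq_Rintegral do rewrite -integral_expR_cos//.
rewrite (@RFubini _ _ _ _ _ P mu setT measurableT _ _
  (fun z => expR (- e * z.2) * cos ((y - S z.1) * z.2)) (cst 1) (fun t => expR (- e * t)))//.
- apply: eq_Rintegral => t _.
  rewrite -RintegralZl//.
    by apply: eq_Rintegral => w _; rewrite -E.
  apply: (@probability_integrable _ _ _ P _ 1) => [|w]; last exact: cos_max.
  exact: measurable_cos_affine.
- apply: measurable_funM.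
    apply: (measurableT_comp (f := fun t => expR (- e * t))) => //.
    apply: continuous_measurable_fun => t.
    exact: is_derive_continuous (is_derive_expMN e t).
  apply: (measurableT_comp (f := cos)).
    by apply: continuous_measurable_fun; exact: continuous_cos.
  apply: measurable_funM => //; apply: measurable_funB => //.
  exact: measurableT_comp.
- exact: (finite_measure_integrable_cst P 1 measurableT).
- exact: integrable_expR.
- by move=> w t _ _ /=; rewrite normrM mul1r ger0_norm ?expR_ge0// ler_piMr ?expR_ge0 ?cos_max.
Qed.

(** The atan difference is the Poisson kernel integrated over [a, b]: for small e, a smooth version
    of pi times the indicator of that interval. *)
Lemma expectation_atan (e a b : R) : 0 < e -> a <= b ->
  \int[P]_w (atan ((b - S w) / e) - atan ((a - S w) / e)) =
  \int[mu]_(y in `[a, b]) \int[mu]_(t in `[0, +oo[)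
    (expR (- e * t) * \int[P]_w cos (- t * S w + t * y)).
Proof.
move=> e0 ab.
under eq_Rintegral do rewrite -integral_poisson_kernel//.
rewrite (@RFubini _ _ _ _ _ P mu setT measurableT _ _
  (fun z => e / (e ^+ 2 + (z.2 - S z.1) ^+ 2)) (cst 1) (cst e^-1))//.
- by apply: eq_Rintegral => y _; rewrite expectation_poisson_kernel.
- have mp : measurable_fun setT (fun u : R => e / (e ^+ 2 + u ^+ 2)).
    by apply: continuous_measurable_fun; exact: continuous_poisson_kernel.
  apply: (measurableT_comp mp).
  by apply: measurable_funB => //; exact: measurableT_comp.
- exact: (finite_measure_integrable_cst P 1 measurableT).
- by apply: (@bounded_integrable _ _ _ mu _ _ _ e^-1) => //= *;
    rewrite ?ger0_norm ?invr_ge0 ?(ltW e0)// lebesgue_measure_itv/=; case: ifP => _; rewrite ?ltry// -EFinB ltry.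
- move=> w y _ _ /=; rewrite mul1r.
  by have /andP[p0 p1] := poisson_kernel_le (y - S w) e0; rewrite ger0_norm.
Qed.

End smoothing.

(** * From smoothed indicators to distribution functions *)

Section continuity_theorem.
Context d (T : measurableType d) (P : probability T R) (S : nat -> {RV P >-> R}).
Context d' (T' : measurableType d') (Q : probability T' R) (N : {RV Q >-> R}).
Hypothesis cf_cvg : forall t c : R,
  \int[P]_w cos (t * S n w + c) @[n --> \oo] --> \int[Q]_w cos (t * N w + c).

Let cf_le d1 (T1 : measurableType d1) (P1 : probability T1 R) (X : {RV P1 >-> R})
  (t c : R) : `|\int[P1]_w cos (t * X w + c)| <= 1.
Proof.
apply: normr_expectation_le => [|w]; last exact: cos_max.
exact: measurable_cos_affine.
Qed.

(** Two nested dominated convergences: the inner integrand is dominated by exp(-e t), hence the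
    inner integral by 1/e, which is integrable over the bounded interval [a, b]. *)
Let cvg_expectation_atan (e a b : R) : 0 < e -> a <= b ->
  \int[P]_w (atan ((b - S n w) / e) - atan ((a - S n w) / e)) @[n --> \oo] -->
  \int[Q]_w (atan ((b - N w) / e) - atan ((a - N w) / e)).
Proof.
move=> e0 ab.
under eq_fun do rewrite expectation_atan//.
rewrite expectation_atan//.
have mexp : measurable_fun setT (fun t : R => expR (- e * t)).
  apply: continuous_measurable_fun => t.
  exact: is_derive_continuous (is_derive_expMN e t).
have mcf d1 (T1 : measurableType d1) (P1 : probability T1 R) (X : {RV P1 >-> R}) (y : R) :
    measurable_fun (`[0%R, +oo[%classic : set R)
      (fun t : R => expR (- e * t) * \int[P1]_w cos (- t * X w + t * y)).
  rewrite (_ : (fun t : R => _) = (fun t : R => \int[P1]_w (expR (- e * t) * cos (- t * X w + t * y)))).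
    apply: measurable_funTS.
    apply: (measurable_Rintegral_param P1 (f := fun z : R * T1 =>
      expR (- e * z.1) * cos (- z.1 * X z.2 + z.1 * y))) => //.
    apply: measurable_funM; first exact: (measurableT_comp mexp).
    apply: (measurableT_comp (f := cos)).
      by apply: continuous_measurable_fun; exact: continuous_cos.
    apply: measurable_funD; last exact: measurable_funM.
    apply: measurable_funM; first exact: measurableT_comp.
    exact: measurableT_comp.
  apply/funext => t; rewrite RintegralZl//.
  apply: (@probability_integrable _ _ _ P1 _ 1) => [|w]; last exact: cos_max.
  exact: measurable_cos_affine.
have ie1 : mu.-integrable `[a, b] (EFin \o cst e^-1).
  apply: (@bounded_integrable _ _ _ mu _ _ _ e^-1) => //= *; last first.
    by rewrite ger0_norm ?invr_ge0 ?(ltW e0).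
  by rewrite lebesgue_measure_itv/=; case: ifP => _; rewrite ?ltry// -EFinB ltry.
have mcf2 d1 (T1 : measurableType d1) (P1 : probability T1 R) (X : {RV P1 >-> R}) :
    measurable_fun (`[a, b]%classic : set R) (fun y : R => \int[mu]_(t in `[0, +oo[)
      (expR (- e * t) * \int[P1]_w cos (- t * X w + t * y))).
  rewrite (_ : (fun y : R => _) = (fun y => \int[P1]_w (e / (e ^+ 2 + (y - X w) ^+ 2)))); last first.
    by apply/funext => y; rewrite expectation_poisson_kernel.
  have mp : measurable_fun setT (fun u : R => e / (e ^+ 2 + u ^+ 2)).
    by apply: continuous_measurable_fun; exact: continuous_poisson_kernel.
  apply: measurable_funTS.
  apply: (measurable_Rintegral_param P1 (f := fun z : R * T1 => e / (e ^+ 2 + (z.1 - X z.2) ^+ 2))) => //.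
  apply: (measurableT_comp mp).
  by apply: measurable_funB => //; exact: measurableT_comp.
have cf1 d1 (T1 : measurableType d1) (P1 : probability T1 R) (X : {RV P1 >-> R}) (y t : R) :
   `|expR (- e * t) * \int[P1]_w cos (- t * X w + t * y)| <= expR (- e * t).
  by rewrite normrM ger0_norm ?expR_ge0// ler_piMr ?expR_ge0.
apply: (@Rdominated_cvg _ _ _ mu `[a, b]%classic _ _ _ (cst e^-1)) => //.
- by move=> n; exact: mcf2.
- exact: mcf2.
- move=> y _; apply: (@Rdominated_cvg _ _ _ mu `[0%R, +oo[%classic _ _ _ (fun t => expR (- e * t))) => //.
  + by move=> n; exact: mcf.
  + exact: mcf.
  + by move=> t _; apply: cvgM; [exact: cvg_cst|exact: cf_cvg].
  + exact: integrable_expR.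
- move=> n y _.
  have ie := integrable_expR e0.
  have ic : mu.-integrable `[0%R, +oo[ (EFin \o
      (fun t : R => expR (- e * t) * \int[P]_w cos (- t * S n w + t * y))).
    by apply: (@le_Rintegrable _ _ _ mu _ _ _ (fun t => expR (- e * t))) => //; exact: mcf.
  apply: (le_trans (le_normr_Rintegral _ _)) => //.
  apply: (@le_trans _ _ (\int[mu]_(t in `[0, +oo[) expR (- e * t))).
    by apply: le_Rintegral => //; exact: integrable_norm.
  by rewrite /Rintegral integral_expR.
Qed.

Let mD (e a b : R) d1 (T1 : measurableType d1) (P1 : probability T1 R) (X : {RV P1 >-> R}) :
  measurable_fun setT (fun w => atan ((b - X w) / e) - atan ((a - X w) / e)).
Proof.
have ma : measurable_fun setT (@atan R).
  by apply: continuous_measurable_fun => x; exact: continuous_atan.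
by apply: measurable_funB; apply: (measurableT_comp ma);
  apply: measurable_funM => //; exact: measurable_funB.
Qed.

(* atan differences vs. indicators of the slightly enlarged, resp. shrunk interval *)
Let atan_ub (e a b r s : R) : 0 < e -> 0 < r -> a <= b ->
  atan ((b - s) / e) - atan ((a - s) / e) <=
  pi * \1_(`[a - r, b + r] : set R) s + (pi / 2 - atan (r / e)).
Proof.
move=> e0 r0 ab.
have re : 0 < r / e by rewrite divr_gt0.
have u1 := atan_ltpi2 ((b - s) / e); have u2 := atan_gtNpi2 ((a - s) / e).
have u3 := atan_ltpi2 (r / e).
rewrite indicE; have [|] := boolP (s \in _); first by move=> _; rewrite mulr1; lra.
rewrite mulr0 add0r notin_setE/= in_itv/= => /negP; rewrite negb_and -!ltNge => /orP[sa|bs].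
- have : r / e <= (a - s) / e by rewrite ler_pM2r ?invr_gt0//; lra.
  by move=> /le_atan; lra.
- have : (b - s) / e <= - (r / e) by rewrite -mulNr ler_pM2r ?invr_gt0//; lra.
  by move=> /le_atan; rewrite atanN; lra.
Qed.

Let atan_lb (e a b r s : R) : 0 < e -> 0 < r -> a <= b ->
  pi * \1_(`[a + r, b - r] : set R) s - 2 * (pi / 2 - atan (r / e)) <=
  atan ((b - s) / e) - atan ((a - s) / e).
Proof.
move=> e0 r0 ab.
have u3 := atan_ltpi2 (r / e).
rewrite indicE; have [|] := boolP (s \in _); last first.
  have : (a - s) / e <= (b - s) / e by rewrite ler_pM2r ?invr_gt0//; lra.
  by move=> /le_atan; rewrite mulr0; lra.
rewrite inE/= in_itv/= => /andP[as_ sb]; rewrite mulr1.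
have /le_atan : r / e <= (b - s) / e by rewrite ler_pM2r ?invr_gt0//; lra.
have /le_atan : (a - s) / e <= - (r / e) by rewrite -mulNr ler_pM2r ?invr_gt0//; lra.
by rewrite atanN; lra.
Qed.

(** The smoothed indicator of [a, b] is squeezed between the indicators of the shrunk and the
    enlarged interval. Only this lower bound is needed: an upper bound for a half-line comes from a
    lower bound on a disjoint interval. *)
Let itv_liminf (a b r k : R) : a <= b -> 0 < r -> 0 < k ->
  \forall n \near \oo, fine (Q (N @^-1` `[a + r, b - r])) - k <=
    fine (P (S n @^-1` `[a - r, b + r])).
Proof.
move=> ab r0 k0.
have pi0 : 0 < pi :> R by exact: pi_gt0.
(* Four errors of size at most [k'] add up: one from the limit, one from [atan_ub], two from
   [atan_lb]; the indicators carry a factor pi. *)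
pose k' := k * pi / 4.
have k'0 : 0 < k' by rewrite divr_gt0 ?mulr_gt0.
have [e e0 ek] : exists2 e : R, 0 < e & pi / 2 - atan (r / e) < k'.
  have /cvgrPdist_lt /(_ k' k'0) [M [_ atanM]] := @cvgy_atan R.
  pose M' := Num.max M 0 + 1.
  have M'0 : 0 < M' by rewrite ltr_wpDl// le_max lexx orbT.
  exists (r / M'); first by rewrite divr_gt0.
  have -> : r / (r / M') = M' by field; rewrite !gt_eqF.
  have /atanM : M < M' by rewrite ltr_pwDr// le_max lexx.
  by apply: le_lt_trans; exact: ler_norm.
have /cvgrPdist_lt /(_ k' k'0) := cvg_expectation_atan e0 ab.
apply: filterS => n; rewrite ltr_distlC => /andP[+ _].
rewrite -!Rintegral_indic_comp//.
have iD d1 (T1 : measurableType d1) (P1 : probability T1 R) (X : {RV P1 >-> R}) :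
    P1.-integrable setT (EFin \o (fun w => atan ((b - X w) / e) - atan ((a - X w) / e))).
  apply: (@probability_integrable _ _ _ P1 _ pi); first exact: mD.
  move=> w; have u1 := atan_ltpi2 ((b - X w) / e); have u2 := atan_gtNpi2 ((b - X w) / e).
  have u3 := atan_ltpi2 ((a - X w) / e); have u4 := atan_gtNpi2 ((a - X w) / e).
  by rewrite ler_norml; apply/andP; split; lra.
have iI d1 (T1 : measurableType d1) (P1 : probability T1 R) (X : {RV P1 >-> R}) (A : set R) :
    measurable A -> P1.-integrable setT (EFin \o (fun w => pi * \1_A (X w))).
  by move=> mA; exact: (integrableZl measurableT pi (integrable_indic_comp X mA)).
have iC d1 (T1 : measurableType d1) (P1 : probability T1 R) (c : R) :
  P1.-integrable setT (EFin \o cst c) by exact: (finite_measure_integrable_cst P1 c measurableT).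
have mS : measurable (`[a - r, b + r]%classic : set R) by [].
have mN : measurable (`[a + r, b - r]%classic : set R) by [].
have : \int[P]_w (atan ((b - S n w) / e) - atan ((a - S n w) / e)) <=
    pi * \int[P]_w \1_(`[a - r, b + r]%classic : set R) (S n w) + (pi / 2 - atan (r / e)).
  rewrite -RintegralZl//; last exact: integrable_indic_comp.
  rewrite -[X in _ + X]mulr1 -[X in _ + _ * X](_ : fine (P setT) = 1); last by rewrite probability_setT.
  rewrite -Rintegral_cst// -RintegralD//; [|exact: iI|exact: iC].
  apply: le_Rintegral => //; first exact: iD.
    exact: (integrableD measurableT (iI _ _ _ (S n) _ mS) (iC _ _ P _)).
  by move=> w _; exact: atan_ub.
have : pi * \int[Q]_w \1_(`[a + r, b - r]%classic : set R) (N w) - 2 * (pi / 2 - atan (r / e))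
    <= \int[Q]_w (atan ((b - N w) / e) - atan ((a - N w) / e)).
  rewrite -RintegralZl//; last exact: integrable_indic_comp.
  rewrite -[X in _ - X]mulr1 -[X in _ - _ * X](_ : fine (Q setT) = 1); last by rewrite probability_setT.
  rewrite -Rintegral_cst// -RintegralB//; [|exact: iI|exact: iC].
  apply: le_Rintegral => //; last 2 first.
  - exact: iD.
  - by move=> w _; exact: atan_lb.
  exact: (integrableB measurableT (iI _ _ _ N _ mN) (iC _ _ Q _)).
set p := \int[P]_w \1__ _; set q := \int[Q]_w \1__ _ => Hq Hp HD.
rewrite -(ler_pM2l pi0) mulrBr.
have -> : pi * k = 4 * k' by rewrite /k'; field.
by lra.
Qed.

Let cdfE z : fine (cdf N z) = fine (Q (N @^-1` `]-oo, z])).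
Proof. by []. Qed.

Let cdf_itv (u v : R) : u <= v ->
  fine (cdf N v) - fine (cdf N u) <= fine (Q (N @^-1` `[u, v])).
Proof.
move=> uv; rewrite !cdfE lerBlDr; apply: le_trans (prob_setU_le _ _ _) => //.
apply: prob_le => //; first exact: measurableU.
move=> w /=; rewrite !in_itv/= => wv; have [uw|wu] := leP u w.
  by left; rewrite wv.
by right; rewrite ltW.
Qed.

(** [itv_liminf] is applied to an interval ending just left of y and to one starting just right of
    it. The first bounds the probability of S n <= y from below, the second that of the complement.
    Since both intervals reach far into the tails of N, almost no mass is lost. *)
Theorem levy_continuity (y : R) : {for y, continuous (cdf N)} ->
  P (S n @^-1` `]-oo, y]) @[n --> \oo] --> cdf N y.
Proof.
move=> cy.
have fN z : cdf N z = (fine (cdf N z))%:E by rewrite fineK// -[cdf N z]/(Q (N @^-1` `]-oo, z])) prob_fin_num.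
rewrite fN; apply/fine_cvgP; split.
  by apply: nearW => n; exact: prob_fin_num.
have cyr : fine (cdf N z) @[z --> y] --> fine (cdf N y).
  by apply: fine_cvg; rewrite -fN.
apply/cvgrPdist_le => k k0.
pose k' := k / 3; have k'0 : 0 < k' by rewrite divr_gt0.
have /cvgrPdist_lt/(_ k' k'0) := cyr.
move=> /nbhs_ballP[r0 /= r00 yr].
(* The largest displacement from y is 3 r, which has to stay below [r0]. *)
pose r := r0 / 4; have r_gt0 : 0 < r by rewrite divr_gt0.
have y1 : `|fine (cdf N y) - fine (cdf N (y - 2 * r))| < k'.
  by apply: yr; rewrite /ball/= opprB addrC subrK ger0_norm ?mulr_ge0 ?(ltW r_gt0)// /r; lra.
have y2 : `|fine (cdf N y) - fine (cdf N (y + 3 * r))| < k'.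
  apply: yr; rewrite /ball/= opprD addNKr normrN ger0_norm ?mulr_ge0 ?(ltW r_gt0)// /r; lra.
have [a ay aN] : exists2 a, a <= y - 2 * r & fine (cdf N (a + r)) < k'.
  have : fine (cdf N z) @[z --> -oo] --> (0 : R) by apply: fine_cvg; exact: cvg_cdfNy0.
  move=> /cvgrPdist_lt/(_ k' k'0) [M [_ HM]].
  exists (Num.min (y - 2 * r) (M - 1 - r)); first by rewrite ge_min lexx.
  have : Num.min (y - 2 * r) (M - 1 - r) + r < M.
    have : Num.min (y - 2 * r) (M - 1 - r) <= M - 1 - r by rewrite ge_min lexx orbT.
    lra.
  by move=> /HM; rewrite sub0r normrN => /(le_lt_trans (ler_norm _)).
have [b yb bN] : exists2 b, y + 2 * r + 2 * r <= b & 1 - fine (cdf N (b - r)) < k'.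
  have : fine (cdf N z) @[z --> +oo] --> (1 : R) by apply: fine_cvg; exact: cvg_cdfy1.
  move=> /cvgrPdist_lt/(_ k' k'0) [M [_ HM]].
  exists (Num.max (y + 2 * r + 2 * r) (M + 1 + r)); first by rewrite le_max lexx.
  have : M < Num.max (y + 2 * r + 2 * r) (M + 1 + r) - r.
    have : M + 1 + r <= Num.max (y + 2 * r + 2 * r) (M + 1 + r) by rewrite le_max lexx orbT.
    lra.
  by move=> /HM; exact: (le_lt_trans (ler_norm _)).
have ay' : a <= y - r by lra.
have yb' : y + 2 * r <= b by lra.
have yb2 : y + 2 * r + r <= b - r by lra.
have yyr : y < y + 2 * r - r by lra.
have H1 := itv_liminf ay' r_gt0 k'0.
have H2 := itv_liminf yb' r_gt0 k'0.
near=> n.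
have H1' : fine (Q (N @^-1` `[a + r, y - r - r])) - k' <= fine (P (S n @^-1` `[a - r, y - r + r])).
  by near: n; exact: H1.
have H2' : fine (Q (N @^-1` `[y + 2 * r + r, b - r])) - k' <= fine (P (S n @^-1` `[y + 2 * r - r, b + r])).
  by near: n; exact: H2.
have C1 : fine (cdf N (y - r - r)) - fine (cdf N (a + r)) <= fine (Q (N @^-1` `[a + r, y - r - r])).
  have [|/ltW yra] := leP (a + r) (y - r - r); first exact: cdf_itv.
  apply: (@le_trans _ _ 0); last by rewrite fine_ge0.
  by rewrite subr_le0 !cdfE; apply: prob_le => // w /=; rewrite !in_itv/= => /le_trans; apply.
have C2 : fine (cdf N (b - r)) - fine (cdf N (y + 2 * r + r)) <= fine (Q (N @^-1` `[y + 2 * r + r, b - r])).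
  exact: cdf_itv.
have P1 : fine (P (S n @^-1` `[a - r, y - r + r])) <= fine (P (S n @^-1` `]-oo, y])).
  by apply: prob_le => // w /=; rewrite !in_itv/= subrK => /andP[].
have P2 : fine (P (S n @^-1` `[y + 2 * r - r, b + r])) + fine (P (S n @^-1` `]-oo, y])) <= 1.
  apply: prob_disjoint_le1 => //.
  apply/eqP/negPn/negP => /set0P [w [/=]]; rewrite !in_itv/= => /andP[yw _] wy.
  by have := lt_le_trans yyr (le_trans yw wy); rewrite ltxx.
have E1 : y - r - r = y - 2 * r by rewrite mulr2n mulrDl mul1r opprD addrA.
have E2 : y + 2 * r + r = y + 3 * r by rewrite -addrA -{2}[r]mul1r -mulrDl natr1.
rewrite E1 in C1 H1'; rewrite E2 in C2 H2'.
have -> : k = 3 * k' by rewrite /k' mulrC divfK.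
exact: (squeeze_arith y1 y2 aN bN H1' H2' C1 C2 P1 P2).
Unshelve. all: by end_near. Qed.

End continuity_theorem.
End levy.

(** * The normal law *)

Lemma Rintegral_density d (T : measurableType d) (R : realType)
    (P : probability T R) (X : T -> R) (q F : R -> R) (K : R) :
  measurable_fun setT X -> (forall x, 0 <= q x) -> measurable_fun setT q ->
  (forall A : set R, measurable A ->
    P (X @^-1` A) = (\int[lebesgue_measure]_(x in A) (q x)%:E)%E) ->
  measurable_fun setT F -> (forall x, `|F x| <= K) ->
  \int[P]_w F (X w) = \int[lebesgue_measure]_x (F x * q x).
Proof.
move=> mX q0 mq Xq mF FK.
have mX' A : measurable A -> measurable (X @^-1` A).
  by move=> mA; rewrite -[X in measurable X]setTI; exact: mX.
transitivity (\int[P]_w (cst 1 w * F (X w))).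
  by apply: eq_Rintegral => x _; rewrite mul1r.
rewrite (@Rintegral_transfer _ _ _ _ _ _ _ P lebesgue_measure (cst 1) q X idfun _ _ _ _ _ F K)//.
- by apply: eq_Rintegral => x _; rewrite mulrC.
- exact: (finite_measure_integrable_cst P 1 measurableT).
- apply/integrableP; split; first exact/measurable_EFinP.
  under eq_integral do rewrite /= ger0_norm//.
  by rewrite -Xq// preimage_setT; exact: (le_lt_trans (probability_le1 P _) (ltry _)).
- exact: measurable_id.
- move=> A mA; rewrite /Rintegral; congr fine.
  transitivity (\int[P]_w (\1_(X @^-1` A) w)%:E)%E.
    apply: eq_integral => w _; rewrite /= mul1r !indicE; congr (_%:R%:E).
  rewrite integral_indic ?setIT//; last exact: mX'.
  transitivity (\int[lebesgue_measure]_(x in A) (q x)%:E)%E; first exact: Xq.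
  rewrite [in LHS]integral_mkcond.
  apply: eq_integral => x _; rewrite patchE indicE /=.
  by case: ifP; rewrite ?mulr1 ?mulr0.
Qed.

Section normal_cf.
Context {R : realType}.
Notation mu := (@lebesgue_measure R).
Variables (s : R) (s0 : s != 0).
Let p := normal_pdf 0 s.

Let pE x : p x = normal_peak s * expR (- x ^+ 2 / (s ^+ 2 *+ 2)).
Proof. by rewrite /p normal_pdfE// /normal_fun subr0. Qed.

Let s2 : 0 < s ^+ 2. Proof. by rewrite exprn_even_gt0. Qed.

Let p_ge0 x : 0 <= p x.
Proof. by rewrite pE mulr_ge0 ?normal_peak_ge0 ?expR_ge0. Qed.

Let cp : continuous p. Proof. exact: continuous_normal_pdf. Qed.

Let ip : mu.-integrable setT (EFin \o p).
Proof. exact: integrable_normal_pdf. Qed.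

Let dp (x : R) : is_derive x (1:R) p (- x / s ^+ 2 * p x).
Proof.
rewrite (_ : p = fun x => normal_peak s * expR (- x ^+ 2 / (s ^+ 2 *+ 2))); last first.
  by apply/funext => y; rewrite pE.
apply: is_derive_eq; rewrite /GRing.scale /= .
by field.
Qed.

(** With y = |x|/|s|, half of the Gaussian exponent pays for the linear factor: y <= 1 + y^2/4 <=
    exp(y^2/4). What remains is the normal density with doubled variance, so the first moment is
    finite. *)
Let xp_le (x : R) : `|x * p x| <= `|s| * normal_peak s / normal_peak (Num.sqrt 2 * s) *
  normal_pdf 0 (Num.sqrt 2 * s) x.
Proof.
have s2s : Num.sqrt 2 * s != 0 by rewrite mulf_eq0 negb_or s0 andbT gt_eqF// sqrtr_gt0.
have pk : 0 < normal_peak (Num.sqrt 2 * s) by rewrite normal_peak_gt0.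
rewrite normal_pdfE// mulrA mulfVK ?gt_eqF// /normal_fun subr0 exprMn sqr_sqrtr//.
rewrite normrM (ger0_norm (p_ge0 x)) pE mulrCA [X in _ <= X * _]mulrC -mulrA ler_wpM2l ?normal_peak_ge0//.
pose y := `|x| / `|s|.
have ns : `|s| != 0 by rewrite normr_eq0.
have xE : `|x| = `|s| * y by rewrite /y mulrC divfK.
rewrite xE -mulrA ler_wpM2l//.
have x2E : x ^+ 2 = s ^+ 2 * y ^+ 2 by rewrite -(real_normK (num_real x)) xE exprMn real_normK ?num_real.
have -> : - x ^+ 2 / (s ^+ 2 *+ 2) = - (y ^+ 2 / 4) + (- x ^+ 2 / ((2 * s ^+ 2) *+ 2)).
  by rewrite x2E; field.
rewrite expRD mulrA ler_piMl ?expR_ge0// expRN -ler_pdivlMr ?invr_gt0 ?expR_gt0// mul1r invrK.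
apply: le_trans (expR_ge1Dx _).
have -> : 1 + y ^+ 2 / 4 = y + (y / 2 - 1) ^+ 2 by field.
by rewrite lerDl sqr_ge0.
Qed.

Let mcont (f : R -> R) : continuous f -> measurable_fun setT f.
Proof. exact: continuous_measurable_fun. Qed.

Let ixp : mu.-integrable setT (EFin \o (fun x => `|x| * p x)).
Proof.
apply: (@le_Rintegrable _ _ _ mu setT measurableT _ _ _ _
  (integrableZl measurableT _ (@integrable_normal_pdf R 0 (Num.sqrt 2 * s)))).
  by apply: measurable_funM; apply: mcont => //; exact: norm_continuous.
by move=> x _ /=; rewrite normrM normr_id -normrM; exact: xp_le.
Qed.

(** The boundary terms on [- n, n] vanish in the limit; this serves as integration by parts on the
    line. *)
Lemma integral_derive_R (F f : R -> R) : (forall x : R, is_derive x (1:R) F (f x)) ->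
  continuous f -> mu.-integrable setT (EFin \o f) ->
  F n%:R @[n --> \oo] --> (0 : R) -> F (- n%:R) @[n --> \oo] --> (0 : R) ->
  \int[mu]_x f x = 0.
Proof.
move=> dF cf fi F1 F2.
have c1 : \int[mu]_x (f x * \1_(`[- n%:R, n%:R] : set R) x) @[n --> \oo] --> \int[mu]_x f x.
  apply: (@Rdominated_cvg _ _ _ mu setT measurableT _ _ (fun x => `|f x|)) => //.
  - by move=> n; apply: measurable_funM => //; exact: mcont.
  - exact: mcont.
  - move=> x _; apply: (@cvg_near_cst _ _ (f x)).
    near=> n; rewrite indicE mem_set ?mulr1//= in_itv/= -ler_norml.
    by near: n; exact: nbhs_infty_ger.
  - exact: integrable_norm.
  - by move=> n x _; rewrite normrM indicE; case: (_ \in _); rewrite ?normr1 ?normr0 ?mulr1 ?mulr0.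
have c2 : F n%:R - F (- n%:R) @[n --> \oo] --> 0 - 0 by exact: cvgB.
rewrite subrr in c2.
suff c3 : \int[mu]_x (f x * \1_(`[- n%:R, n%:R] : set R) x) @[n --> \oo] --> (0 : R).
  exact: (cvg_unique _ c1 c3).
apply: cvg_trans c2; apply: near_eq_cvg; apply: nearW => n.
rewrite -(@RFTC2 _ f F)//; last exact: continuous_subspaceT.
  rewrite Rintegral_mkcond; apply: eq_Rintegral => x _.
  by rewrite patchE indicE; case: ifP; rewrite ?mulr1 ?mulr0.
by rewrite (@le_trans _ _ 0)// oppr_le0.
Unshelve. all: by end_near. Qed.

Let phi c t := \int[mu]_x (cos (t * x + c) * p x).

Let dcos (c t x : R) : is_derive t (1:R) (fun t => cos (t * x + c) * p x) (- (x * p x) * sin (t * x + c)).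
Proof.
by apply: is_derive_eq; rewrite /GRing.scale /=; ring.
Qed.

(** Differentiation under the integral, with majorant |x| p(x), gives the integral of - x p(x) sin(t
    x + c). As p' = - x p / s^2, Gaussian integration by parts brings back [phi], so that it solves
    a linear differential equation. *)
Let dphi c t : is_derive t (1:R) (phi c) (- s ^+ 2 * t * phi c t).
Proof.
have mcos (t' : R) : continuous (fun x : R => cos (t' * x + c)).
  move=> x; apply: (@continuous_comp _ _ _ (fun x => t' * x + c) cos); last exact: continuous_cos.
  by apply: cvgD; [exact: mulrl_continuous|exact: cvg_cst].
have msin (t' : R) : continuous (fun x : R => sin (t' * x + c)).
  move=> x; apply: (@continuous_comp _ _ _ (fun x => t' * x + c) sin); last exact: continuous_sin.
  by apply: cvgD; [exact: mulrl_continuous|exact: cvg_cst].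
have iphi (t' : R) : mu.-integrable setT (EFin \o (fun x => cos (t' * x + c) * p x)).
  apply: (@le_Rintegrable _ _ _ mu setT measurableT _ p) => //.
    by apply: measurable_funM; exact: mcont.
  by move=> x _; rewrite normrM (ger0_norm (p_ge0 x)) ler_piMl ?cos_max.
have d1 (t' x : R) : partial1of2 (fun t x => cos (t * x + c) * p x) t' x = - (x * p x) * sin (t' * x + c).
  by rewrite partial1of2E; have [] := dcos c t' x.
have D : derivable (phi c) t 1.
  apply: (@derivable_under_integral R _ _ mu (fun t x => cos (t * x + c) * p x)
    setT measurableT t (t - 1) (t + 1) _ _ _ (fun x => `|x| * p x)) => //.
  - by rewrite /= in_itv/=; apply/andP; split; lra.
  - by move=> y; rewrite mulr_ge0.
  - move=> t' x _ _; rewrite d1 normrM normrN normrM (ger0_norm (p_ge0 x)).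
    by rewrite ler_piMr ?mulr_ge0// sin_max.
(* The derivative of sin(t x + c) p(x), whose integral over the line is 0. *)
pose f (x : R) := t * (cos (t * x + c) * p x) - (x * p x) / s ^+ 2 * sin (t * x + c).
have dF (x : R) : is_derive x (1:R) (fun x : R => sin (t * x + c) * p x) (f x).
  have D' := dp x.
  by apply: is_derive_eq; rewrite /GRing.scale /= /f; field.
have cf : continuous f.
  move=> x; apply: cvgB.
    by apply: cvgM; [exact: cvg_cst|apply: cvgM; [exact: mcos|exact: cp]].
  apply: cvgM; last exact: msin.
  by apply: cvgM; [apply: cvgM; [exact: cvg_id|exact: cp]|exact: cvg_cst].
have ixs : mu.-integrable setT (EFin \o (fun x => (x * p x) / s ^+ 2 * sin (t * x + c))).
  apply: (@le_Rintegrable _ _ _ mu setT measurableT _ (fun x => (s ^+ 2)^-1 * (`|x| * p x))).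
  - apply: mcont => x; apply: cvgM; last exact: msin.
    by apply: cvgM; [apply: cvgM; [exact: cvg_id|exact: cp]|exact: cvg_cst].
  - move=> x _; rewrite !normrM (ger0_norm (p_ge0 x)) [X in _ * X * _]ger0_norm ?invr_ge0 ?(ltW s2)//.
    rewrite [leRHS]mulrC; apply: ler_piMr; last exact: sin_max.
    by rewrite mulr_ge0 ?invr_ge0 ?(ltW s2)// mulr_ge0.
  - exact: (integrableZl measurableT _ ixp).
have fi : mu.-integrable setT (EFin \o f).
  exact: (integrableB measurableT (integrableZl measurableT t (iphi t)) ixs).
have pn : p n%:R @[n --> \oo] --> (0 : R).
  have e0 : 0 < (s ^+ 2 *+ 2)^-1 by rewrite invr_gt0 pmulrn_lgt0.
  have c1 := cvg_comp _ _ cvgr_idn (cvg_expMN e0).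
  apply: (@norm_squeeze0 _ _ _ _ _ (fun n => normal_peak s * expR (- (s ^+ 2 *+ 2)^-1 * n%:R))).
    near=> n; rewrite ger0_norm// pE ler_wpM2l ?normal_peak_ge0// ler_expR !mulNr lerN2 mulrC.
    rewrite ler_wpM2r ?(ltW e0)//.
    rewrite expr2 ler_peMr// (ler_nat _ 1); near: n; exact: nbhs_infty_ge.
  rewrite -[X in _ --> X](mulr0 (normal_peak s)).
  by apply: cvgM; [exact: cvg_cst|exact: c1].
have sp (x : R) : `|sin (t * x + c) * p x| <= p x.
  by rewrite normrM (ger0_norm (p_ge0 x)) ler_piMl ?sin_max.
have f0 : \int[mu]_x f x = 0.
  apply: (integral_derive_R dF cf fi).
  - by apply: (@norm_squeeze0 _ _ _ _ _ (fun n => p n%:R)) => //; exact: nearW.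
  - apply: (@norm_squeeze0 _ _ _ _ _ (fun n => p n%:R)) => //; apply: nearW => n.
    by rewrite (le_trans (sp _))// !pE sqrrN.
have int_d1 : \int[mu]_x (- (x * p x) * sin (t * x + c)) = - s ^+ 2 * t * phi c t.
  have -> : - s ^+ 2 * t * phi c t = s ^+ 2 * (\int[mu]_x f x - t * phi c t) by rewrite f0; ring.
  rewrite /phi -RintegralZl// -RintegralB//; last exact: (integrableZl measurableT t (iphi t)).
  rewrite -RintegralZl//; last first.
    exact: (integrableB measurableT fi (integrableZl measurableT t (iphi t))).
  have E (x : R) : - (x * p x) * sin (t * x + c) = s ^+ 2 * (f x - t * (cos (t * x + c) * p x)).
    by rewrite /f; field.
  by apply: eq_Rintegral => x _; exact: E.
have DE : (phi c)^`()%classic t = - s ^+ 2 * t * phi c t.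
  rewrite (@differentiation_under_integral R _ _ mu (fun t x => cos (t * x + c) * p x)
    setT measurableT t (t - 1) (t + 1) _ _ _ (fun x => `|x| * p x)) => //.
  - under eq_Rintegral do rewrite d1.
    exact: int_d1.
  - by rewrite /= in_itv/=; apply/andP; split; lra.
  - by move=> y; rewrite mulr_ge0.
  - move=> t' x _ _; rewrite d1 normrM normrN normrM (ger0_norm (p_ge0 x)).
    by rewrite ler_piMr ?mulr_ge0// sin_max.
by rewrite -DE derive1E; exact: DeriveDef.
Unshelve. all: by end_near. Qed.

Let phi0 c : phi c 0 = cos c.
Proof.
rewrite /phi; under eq_Rintegral do rewrite mul0r add0r.
by rewrite RintegralZl// /Rintegral (@integral_normal_pdf R 0 s) mulr1.
Qed.

Lemma integral_cos_normal_pdf c t :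
  \int[mu]_x (cos (t * x + c) * p x) = cos c * expR (- (s ^+ 2 * t ^+ 2 / 2)).
Proof.
(* The integrating factor of the equation in [dphi]; the product is therefore constant and equal to
   its value at 0. *)
have dE (u : R) : is_derive u (1:R) (fun u => expR (s ^+ 2 * u ^+ 2 / 2) * phi c u) 0.
  have D := dphi c u.
  by apply: is_derive_eq; rewrite /GRing.scale /=; field.
have := is_derive_0_is_cst t 0 dE.
rewrite phi0 expr0n/= mulr0 mul0r expR0 mul1r -/(phi c t) expRN => <-.
by rewrite mulrAC divff ?mul1r// gt_eqF ?expR_gt0.
Qed.

Lemma integral_cos_normal_prob c t :
  \int[normal_prob 0 s]_x cos (t * x + c) = expR (- (s ^+ 2 * t ^+ 2 / 2)) * cos c.
Proof.
rewrite mulrC -integral_cos_normal_pdf.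
apply: (@Rintegral_density _ _ _ (normal_prob 0 s) idfun _ (fun x => cos (t * x + c)) 1) => //.
- exact: measurable_id.
- exact: mcont.
- apply: mcont => x; apply: (@continuous_comp _ _ _ (fun x => t * x + c) cos); last exact: continuous_cos.
  by apply: cvgD; [exact: mulrl_continuous|exact: cvg_cst].
- by move=> x; exact: cos_max.
Qed.

End normal_cf.

(** * Triangular arrays *)

Section taylor.
Context {R : realType}.
Implicit Types x y : R.

Lemma ge0_derive_ge0 (f df : R -> R) : (forall x : R, is_derive x (1:R) f (df x)) ->
  (forall x, 0 <= x -> 0 <= df x) -> f 0 = 0 -> forall y, 0 <= y -> 0 <= f y.
Proof.
move=> fdf df0 f0 y y0.
have cf : {within `[0, y], continuous f}.
  by apply: continuous_subspaceT => x; exact: is_derive_continuous (fdf x).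
have [c /[!in_itv]/= /andP[c0 _]] := MVT_segment y0 (fun x _ => fdf x) cf.
by rewrite f0 !subr0 => ->; rewrite mulr_ge0// df0.
Qed.

Lemma subr_sin_ge0 x : 0 <= x -> 0 <= x - sin x.
Proof.
apply: (@ge0_derive_ge0 (fun x => x - sin x) (fun x => 1 - cos x)).
- by move=> z _; rewrite subr_ge0 cos_le1.
- by rewrite sin0 subr0.
Qed.

Lemma cos_ge_taylor x : 0 <= x -> 0 <= cos x - 1 + x ^+ 2 / 2.
Proof.
apply: (@ge0_derive_ge0 (fun x => cos x - 1 + x ^+ 2 / 2) (fun x => x - sin x)).
- by move=> z; apply: is_derive_eq; rewrite /GRing.scale /=; field.
- exact: subr_sin_ge0.
- by rewrite cos0 expr0n/=; ring.
Qed.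

(** Each remainder is the derivative of the next, starting from 1 - cos >= 0 and integrating from 0.
    The constant 1 in place of 1/6 suffices: only the power matters, as it leaves a factor to spare
    beyond the square. *)
Lemma sin_taylor y : `|sin y - y| <= `|y| ^+ 3.
Proof.
wlog y0 : y / 0 <= y => [hw|].
  have [/hw//|/ltW y0] := leP 0 y.
  by have := hw (- y); rewrite sinN -opprD !normrN; apply; rewrite oppr_ge0.
have s1 := subr_sin_ge0.
have s2 := cos_ge_taylor.
have s3 x : 0 <= x -> 0 <= sin x - x + x ^+ 3 / 6.
  apply: (@ge0_derive_ge0 (fun x => sin x - x + x ^+ 3 / 6) (fun x => cos x - 1 + x ^+ 2 / 2)).
  - by move=> z; apply: is_derive_eq; rewrite /GRing.scale /=; field.
  - exact: s2.
  - by rewrite sin0 expr0n/=; ring.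
have := s1 _ y0; have := s3 _ y0; have : 0 <= y ^+ 3 by rewrite exprn_ge0.
rewrite (ger0_norm y0) ler_norml => *; apply/andP; split; lra.
Qed.

Lemma cos_taylor y : `|cos y - (1 - y ^+ 2 / 2)| <= y ^+ 4.
Proof.
wlog y0 : y / 0 <= y => [hw|].
  have [/hw//|/ltW y0] := leP 0 y.
  by have := hw (- y); rewrite cosN sqrrN exprNn -signr_odd mul1r; apply; rewrite oppr_ge0.
have s1 := subr_sin_ge0.
have s2 := cos_ge_taylor.
have s3 x : 0 <= x -> 0 <= x ^+ 4 - (cos x - 1 + x ^+ 2 / 2).
  apply: (@ge0_derive_ge0 (fun x => x ^+ 4 - (cos x - 1 + x ^+ 2 / 2)) (fun x => 4 * x ^+ 3 - (x - sin x))).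
  - by move=> z; apply: is_derive_eq; rewrite /GRing.scale /=; field.
  - move=> z z0; have := sin_taylor z; rewrite distrC (ger0_norm z0).
    have := exprn_ge0 3 z0.
    by move=> ? /(le_trans (ler_norm _)) ?; lra.
  - by rewrite cos0 !expr0n/=; ring.
have := s2 _ y0; have := s3 _ y0 => *.
by rewrite ler_norml; apply/andP; split; lra.
Qed.

Lemma expRN_taylor x : 0 <= x -> `|expR (- x) - (1 - x)| <= x ^+ 2.
Proof.
move=> x0; have := expR_ge1Dx (- x) => e1.
rewrite ger0_norm; last by lra.
have e2 : expR (- x) <= (1 + x)^-1.
  by rewrite expRN lef_pV2 ?posrE ?expR_gt0 ?expR_ge1Dx// ltr_wpDr.
have : (1 + x)^-1 <= 1 - x + x ^+ 2.
  rewrite -[leLHS]mul1r ler_pdivrMr ?ltr_wpDr//.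
  have -> : (1 - x + x ^+ 2) * (1 + x) = 1 + x ^+ 3 by ring.
  by rewrite lerDl exprn_ge0.
lra.
Qed.

End taylor.

(** The real part of exp(ic) (p + iq)^m, computed without complex numbers: multiplication by p + iq
    mixes real and imaginary part, and the latter is the real part at phase c - pi/2. *)
Fixpoint cos_rec (R : realType) (p q : R) (m : nat) (c : R) : R :=
  if m is m'.+1 then p * cos_rec p q m' c - q * cos_rec p q m' (c - pi / 2)
  else cos c.

(** The telescoping bound |z^m - w^m| <= m |z - w| in the unit disc, for z = p + iq and w real; the
    bound on [cos_rec] stands in for |z| <= 1. *)
Lemma cos_rec_approx (R : realType) (p q w : R) (m : nat) (c : R) : 0 <= w <= 1 ->
  (forall m c, `|cos_rec p q m c| <= 1) ->
  `|cos_rec p q m c - w ^+ m * cos c| <= m%:R * (`|p - w| + `|q|).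
Proof.
move=> /andP[w0 w1] r1; elim: m => [|m IH] /=.
  by rewrite expr0 mul1r subrr normr0 mul0r.
have -> : p * cos_rec p q m c - q * cos_rec p q m (c - pi / 2) - w ^+ m.+1 * cos c =
    (p - w) * cos_rec p q m c - q * cos_rec p q m (c - pi / 2) +
    w * (cos_rec p q m c - w ^+ m * cos c) by rewrite exprS; ring.
rewrite (le_trans (ler_normD _ _))// -[m.+1%:R]natr1 [leRHS]mulrDl mul1r [leRHS]addrC lerD//.
  rewrite (le_trans (ler_normB _ _))// !normrM.
  by apply: lerD; rewrite ler_piMr.
by rewrite normrM ger0_norm// (le_trans (ler_wpM2l w0 IH))// ler_piMl// mulr_ge0// addr_ge0.
Qed.

(** * Expectation of cosines of sums of i.i.d. variables *)

Section iid_sums.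
Context d (T : measurableType d) (R : realType) (P : probability T R).
Variables (X : nat -> {RV P >-> R}) (X_iid : iid X).

Let prod_cond (J : {fset nat}) (A : nat -> set R) :=
  \bigcap_(j in [set` J]) (X j @^-1` A j).

Let mprod_cond (J : {fset nat}) A : (forall j, measurable (A j)) -> measurable (prod_cond J A).
Proof.
move=> mA; apply: fin_bigcap_measurable; first exact: finite_fset.
by move=> j _; exact: measurable_preimage.
Qed.

Let prod_condU (J : {fset nat}) A m B w : m \notin J ->
  \1_(prod_cond (m |` J)%fset (fun j => if j == m then B else A j)) w =
  \1_(prod_cond J A) w * \1_B (X m w) :> R.
Proof.
move=> mJ; rewrite !indicE -natrM mulnb; congr (_%:R); congr (nat_of_bool _).
apply/idP/andP; rewrite !inE /prod_cond /=.
- move=> H; split.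
    move=> j /= jJ; have := H j; rewrite /= in_fset1U jJ orbT => /(_ isT).
    by case: eqP jJ => // ->; rewrite (negbTE mJ).
  by have := H m; rewrite /= in_fset1U eqxx => /(_ isT).
- move=> [H1 H2] j /=; rewrite in_fset1U => /orP[/eqP->|jJ]; first by rewrite eqxx.
  by case: eqP => [->//|_]; exact: H1.
Qed.

Let prob_condU (J : {fset nat}) A m B : m \notin J -> (forall j, measurable (A j)) -> measurable B ->
  fine (P (prod_cond (m |` J)%fset (fun j => if j == m then B else A j))) =
  fine (P (prod_cond J A)) * fine (P (X m @^-1` B)).
Proof.
move=> mJ mA mB; have [mi _] := X_iid.
rewrite /prod_cond !mi//; last by move=> j; case: ifP.
rewrite big_fsetU1//= eqxx mulrC -fineM; last 2 first.
- by rewrite prob_fin_num.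
- rewrite -mi// fin_num_measure//; exact: mprod_cond.
congr (fine (_ * _)); apply: eq_big_seq => j jJ.
by case: eqP jJ => // ->; rewrite (negbTE mJ).
Qed.

Variables (F : R -> R) (mF : measurable_fun setT F).

Let S m w := \sum_(j < m) F (X j w).

Let mS m : measurable_fun setT (S m).
Proof. by apply: measurable_sum => j; exact: measurableT_comp. Qed.

Let mcosS m c : measurable_fun setT (fun w => cos (c + S m w)).
Proof.
apply: (measurableT_comp (f := cos)).
  by apply: continuous_measurable_fun; exact: continuous_cos.
exact: measurable_funD.
Qed.

Let p := \int[P]_w cos (F (X 0%N w)).
Let q := \int[P]_w sin (F (X 0%N w)).

(** Mutual independence speaks of cylinder events only. The induction on m therefore carries a
    cylinder on indices from m on: to split off the function of X m, [Rintegral_transfer] asks for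
    the same identity with an event on X m added, and this is the induction hypothesis for a larger
    cylinder. *)
Let expectation_cond m (J : {fset nat}) A c : (forall j, measurable (A j)) ->
  (forall j, j \in J -> (m <= j)%N) ->
  \int[P]_w (\1_(prod_cond J A) w * cos (c + S m w)) =
  fine (P (prod_cond J A)) * cos_rec p q m c.
Proof.
elim: m J A c => [|m IH] J A c mA Jm.
  under eq_Rintegral do rewrite /S big_ord0 addr0.
  rewrite RintegralZr//; last first.
    apply: (@probability_integrable _ _ _ P _ 1); first exact/measurable_indic/mprod_cond.
    by move=> w; rewrite indicE; case: (_ \in _) => /=; rewrite ?normr1 ?normr0.
  congr (_ * _); rewrite /Rintegral integral_indic ?setIT//; exact: mprod_cond.
have mJ : m \notin J by apply/negP => /Jm; rewrite ltnn.
set B := prod_cond J A.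
have mB : measurable B by exact: mprod_cond.
have mG b : measurable_fun setT (fun w => \1_B w * cos (b + S m w) : R).
  by apply: measurable_funM => //; exact: measurable_indic.
have Gle b w : `|\1_B w * cos (b + S m w) : R| <= 1.
  rewrite normrM indicE; case: (_ \in _); rewrite ?normr1 ?normr0 ?mul0r// mul1r.
  exact: cos_max.
have step (H : R -> R) b : measurable_fun setT H -> (forall x, `|H x| <= 1) ->
    \int[P]_w (\1_B w * cos (b + S m w) * H (F (X m w))) =
    fine (P B) * cos_rec p q m b * \int[P]_w H (F (X 0%N w)).
  move=> mH H1.
  have iH : P.-integrable setT (EFin \o (fun w => H (F (X 0%N w)))).
    apply: (@probability_integrable _ _ _ P _ 1) => //.
    by apply: (measurableT_comp mH); exact: measurableT_comp.
  rewrite -RintegralZl//.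
  apply: (@Rintegral_transfer _ _ _ _ _ _ _ P P _ (cst (fine (P B) * cos_rec p q m b))
    (X m) (X 0%N) _ _ _ _ _ (fun x => H (F x)) 1) => //.
  - exact: (probability_integrable P (mG b) (Gle b)).
  - exact: (finite_measure_integrable_cst P _ measurableT).
  (* The event that X m lies in D joins the cylinder, whose indices remain at least m. *)
  - move=> D mD.
    transitivity (\int[P]_w (\1_(prod_cond (m |` J)%fset (fun j => if j == m then D else A j)) w
        * cos (b + S m w))).
      by apply: eq_Rintegral => w _; rewrite prod_condU// mulrAC.
    rewrite IH; last 2 first.
    - by move=> j; case: ifP.
    - by move=> j; rewrite in_fset1U => /orP[/eqP->//|/Jm/ltnW].
    rewrite prob_condU// RintegralZl//; last exact: integrable_indic_comp.
    rewrite Rintegral_indic_comp// mulrAC; congr (_ * _ * fine _).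
    have [_ /(_ m 0%N D mD)] := X_iid; by [].
  - exact: (measurableT_comp mH).
have SE b w : cos (b + S m.+1 w) = cos (b + S m w) * cos (F (X m w)) -
    cos (b - pi / 2 + S m w) * sin (F (X m w)).
  by rewrite /S big_ord_recr /= addrA cosD addrAC cosBpihalf.
transitivity (\int[P]_w (\1_B w * cos (c + S m w) * cos (F (X m w)) -
    \1_B w * cos (c - pi / 2 + S m w) * sin (F (X m w)))).
  by apply: eq_Rintegral => w _; rewrite SE mulrBr !mulrA.
have mc : measurable_fun setT (@cos R).
  by apply: continuous_measurable_fun; exact: continuous_cos.
have ms : measurable_fun setT (@sin R).
  by apply: continuous_measurable_fun; exact: continuous_sin.
have mFX : measurable_fun setT (fun w => F (X m w)) by exact: measurableT_comp.
rewrite RintegralB//; last 2 first.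
- apply: (@probability_integrable _ _ _ P _ 1).
    by apply: measurable_funM => //; exact: (measurableT_comp mc).
  by move=> w; rewrite normrM mulr_ile1// cos_max.
- apply: (@probability_integrable _ _ _ P _ 1).
    by apply: measurable_funM => //; exact: (measurableT_comp ms).
  by move=> w; rewrite normrM mulr_ile1// sin_max.
rewrite (step cos c mc (@cos_max R)) (step sin (c - pi / 2) ms (@sin_max R)) /=.
by rewrite -/p -/q; ring.
Qed.

Lemma expectation_cos_sum m c :
  \int[P]_w cos (c + \sum_(j < m) F (X j w)) = cos_rec p q m c.
Proof.
have := @expectation_cond m fset0 (fun=> setT) c (fun=> measurableT).
rewrite (_ : prod_cond _ _ = setT); last first.
  by apply/seteqP; split => // w _ j /=.
rewrite probability_setT mul1r => <-//.
by apply: eq_Rintegral => w _; rewrite indicE in_setT mul1r.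
Qed.

Lemma cos_rec_le1 m c : `|cos_rec p q m c| <= 1.
Proof.
rewrite -expectation_cos_sum; apply: normr_expectation_le => [|w]; last exact: cos_max.
exact: mcosS.
Qed.

End iid_sums.

(** * Convergence of the characteristic functions of row sums *)

Section clt.
Context d (T : measurableType d) (R : realType) (P : probability T R).
Variables (X : nat -> {RV P >-> R}) (X_iid : iid X).
Variables (F : nat -> R -> R) (b : nat -> R) (v : R).
Hypotheses (mF : forall n, measurable_fun setT (F n))
  (Fb : forall n x, `|F n x| <= b n) (b0 : b n @[n --> \oo] --> (0 : R))
  (F0 : forall n, \int[P]_w F n (X 0%N w) = 0)
  (Fv : n%:R * \int[P]_w (F n (X 0%N w)) ^+ 2 @[n --> \oo] --> v).

Let s n := \int[P]_w (F n (X 0%N w)) ^+ 2.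

Let mFX n : measurable_fun setT (fun w => F n (X 0%N w)).
Proof. exact: measurableT_comp. Qed.

Let b_ge0 n : 0 <= b n.
Proof. exact: le_trans (Fb n 0). Qed.

Let sq_le n w : F n (X 0%N w) ^+ 2 <= b n ^+ 2.
Proof. by rewrite -real_normK ?num_real// ler_sqr ?nnegrE// Fb. Qed.

Let isq n : P.-integrable setT (EFin \o (fun w => F n (X 0%N w) ^+ 2)).
Proof.
apply: (@probability_integrable _ _ _ P _ (b n ^+ 2)); first exact: measurable_funX.
by move=> w; rewrite ger0_norm ?sqr_ge0.
Qed.

Let s_ge0 n : 0 <= s n. Proof. by apply: Rintegral_ge0 => w _; exact: sqr_ge0. Qed.

Let s_le n : s n <= b n ^+ 2.
Proof.
apply: (le_trans (ler_norm _)); apply: normr_expectation_le; first exact: measurable_funX.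
by move=> w; rewrite ger0_norm ?sqr_ge0.
Qed.

(** Both sides are compared with 1 - t^2 s/2. The remainders are of order b^2 s, because F^4 <= b^2
    F^2 and s^2 <= b^2 s; multiplied by n they vanish, as n s converges. *)
Let cos_close n t : `|\int[P]_w cos (t * F n (X 0%N w)) - expR (- (t ^+ 2 * s n / 2))| <=
  t ^+ 4 * b n ^+ 2 * s n + (t ^+ 2 / 2) ^+ 2 * b n ^+ 2 * s n.
Proof.
have ts0 : 0 <= t ^+ 2 * s n / 2 by rewrite divr_ge0// mulr_ge0 ?sqr_ge0.
rewrite -[X in `|X|](subrKA (1 - t ^+ 2 * s n / 2)).
rewrite (le_trans (ler_normD _ _))// lerD//; last first.
  rewrite distrC (le_trans (expRN_taylor ts0))//.
  have -> : (t ^+ 2 * s n / 2) ^+ 2 = (t ^+ 2 / 2) ^+ 2 * s n * s n by ring.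
  by rewrite ler_wpM2r// ler_wpM2l// sqr_ge0.
have -> : 1 - t ^+ 2 * s n / 2 = \int[P]_w (1 - (t ^+ 2 / 2) * F n (X 0%N w) ^+ 2).
  rewrite RintegralB//.
  - by rewrite Rintegral_cst//= probability_setT mulr1 RintegralZl// -/(s n); congr (_ - _); ring.
  - exact: (finite_measure_integrable_cst P 1 measurableT).
  - exact: (integrableZl measurableT _ (isq n)).
have i1 : P.-integrable setT (EFin \o (fun w => cos (t * F n (X 0%N w)))).
  apply: (@probability_integrable _ _ _ P _ 1) => [|w]; last exact: cos_max.
  apply: (measurableT_comp (f := cos)).
    by apply: continuous_measurable_fun; exact: continuous_cos.
  exact: measurable_funM.
have i2 : P.-integrable setT (EFin \o (fun w => 1 - (t ^+ 2 / 2) * F n (X 0%N w) ^+ 2)).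
  apply: RintegrableB => //; last exact: RintegrableZl.
  exact: (finite_measure_integrable_cst P 1 measurableT).
rewrite -RintegralB// -RintegralZl//.
apply: (le_trans (le_normr_Rintegral _ _)) => //; first exact: (integrableB measurableT i1 i2).
apply: le_Rintegral => //.
- exact: (integrable_norm (integrableB measurableT i1 i2)).
- exact: (integrableZl measurableT _ (isq n)).
- move=> w _; have := cos_taylor (t * F n (X 0%N w)).
  rewrite exprMn mulrAC => /le_trans; apply.
  rewrite exprMn -mulrA ler_wpM2l ?exprn_even_ge0// (exprM _ 2 2) expr2.
  by rewrite ler_wpM2r ?sqr_ge0.
Qed.

(** The mean is zero, so the linear term may be subtracted, and a cubic remainder of order b F^2 is
    left. *)
Let sin_close n t : `|\int[P]_w sin (t * F n (X 0%N w))| <= `|t| ^+ 3 * b n * s n.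
Proof.
have iF : P.-integrable setT (EFin \o (fun w => t * F n (X 0%N w))).
  apply: RintegrableZl => //.
  exact: (@probability_integrable _ _ _ P _ (b n)).
have is_ : P.-integrable setT (EFin \o (fun w => sin (t * F n (X 0%N w)))).
  apply: (@probability_integrable _ _ _ P _ 1) => [|w]; last exact: sin_max.
  apply: (measurableT_comp (f := sin)).
    by apply: continuous_measurable_fun; exact: continuous_sin.
  exact: measurable_funM.
have -> : \int[P]_w sin (t * F n (X 0%N w)) =
    \int[P]_w (sin (t * F n (X 0%N w)) - t * F n (X 0%N w)).
  rewrite RintegralB// RintegralZl// ?F0 ?mulr0 ?subr0//.
  exact: (@probability_integrable _ _ _ P _ (b n)).
rewrite -RintegralZl//.
apply: (le_trans (le_normr_Rintegral _ _)) => //; first exact: (integrableB measurableT is_ iF).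
apply: le_Rintegral => //.
- exact: (integrable_norm (integrableB measurableT is_ iF)).
- exact: (integrableZl measurableT _ (isq n)).
- move=> w _; apply: (le_trans (sin_taylor _)).
  rewrite normrM exprMn -[leRHS]mulrA ler_wpM2l ?exprn_ge0// exprS real_normK ?num_real//.
  by rewrite ler_wpM2r ?sqr_ge0.
Qed.

(** The comparison value W = exp(- t^2 s/2) has an exact n-th power, exp(- t^2 n s/2), which
    converges; the telescoping bound of [cos_rec_approx] multiplies the errors of one factor by n
    only. *)
Lemma clt_cf t c :
  \int[P]_w cos (t * (\sum_(j < n) F n (X j w)) + c) @[n --> \oo] -->
  expR (- (v * t ^+ 2 / 2)) * cos c.
Proof.
pose p n := \int[P]_w cos (t * F n (X 0%N w)).
pose q n := \int[P]_w sin (t * F n (X 0%N w)).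
pose W n := expR (- (t ^+ 2 * s n / 2)).
have E n : \int[P]_w cos (t * (\sum_(j < n) F n (X j w)) + c) = cos_rec (p n) (q n) n c.
  rewrite -(expectation_cos_sum X_iid (F := fun x => t * F n x)) //; last exact: measurable_funM.
  by apply: eq_Rintegral => w _; rewrite mulr_sumr addrC.
have c1 : (W n) ^+ n * cos c @[n --> \oo] --> expR (- (v * t ^+ 2 / 2)) * cos c.
  apply: cvgM; last exact: cvg_cst.
  have -> : (fun n => W n ^+ n) = (fun n => expR (- (n%:R * s n * (t ^+ 2 / 2)))).
    by apply/funext => n; rewrite /W -expRM_natl; congr expR; ring.
  rewrite -mulrA; apply: continuous_cvg; first exact: continuous_expR.
  by apply: cvgN; apply: cvgM => //; exact: cvg_cst.
suff c2 : cos_rec (p n) (q n) n c - (W n) ^+ n * cos c @[n --> \oo] --> (0 : R).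
  rewrite -[X in _ --> X]add0r.
  rewrite (_ : (fun n => _) = (fun n => (cos_rec (p n) (q n) n c - W n ^+ n * cos c) + W n ^+ n * cos c)).
    exact: cvgD.
  by apply/funext => n; rewrite E subrK.
apply: (@norm_squeeze0 _ _ _ _ _ (fun n =>
   (t ^+ 4 + (t ^+ 2 / 2) ^+ 2) * b n * b n * (n%:R * s n) + `|t| ^+ 3 * b n * (n%:R * s n))).
  apply: nearW => n; apply: (le_trans (cos_rec_approx _ _ _ _)).
  - by rewrite expR_ge0/= -expR0 ler_expR oppr_le0 divr_ge0// mulr_ge0 ?sqr_ge0.
  - move=> m c'; apply: (cos_rec_le1 X_iid (F := fun x => t * F n x)).
    exact: measurable_funM.
  - have := lerD (cos_close n t) (sin_close n t).
    move=> /(ler_wpM2l (ler0n R n)) /le_trans; apply.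
    by rewrite le_eqVlt; apply/orP; left; apply/eqP; ring.
rewrite -[X in _ --> X](_ : (t ^+ 4 + (t ^+ 2 / 2) ^+ 2) * 0 * 0 * v + `|t| ^+ 3 * 0 * v = 0); last by ring.
apply: cvgD; apply: cvgM => //; apply: cvgM => //; last exact: cvg_cst.
by apply: cvgM => //; exact: cvg_cst.
Qed.

End clt.

(** * Fourier inversion *)

Section independence.
Context d (T : measurableType d) (R : realType) (P : probability T R).

(** Two transfers: B(Z) is treated against the indicator of an event of Y, and then A(Y) against the
    weight B(Z), which may change sign. *)
Lemma expectation_independent2 (Y Z : {RV P >-> R}) (A B : R -> R) :
  independent2 Y Z -> measurable_fun setT A -> measurable_fun setT B ->
  (forall x, `|A x| <= 1) -> (forall x, `|B x| <= 1) ->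
  \int[P]_w (A (Y w) * B (Z w)) = \int[P]_w A (Y w) * \int[P]_w B (Z w).
Proof.
move=> YZ mA mB A1 B1.
have iC c : P.-integrable setT (EFin \o cst c) by exact: (finite_measure_integrable_cst P c measurableT).
have iAY : P.-integrable setT (EFin \o (fun w => A (Y w))).
  apply: (@probability_integrable _ _ _ P _ 1) => //; exact: (measurableT_comp mA).
have iBZ : P.-integrable setT (EFin \o (fun w => B (Z w))).
  apply: (@probability_integrable _ _ _ P _ 1) => //; exact: (measurableT_comp mB).
have step1 (C : set R) : measurable C ->
    \int[P]_w (\1_C (Y w) * B (Z w)) = fine (P (Y @^-1` C)) * \int[P]_w B (Z w).
  move=> mC; rewrite -RintegralZl//.
  apply: (@Rintegral_transfer _ _ _ _ _ _ _ P P _ (cst (fine (P (Y @^-1` C)))) Z Z _ _ _ _ _ B 1) => //.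
    exact: integrable_indic_comp.
  move=> D mD; rewrite RintegralZl//; last exact: integrable_indic_comp.
  rewrite Rintegral_indic_comp// -fineM ?prob_fin_num// -YZ//.
  rewrite /Rintegral; congr fine.
  transitivity (\int[P]_w (\1_(Y @^-1` C `&` Z @^-1` D) w)%:E)%E.
    by apply: eq_integral => w _; rewrite indicI.
  rewrite integral_indic ?setIT//.
  by apply: measurableI; exact: measurable_preimage.
under eq_Rintegral do rewrite mulrC.
rewrite [RHS]mulrC -RintegralZl//.
apply: (@Rintegral_transfer _ _ _ _ _ _ _ P P (fun w => B (Z w))
  (cst (\int[P]_w B (Z w))) Y Y _ _ _ _ _ A 1) => //.
move=> C mC; under eq_Rintegral do rewrite mulrC.
rewrite step1// RintegralZl//; last exact: integrable_indic_comp.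
by rewrite Rintegral_indic_comp// mulrC.
Qed.

Lemma continuous_cf (U : T -> R) : measurable_fun setT U ->
  continuous (fun t : R => \int[P]_w cos (t * U w)).
Proof.
move=> mU t; apply/(@cvg_nbhsP _ R^o) => u ut.
have mc (s : R) : measurable_fun setT (fun w => cos (s * U w)).
  apply: (measurableT_comp (f := cos)).
    by apply: continuous_measurable_fun; exact: continuous_cos.
  exact: measurable_funM.
apply: (@Rdominated_cvg _ _ _ P setT measurableT _ _ (cst 1)) => //.
- move=> w _; apply: continuous_cvg; first exact: continuous_cos.
  by apply: cvgM => //; exact: cvg_cst.
- exact: (finite_measure_integrable_cst P 1 measurableT).
- by move=> n w _; exact: cos_max.
Qed.

End independence.

(** * Inversion for a density with integrable real characteristic function *)

Section inversion.
Context {R : realType}.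
Notation mu := (@lebesgue_measure R).
Context d (T : measurableType d) (P : probability T R) (Z : {RV P >-> R}).
Variables (k phi : R -> R) (k_cont : continuous k) (k_dens : has_density Z k).
Hypotheses (mphi : measurable_fun setT phi) (phi0 : forall t, 0 <= phi t)
  (iphi : mu.-integrable `[0%R, +oo[ (EFin \o phi)).
Hypothesis cfZ : forall t c, \int[P]_w cos (t * (Z w + c)) = phi t * cos (t * c).

Let k0 x : 0 <= k x. Proof. by case: k_dens. Qed.

Let densE (F : R -> R) (K : R) : measurable_fun setT F -> (forall x, `|F x| <= K) ->
  \int[P]_w F (Z w) = \int[mu]_x (F x * k x).
Proof. by case: k_dens => ? ? Zk mF FK; exact: (Rintegral_density _ _ _ _ mF FK). Qed.

Let mk : measurable_fun setT k. Proof. exact: continuous_measurable_fun. Qed.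

Let intk : (\int[mu]_z (k z)%:E = 1)%E.
Proof.
case: k_dens => _ _ Zk; rewrite -Zk// /distribution /pushforward preimage_setT.
exact: probability_setT.
Qed.

Let ik : mu.-integrable setT (EFin \o k).
Proof.
apply/integrableP; split; first exact/measurable_EFinP.
under eq_integral do rewrite /= ger0_norm//.
by rewrite intk ltry.
Qed.

Let k1 : \int[mu]_z k z = 1. Proof. by rewrite /Rintegral intk. Qed.

(** Within distance r of c the density varies by at most [kap], and the kernel has mass 2 atan(r/e)
    there; outside, the kernel is at most e/r^2 and k has total mass 1. *)
Let poisson_smoothing (c r e kap : R) : 0 < r -> 0 < e -> 0 < kap ->
  (forall z, `|z - c| <= r -> `|k z - k c| <= kap) ->
  `|\int[P]_w (e / (e ^+ 2 + (c - Z w) ^+ 2)) - k c * (2 * atan (r / e))| <=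
  kap * (2 * atan (r / e)) + e / r ^+ 2.
Proof.
move=> r0 e0 kap0 kr.
pose p z := e / (e ^+ 2 + (z - c) ^+ 2).
pose I := `[c - r, c + r]%classic : set R.
have p0 z : 0 <= p z <= e^-1 by exact: poisson_kernel_le.
have cp : continuous p.
  move=> z; apply: (@continuous_comp _ _ _ (fun z => z - c) (fun u => e / (e ^+ 2 + u ^+ 2))).
    by apply: cvgB; [exact: cvg_id|exact: cvg_cst].
  exact: continuous_poisson_kernel.
have mp : measurable_fun setT p by exact: continuous_measurable_fun.
have ikp : mu.-integrable setT (EFin \o (fun z => p z * k z)).
  apply: (@le_Rintegrable _ _ _ mu setT measurableT _ (fun z => e^-1 * k z)) => //.
  - exact: measurable_funM.
  - move=> z _; have /andP[pz0 pz1] := p0 z.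
    by rewrite normrM !ger0_norm// ler_wpM2r.
  - exact: RintegrableZl.
have ipI0 : mu.-integrable I (EFin \o p).
  apply: (@bounded_integrable _ _ _ mu I _ _ e^-1).
  - exact: measurable_itv.
  - exact: lebesgue_itv_lty.
  - exact: measurable_funTS.
  - by move=> z _; have /andP[pz0 pz1] := p0 z; rewrite ger0_norm.
have ipI : mu.-integrable setT (EFin \o (fun z => p z * \1_I z)).
  by apply: Rintegrable_mulr_indic => //; exact: measurable_itv.
have intpI : \int[mu]_z (p z * \1_I z) = 2 * atan (r / e).
  rewrite Rintegral_mulr_indic integral_poisson_kernel//; last by lra.
  rewrite [X in atan (X / e)]addrAC subrr add0r [X in _ - atan (X / e)]addrAC subrr add0r.
  by rewrite mulNr atanN opprK mulr2n mulrDl mul1r.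
have -> : \int[P]_w (e / (e ^+ 2 + (c - Z w) ^+ 2)) = \int[mu]_z (p z * k z).
  rewrite -(densE mp (K := e^-1)).
    by apply: eq_Rintegral => w _; rewrite /p -[(Z w - c) ^+ 2]sqrrN opprB.
  by move=> z; have /andP[pz0 pz1] := p0 z; rewrite ger0_norm.
have inI (z : R) : z \in I -> `|z - c| <= r.
  rewrite /I inE/= in_itv/= ler_norml => /andP[? ?].
  by apply/andP; split; lra.
have notinI (z : R) : z \notin I -> r ^+ 2 <= (z - c) ^+ 2.
  move=> zI; rewrite -(real_normK (num_real (z - c))) ler_sqr ?nnegrE ?(ltW r0)// leNgt.
  apply: contra zI; rewrite /I inE/= in_itv/= ltr_norml => /andP[? ?].
  by apply/andP; split; lra.
have -> : e / r ^+ 2 = \int[mu]_z (e / r ^+ 2 * k z) by rewrite RintegralZl// k1 mulr1.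
rewrite -intpI -!RintegralZl// -RintegralB//; last exact: RintegrableZl.
rewrite -RintegralD//; [|exact: RintegrableZl|exact: RintegrableZl].
apply: (le_trans (le_normr_Rintegral _ _)) => //.
  by apply: RintegrableB => //; exact: RintegrableZl.
apply: le_Rintegral => //.
- by apply: integrable_norm => //; apply: RintegrableB => //; exact: RintegrableZl.
- by apply: RintegrableD => //; exact: RintegrableZl.
move=> z _ /=.
have /andP[pz0 pz1] := p0 z.
rewrite indicE; have [zI|zI] := boolP (z \in I).
  rewrite mulr1 mulrC -mulrBl normrM (ger0_norm pz0).
  apply: (@le_trans _ _ (kap * p z)); last by rewrite lerDl mulr_ge0// divr_ge0 ?sqr_ge0 ?(ltW e0).
  by rewrite ler_wpM2r//; apply: kr; exact: inI.
rewrite !mulr0 subr0 add0r normrM ger0_norm// ger0_norm// ler_wpM2r//.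
move: (notinI _ zI) => rz; rewrite /p ler_wpM2l ?(ltW e0)// lef_pV2 ?posrE ?exprn_gt0//; last first.
  by rewrite ltr_pwDl ?exprn_gt0 ?sqr_ge0.
by rewrite (le_trans rz)// lerDr sqr_ge0.
Qed.

(** Both sides are limits of [expectation_poisson_kernel] as e tends to 0: the Laplace side by
    dominated convergence with majorant [phi], the kernel side because the kernel is an approximate
    identity of mass pi. The sequence e is 1/(n+1). *)
Lemma cf_inversion (c : R) :
  pi * k c = \int[mu]_(t in `[0, +oo[) (phi t * cos (t * c)).
Proof.
pose e n : R := harmonic n.
have e0 n : 0 < e n by rewrite /e /= invr_gt0.
have ecvg : e n @[n --> \oo] --> (0 : R) by exact: cvg_harmonic.
pose A n := \int[P]_w (e n / (e n ^+ 2 + (c - Z w) ^+ 2)).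
have cA1 : A n @[n --> \oo] --> \int[mu]_(t in `[0, +oo[) (phi t * cos (t * c)).
  rewrite (_ : A = fun n => \int[mu]_(t in `[0, +oo[) (expR (- e n * t) * (phi t * cos (t * c)))); last first.
    apply/funext => n; rewrite /A expectation_poisson_kernel//.
    apply: eq_Rintegral => t _; congr (_ * _).
    rewrite -[t * c]opprK -mulrN cosN -cfZ; apply: eq_Rintegral => w _.
    by rewrite -[RHS]cosN; congr cos; rewrite mulrDr opprD mulrN opprK mulNr.
  have mcosc : measurable_fun setT (fun t : R => cos (t * c)).
    apply: (measurableT_comp (f := cos)).
      by apply: continuous_measurable_fun; exact: continuous_cos.
    exact: measurable_funM.
  have mphic : measurable_fun (`[0%R, +oo[%classic : set R) (fun t => phi t * cos (t * c)).
    by apply: measurable_funTS; exact: measurable_funM.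
  apply: (@Rdominated_cvg _ _ _ mu `[0%R, +oo[%classic _ _ _ phi) => //.
  - move=> n; apply: measurable_funM => //; apply: measurable_funTS.
    apply: continuous_measurable_fun => t.
    exact: is_derive_continuous (is_derive_expMN (e n) t).
  - move=> t _; rewrite -[X in _ --> X]mul1r; apply: cvgM; last exact: cvg_cst.
    rewrite -expR0; apply: continuous_cvg; first exact: continuous_expR.
    rewrite -[X in _ --> X](mul0r t) -[X in X * t]oppr0.
    by apply: cvgM; [exact: cvgN|exact: cvg_cst].
  - move=> n t /=; rewrite in_itv/= andbT => t0.
    have h1 : `|phi t * cos (t * c)| <= phi t.
      by rewrite normrM ger0_norm// ler_piMr// cos_max.
    rewrite normrM (ger0_norm (expR_ge0 _)) (le_trans _ h1)// ler_piMl//.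
    by rewrite -expR0 ler_expR mulNr oppr_le0 mulr_ge0// ltW.
suff cA2 : A n @[n --> \oo] --> pi * k c by exact: (cvg_unique _ cA2 cA1).
apply/cvgrPdist_le => eps eps0.
(* Then [kap] times the full mass pi is eps/2, which leaves room for the terms that tend to 0. *)
pose kap := eps / (2 * pi).
have pi0 : 0 < pi :> R by exact: pi_gt0.
have kap0 : 0 < kap by rewrite divr_gt0// mulr_gt0.
have /cvgrPdist_le/(_ kap kap0) : k z @[z --> c] --> k c by exact: k_cont.
move=> /nbhs_ballP[r1 /= r10 kr].
pose r := r1 / 2; have r0 : 0 < r by rewrite divr_gt0.
have {}kr z : `|z - c| <= r -> `|k z - k c| <= kap.
  move=> zr; rewrite distrC; apply: kr; rewrite /ball/= distrC.
  by apply: (le_lt_trans zr); rewrite /r ltr_pdivrMr// ltr_pMr// (ltr_nat _ 1).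
pose a n := atan (r / e n).
have ca : a n @[n --> \oo] --> pi / 2.
  apply: (@cvg_comp _ _ _ (fun n => r / e n) (@atan R) _ +oo); last exact: cvgy_atan.
  rewrite (_ : (fun n => _) = (fun n => r * n.+1%:R)).
    apply: (@cvg_comp _ _ _ (fun n => n.+1%:R) (fun x => r * x) _ +oo).
      apply/cvgryPge => B; near=> n; apply: (@le_trans _ _ n%:R); last by rewrite ler_nat.
      by near: n; exact: nbhs_infty_ger.
    by apply: gt0_cvgMry => //; exact: cvg_id.
  by apply/funext => n; rewrite /e /= invrK.
have : kap * pi + e n / r ^+ 2 + `|k c| * `|2 * a n - pi| @[n --> \oo] -->
    kap * pi + 0 / r ^+ 2 + `|k c| * `|2 * (pi / 2) - pi|.
  apply: cvgD; first apply: cvgD.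
  - exact: cvg_cst.
  - by apply: cvgM => //; exact: cvg_cst.
  - apply: cvgM; first exact: cvg_cst.
    apply: cvg_norm; apply: cvgB; last exact: cvg_cst.
    by apply: cvgM => //; exact: cvg_cst.
rewrite mul0r addr0 mulrCA divff// mulr1 subrr normr0 mulr0 addr0.
have kp : kap * pi < eps.
  by rewrite /kap invfM mulrA mulfVK ?gt_eqF// ltr_pdivrMr// ltr_pMr// (ltr_nat _ 1).
move=> /cvgr_le /(_ _ kp); apply: filterS => n; apply: le_trans.
rewrite distrC -[X in `|X|](subrKA (k c * (2 * a n))).
rewrite (le_trans (ler_normD _ _))// lerD//; last first.
  by rewrite (mulrC pi) -mulrBr normrM.
apply: (le_trans (poisson_smoothing r0 (e0 n) kap0 kr)).
rewrite lerD2r ler_wpM2l ?(ltW kap0)//.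
by have := atan_ltpi2 (r / e n); lra.
Unshelve. all: by end_near. Qed.

Section convolution.
Variables (Y X : {RV P >-> R}) (f : R -> R) (x : R).
Hypotheses (YZ : independent2 Y Z) (f_dens : has_density Y f)
  (XYZ : forall w, X w = Y w + Z w).

(** By the addition formula and independence there would also be a product of sines, but E sin(tZ) =
    0 since the characteristic function of Z is real. *)
Lemma cf_sum t : \int[P]_w cos (t * (X w - x)) = phi t * \int[P]_w cos (t * (Y w - x)).
Proof.
have sinZ : \int[P]_w sin (t * Z w) = 0.
  have [->|t0] := eqVneq t 0.
    by under eq_Rintegral do rewrite mul0r sin0; rewrite Rintegral_cst ?mul0r.
  (* This shift turns the cosine into a sine and makes the factor cos(t c) vanish. *)
  have := cfZ t (- (pi / 2) / t).
  have E : t * (- (pi / 2) / t) = - (pi / 2) by rewrite mulrC divfK.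
  rewrite E cosN cos_pihalf mulr0 => <-.
  by apply: eq_Rintegral => w _; rewrite mulrDr E cosBpihalf.
have cosZ : \int[P]_w cos (t * Z w) = phi t.
  have := cfZ t 0; rewrite mulr0 cos0 mulr1 => <-.
  by apply: eq_Rintegral => w _; rewrite addr0.
have mc (s : R) : measurable_fun setT (fun y : R => cos (t * (y - s))).
  apply: (measurableT_comp (f := cos)).
    by apply: continuous_measurable_fun; exact: continuous_cos.
  by apply: measurable_funM => //; exact: measurable_funB.
have ms (s : R) : measurable_fun setT (fun y : R => sin (t * (y - s))).
  apply: (measurableT_comp (f := sin)).
    by apply: continuous_measurable_fun; exact: continuous_sin.
  by apply: measurable_funM => //; exact: measurable_funB.
have mc0 : measurable_fun setT (fun y : R => cos (t * y)).
  by have := mc 0; under eq_fun do rewrite subr0.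
have ms0 : measurable_fun setT (fun y : R => sin (t * y)).
  by have := ms 0; under eq_fun do rewrite subr0.
transitivity (\int[P]_w (cos (t * (Y w - x)) * cos (t * Z w) -
    sin (t * (Y w - x)) * sin (t * Z w))).
  by apply: eq_Rintegral => w _; rewrite -cosD -mulrDr XYZ addrAC.
rewrite RintegralB//; last 2 first.
- apply: (@probability_integrable _ _ _ P _ 1) => [|w].
    by apply: measurable_funM; [exact: (measurableT_comp (mc x))|exact: (measurableT_comp mc0)].
  by rewrite normrM mulr_ile1// cos_max.
- apply: (@probability_integrable _ _ _ P _ 1) => [|w].
    by apply: measurable_funM; [exact: (measurableT_comp (ms x))|exact: (measurableT_comp ms0)].
  by rewrite normrM mulr_ile1// sin_max.
rewrite (@expectation_independent2 _ _ _ _ Y Z (fun y => cos (t * (y - x))) (fun z => cos (t * z)))//;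
  [|by move=> *; exact: cos_max|by move=> *; exact: cos_max].
rewrite (@expectation_independent2 _ _ _ _ Y Z (fun y => sin (t * (y - x))) (fun z => sin (t * z)))//;
  [|by move=> *; exact: sin_max|by move=> *; exact: sin_max].
by rewrite sinZ mulr0 subr0 cosZ mulrC.
Qed.

(** The inversion formula for k is inserted into the convolution and the integrals are exchanged,
    with majorant f(y) phi(t). All regularity comes from k, so the formula holds at every x for any
    density f. *)
Lemma convolution_inversion :
  pi * convolution k f x = \int[mu]_(t in `[0, +oo[) \int[P]_w cos (t * (X w - x)).
Proof.
have [f0 mf Yf] := f_dens.
have if1 : (\int[mu]_z (f z)%:E = 1)%E.
  by rewrite -Yf// /distribution /pushforward preimage_setT; exact: probability_setT.
have if_ : mu.-integrable setT (EFin \o f).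
  apply/integrableP; split; first exact/measurable_EFinP.
  by under eq_integral do rewrite /= ger0_norm//; rewrite if1 ltry.
have mc (s : R) : measurable_fun setT (fun y : R => cos (s * (y - x))).
  apply: (measurableT_comp (f := cos)).
    by apply: continuous_measurable_fun; exact: continuous_cos.
  by apply: measurable_funM => //; exact: measurable_funB.
have iphic (c : R) : mu.-integrable `[0%R, +oo[ (EFin \o (fun t => phi t * cos (t * c))).
  apply: (@le_Rintegrable _ _ _ mu _ _ _ phi) => //.
    apply: measurable_funTS; apply: measurable_funM => //.
    apply: (measurableT_comp (f := cos)).
      by apply: continuous_measurable_fun; exact: continuous_cos.
    exact: measurable_funM.
  by move=> t _; rewrite normrM ger0_norm// ler_piMr// cos_max.
have kE c : k c = pi^-1 * \int[mu]_(t in `[0, +oo[) (phi t * cos (t * c)).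
  by rewrite -cf_inversion mulKf// gt_eqF// pi_gt0.
(* Inversion shows that k is bounded, whence y |-> k(x - y) f(y) is integrable. *)
have kle c : `|k c| <= pi^-1 * \int[mu]_(t in `[0, +oo[) phi t.
  rewrite kE normrM ger0_norm ?invr_ge0 ?pi_ge0// ler_wpM2l ?invr_ge0 ?pi_ge0//.
  apply: (le_trans (le_normr_Rintegral _ _)) => //.
  apply: le_Rintegral => //; first exact: integrable_norm.
  by move=> t _; rewrite normrM ger0_norm// ler_piMr// cos_max.
rewrite /convolution -RintegralZl//; last first.
  apply: (@le_Rintegrable _ _ _ mu setT measurableT _
    (fun y => (pi^-1 * \int[mu]_(t in `[0, +oo[) phi t) * f y)).
  - apply: measurable_funM => //; apply: (measurableT_comp mk).
    exact: measurable_funB.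
  - by move=> y _; rewrite normrM (ger0_norm (f0 y)) ler_wpM2r.
  - exact: RintegrableZl.
transitivity (\int[mu]_y \int[mu]_(t in `[0, +oo[) (phi t * cos (t * (x - y)) * f y)).
  by apply: eq_Rintegral => y _; rewrite RintegralZr// mulrA cf_inversion.
rewrite (@RFubini _ _ _ _ _ mu mu setT measurableT _ _
  (fun z => phi z.2 * cos (z.2 * (x - z.1)) * f z.1) f phi)//; last 2 first.
- apply: measurable_funM; last exact: (measurableT_comp mf).
  apply: measurable_funM; first exact: (measurableT_comp mphi).
  apply: (measurableT_comp (f := cos)).
    by apply: continuous_measurable_fun; exact: continuous_cos.
  by apply: measurable_funM => //; exact: measurable_funB.
- move=> y t _ _ /=; rewrite !normrM (ger0_norm (f0 y)) (ger0_norm (phi0 t)) mulrC ler_wpM2l//.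
  by rewrite ler_piMr// cos_max.
apply: eq_Rintegral => t _ /=.
rewrite cf_sum (Rintegral_density _ f0 mf _ (mc t) (K := 1))//; last first.
  by move=> z; exact: cos_max.
rewrite -RintegralZl//; last first.
  apply: (@le_Rintegrable _ _ _ mu setT measurableT _ f) => //.
    by apply: measurable_funM => //; exact: mc.
  by move=> y _; rewrite normrM (ger0_norm (f0 y)) ler_piMl// cos_max.
apply: eq_Rintegral => y _; rewrite -mulrA; congr (_ * (_ * _)).
by rewrite -cosN -mulrN opprB.
Qed.

End convolution.

End inversion.

(** * The stretched exponential *)

Section stretched_exponential.
Context {R : realType}.
Notation mu := (@lebesgue_measure R).
Variable l : R.
Hypotheses (l_gt0 : 0 < l) (l_lt1 : l < 1).

(** For c < 0 a symmetric stable characteristic function, for c > 0 the reciprocal of one. The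
    absolute value makes it even and continuous on the whole line. *)
Definition stretched_exp (l c t : R) := expR (c * `|t| `^ l).
Local Notation sexp := (stretched_exp l).

Lemma continuous_norm_powR : continuous (fun t : R => `|t| `^ l).
Proof.
move=> t; have [->|t0] := eqVneq t 0.
  rewrite /continuous_at normr0 powR0 ?gt_eqF//; apply/cvgrPdist_lt => e e0.
  have e1 : 0 < e `^ l^-1 by rewrite powR_gt0.
  have eE : (e `^ l^-1) `^ l = e by rewrite -powRrM mulVf ?gt_eqF// powRr1// ltW.
  exists (e `^ l^-1) => //= s; rewrite /ball_ /= !sub0r !normrN => se.
  rewrite ger0_norm ?powR_ge0//.
  by rewrite -[ltRHS]eE gt0_ltr_powR ?nnegrE ?powR_ge0.
apply: (@continuous_comp _ _ _ (fun t : R => `|t|) (fun t => t `^ l)).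
  exact: norm_continuous.
have n0 : 0 < `|t| by rewrite normr_gt0.
exact: is_derive_continuous (is_derive1_powR l n0).
Qed.

Lemma continuous_sexp c : continuous (sexp c).
Proof.
move=> t; apply: continuous_comp; last exact: continuous_expR.
by apply: cvgM; [exact: cvg_cst|exact: continuous_norm_powR].
Qed.

Lemma sexp_gt0 c t : 0 < sexp c t. Proof. exact: expR_gt0. Qed.

Lemma sexpN c t : sexp (- c) t = (sexp c t)^-1.
Proof. by rewrite /stretched_exp mulNr expRN. Qed.

Lemma sexpM c c' t : sexp c t * sexp c' t = sexp (c + c') t.
Proof. by rewrite /stretched_exp -expRD mulrDl. Qed.

Lemma sexp_le c s t : 0 <= c -> 0 <= s -> s <= t -> sexp c s <= sexp c t.
Proof.
move=> c0 s0 st; rewrite ler_expR ler_wpM2l// !ger0_norm// ?(le_trans s0)//.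
by rewrite ge0_ler_powR ?nnegrE ?(ltW l_gt0)// (le_trans s0).
Qed.

Lemma sexp_ge1 c t : 0 <= c -> 1 <= sexp c t.
Proof. by move=> c0; rewrite -expR0 ler_expR mulr_ge0// powR_ge0. Qed.

Lemma cvgy_powR (p : R) : 0 < p -> (t : R) `^ p @[t --> +oo] --> +oo.
Proof.
move=> p0; apply/cvgryPge => B.
have B0 : 0 <= Num.max B 0 by rewrite le_max lexx orbT.
near=> t; apply: (@le_trans _ _ (Num.max B 0)); first by rewrite le_max lexx.
have -> : Num.max B 0 = (Num.max B 0 `^ p^-1) `^ p by rewrite -powRrM mulVf ?gt_eqF// powRr1.
rewrite ge0_ler_powR ?nnegrE ?powR_ge0 ?(ltW p0)//; near: t; exact: nbhs_pinfty_ge.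
Unshelve. all: by end_near. Qed.

(* [G] is an antiderivative of [sexp c] up to a factor [c l + o(1)]. *)
Let G c t := t `^ (1 - l) * sexp c t.

Let dG c (t : R) : 0 < t -> is_derive t (1:R) (G c) (sexp c t * ((1 - l) * t `^ (- l) + c * l)).
Proof.
move=> t0.
have D1 := is_derive1_powR (1 - l) t0.
have D2 := is_derive1_powR l t0.
pose E s := expR (c * s `^ l).
have DE : is_derive t (1:R) E (c * (l * t `^ (l - 1)) * expR (c * t `^ l)).
  by rewrite /E; apply: is_derive_eq; rewrite /GRing.scale /=; ring.
have D : is_derive t (1:R) (fun t => t `^ (1 - l) * E t) (sexp c t * ((1 - l) * t `^ (- l) + c * l)).
  apply: is_derive_eq; rewrite /GRing.scale /= /stretched_exp ger0_norm ?ltW// /E.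
  have -> : 1 - l - 1 = - l by ring.
  have tt : t `^ (1 - l) * t `^ (l - 1) = 1.
    have E0 : 1 - l + (l - 1) = 0 by ring.
    rewrite -powRD; last by rewrite (gt_eqF t0) implybT.
    by rewrite E0 powRr0.
  transitivity (expR (c * t `^ l) * ((1 - l) * t `^ (- l) + c * l * (t `^ (1 - l) * t `^ (l - 1)))).
    by ring.
  by rewrite tt mulr1.
apply: near_eq_is_derive D; near=> s.
by rewrite /G /E /stretched_exp gtr0_norm//; near: s; exact: lt_nbhsr.
Unshelve. all: by end_near. Qed.

Lemma cvgyV0 (f : R -> R) : f t @[t --> +oo] --> +oo -> (f t)^-1 @[t --> +oo] --> (0 : R).
Proof.
move=> fy; apply/gtr0_cvgV0 => //.
by move/cvgryPgt : fy; exact.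
Qed.

Let cvgy_G c : 0 <= c -> G c t @[t --> +oo] --> +oo.
Proof.
move=> c0; apply: (ger_cvgy (f := fun t => t `^ (1 - l))).
  by apply: nearW => t; rewrite /G ler_peMr ?powR_ge0// sexp_ge1.
by apply: cvgy_powR; rewrite subr_gt0.
Qed.

Let G_ftc c (T M : R) : 0 < T -> T <= M ->
  \int[mu]_(t in `[T, M]) (sexp c t * ((1 - l) * t `^ (- l) + c * l)) = G c M - G c T.
Proof.
move=> T0 TM; apply: (@RFTC2 _ _ (G c)) => //.
  by move=> t /andP[Tt _]; apply: dG; exact: lt_le_trans Tt.
apply: continuous_in_subspaceT => t; rewrite inE/= in_itv/= => /andP[Tt _].
have t0 : 0 < t by exact: lt_le_trans Tt.
apply: cvgM; first exact: continuous_sexp.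
apply: cvgD; last exact: cvg_cst.
apply: cvgM; first exact: cvg_cst.
exact: is_derive_continuous (is_derive1_powR (- l) t0).
Qed.

(* Compare the derivatives of numerator and denominator, as in l'Hopital's rule. *)
Lemma cvg_stretched_exp_ratio (c : R) (rho : R -> R) (L : R) : 0 < c ->
  (forall M, mu.-integrable `[0%R, M] (EFin \o (fun t => sexp c t * rho t))) ->
  rho t @[t --> +oo] --> L ->
  \int[mu]_(t in `[0, M]) (sexp c t * rho t) / (M `^ (1 - l) * sexp c M) @[M --> +oo] -->
  L / (c * l).
Proof.
move=> c0 irho rhoL.
have cl0 : 0 < c * l by rewrite mulr_gt0.
pose D M := \int[mu]_(t in `[0, M]) (sexp c t * rho t).
apply/cvgrPdist_le => eps eps0.
(* The derivative of [G] is at least c l times [sexp], so an error of [e'] relative to [sexp]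
   integrates to at most eps/2 times the increase of [G]. *)
pose e' := eps / 2 * (c * l).
have e'0 : 0 < e' by rewrite mulr_gt0// divr_gt0.
pose dec t := (1 - l) * t `^ (- l).
have cdec : dec t @[t --> +oo] --> (0 : R).
  rewrite -[X in _ --> X](mulr0 (1 - l)); apply: cvgM; first exact: cvg_cst.
  under eq_fun do rewrite powRN.
  by apply: cvgyV0; exact: cvgy_powR.
have : rho t - L - L / (c * l) * dec t @[t --> +oo] --> L - L - L / (c * l) * 0.
  apply: cvgB; first by apply: cvgB => //; exact: cvg_cst.
  by apply: cvgM => //; exact: cvg_cst.
rewrite mulr0 subr0 subrr => /cvgrPdist_le/(_ e' e'0) [T0 [_ HT0]].
(* T must be positive, as the derivative formula for [G] is available only for t > 0. *)
pose T := Num.max T0 0 + 1.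
have T_gt0 : 0 < T by rewrite ltr_wpDl// le_max lexx orbT.
have HT t : T <= t -> `|rho t - L - L / (c * l) * dec t| <= e'.
  move=> Tt; have := HT0 t; rewrite sub0r normrN; apply.
  by apply: (lt_le_trans _ Tt); rewrite /T ltr_pwDr// le_max lexx.
(* The contribution of the part up to T, fixed while [G] tends to infinity. *)
pose C := `|D T - L / (c * l) * G c T|.
have : C / G c M @[M --> +oo] --> C * 0.
  by apply: cvgM; [exact: cvg_cst|apply: cvgyV0; apply: cvgy_G; exact: ltW].
rewrite mulr0 => /cvgrPdist_le /(_ _ (divr_gt0 eps0 (ltr0n R 2))) HC.
near=> M.
have TM : T <= M by near: M; apply: nbhs_pinfty_ge; exact: num_real.
have GM0 : 0 < G c M by rewrite mulr_gt0 ?sexp_gt0// powR_gt0// (lt_le_trans T_gt0).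
have CG : C / G c M <= eps / 2.
  have : `|0 - C / G c M| <= eps / 2 by near: M.
  by rewrite sub0r normrN; apply: le_trans; exact: ler_norm.
have msexp : measurable_fun setT (sexp c).
  by apply: continuous_measurable_fun; exact: continuous_sexp.
have i1 : mu.-integrable `[T, M] (EFin \o (fun t => sexp c t * rho t)).
  apply: integrableS (irho M) => // t /=; rewrite !in_itv/= => /andP[Tt ->].
  by rewrite (le_trans (ltW T_gt0) Tt).
have i2 : mu.-integrable `[T, M] (EFin \o (fun t => sexp c t * (dec t + c * l))).
  apply: continuous_compact_integrable; first exact: segment_compact.
  apply: continuous_in_subspaceT => t; rewrite inE/= in_itv/= => /andP[Tt _].
  have t0 : 0 < t by exact: lt_le_trans Tt.
  apply: cvgM; first exact: continuous_sexp.
  apply: cvgD; last exact: cvg_cst.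
  apply: cvgM; first exact: cvg_cst.
  exact: is_derive_continuous (is_derive1_powR (- l) t0).
have DM : D M = D T + \int[mu]_(t in `[T, M]) (sexp c t * rho t).
  have := @Rintegral_itvB R _ (BLeft 0) (BRight M) T (irho M).
  rewrite !bnd_simp => /(_ (ltW T_gt0) TM) H.
  rewrite -Rintegral_itv_obnd_cbnd; first by rewrite -H addrC subrK.
  by apply: integrableS i1 => //; exact: subset_itv_oc_cc.
have GE : G c M = G c T + \int[mu]_(t in `[T, M]) (sexp c t * (dec t + c * l)).
  by rewrite G_ftc// addrC subrK.
have E (t : R) : sexp c t * rho t - L / (c * l) * (sexp c t * (dec t + c * l)) =
    sexp c t * (rho t - L - L / (c * l) * dec t).
  by field; rewrite !gt_eqF.
have diff : D M - L / (c * l) * G c M = (D T - L / (c * l) * G c T) +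
    \int[mu]_(t in `[T, M]) (sexp c t * (rho t - L - L / (c * l) * dec t)).
  rewrite DM GE mulrDr opprD addrACA; congr (_ + _).
  rewrite -RintegralZl// -RintegralB//; last exact: RintegrableZl.
  by apply: eq_Rintegral => t _; exact: E.
have i3 : mu.-integrable `[T, M] (EFin \o (fun t => sexp c t * (rho t - L - L / (c * l) * dec t))).
  rewrite (_ : (fun t => _) = fun t => sexp c t * rho t - L / (c * l) * (sexp c t * (dec t + c * l))).
    by apply: RintegrableB => //; exact: RintegrableZl.
  by apply/funext => t; rewrite E.
have bnd : `|\int[mu]_(t in `[T, M]) (sexp c t * (rho t - L - L / (c * l) * dec t))| <=
    eps / 2 * G c M.
  apply: (@le_trans _ _ (eps / 2 * \int[mu]_(t in `[T, M]) (sexp c t * (dec t + c * l)))); last first.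
    rewrite ler_wpM2l ?divr_ge0 ?(ltW eps0)// G_ftc// lerBlDr lerDl.
    by rewrite mulr_ge0 ?powR_ge0// ltW// sexp_gt0.
  rewrite -RintegralZl//.
  apply: (le_trans (le_normr_Rintegral _ _)) => //.
  apply: le_Rintegral => //.
  - exact: integrable_norm.
  - exact: RintegrableZl.
  - move=> t /=; rewrite in_itv/= => /andP[Tt _].
    rewrite normrM (gtr0_norm (sexp_gt0 _ _)) [leRHS]mulrCA ler_wpM2l ?(ltW (sexp_gt0 _ _))//.
    apply: (le_trans (HT t Tt)); rewrite /e' ler_wpM2l ?divr_ge0 ?(ltW eps0)//.
    by rewrite lerDr mulr_ge0 ?powR_ge0// subr_ge0 ltW.
have -> : L / (c * l) - D M / G c M = - ((D M - L / (c * l) * G c M) / G c M).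
  by rewrite mulrBl mulfK ?gt_eqF// opprB.
rewrite normrN normrM diff [X in _ * X]gtr0_norm ?invr_gt0// ler_pdivrMr//.
rewrite (le_trans (ler_normD _ _))//.
have -> : eps * G c M = eps / 2 * G c M + eps / 2 * G c M by rewrite -mulrDl -splitr.
by rewrite lerD// -ler_pdivrMr.
Unshelve. all: by end_near. Qed.

Hypothesis l_gt : 1 / 3 < l.

Let K (c : R) : R := (c / 6) ^+ 6.

Let K_gt0 c : 0 < c -> 0 < K c.
Proof. by move=> c0; rewrite exprn_gt0// divr_gt0. Qed.

(** The exponential is the sixth power of exp((c/6) t^l), which is at least (c/6) t^l. The exponent
    six is chosen because l > 1/3 gives 6 l > 2. *)
Let sexp_ge_sqr (c t : R) : 0 < c -> 1 <= t -> K c * t ^+ 2 <= sexp c t.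
Proof.
move=> c0 t1; have t0 : 0 <= t by exact: le_trans t1.
have tl0 : 0 <= c / 6 * t `^ l by rewrite mulr_ge0 ?divr_ge0 ?powR_ge0 ?(ltW c0).
have -> : sexp c t = expR (c / 6 * t `^ l) ^+ 6.
  by rewrite /stretched_exp -expRM_natl ger0_norm//; congr expR; field.
apply: (@le_trans _ _ ((c / 6 * t `^ l) ^+ 6)); last first.
  rewrite lerXn2r ?nnegrE ?expR_ge0//; apply: le_trans (expR_ge1Dx _).
  by rewrite lerDr.
rewrite exprMn ler_wpM2l ?(ltW (K_gt0 c0))//.
rewrite -!powR_mulrn ?powR_ge0// -powRrM ler_powR//.
by move: l_gt; rewrite ltr_pdivrMr//; lra.
Qed.

Lemma cvgy_div_sexp (c : R) : 0 < c -> t / sexp c t @[t --> +oo] --> (0 : R).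
Proof.
move=> c0; apply: (@norm_squeeze0 _ _ _ _ _ (fun t => (K c)^-1 * t^-1)); last first.
  rewrite -[X in _ --> X](mulr0 (K c)^-1); apply: cvgM; first exact: cvg_cst.
  by apply: cvgyV0; exact: cvg_id.
near=> t; have t1 : 1 <= t by near: t; exact: nbhs_pinfty_ge.
have t0 : 0 < t by exact: lt_le_trans t1.
rewrite normrM normfV (gtr0_norm t0) (gtr0_norm (sexp_gt0 _ _)).
rewrite ler_pdivrMr ?sexp_gt0// -ler_pdivrMl ?mulr_gt0 ?invr_gt0 ?K_gt0//.
rewrite invfM !invrK mulrAC -mulrA -expr2; exact: sexp_ge_sqr.
Unshelve. all: by end_near. Qed.

(** Domination by a multiple of 1/(1 + t^2), the derivative of atan. In the constant, 2 serves t <=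
    1 and 2/K serves t >= 1, where 1 + t^2 <= 2 t^2. *)
Lemma integrable_sexpN (c : R) : 0 < c ->
  mu.-integrable `[0%R, +oo[ (EFin \o sexp (- c)).
Proof.
move=> c0; have mN : measurable_fun setT (sexp (- c)).
  by apply: continuous_measurable_fun; exact: continuous_sexp.
have c1 : continuous (fun t : R => (1 + t ^+ 2)^-1) by exact: continuous_oneDsqrV.
have iD : mu.-integrable `[0%R, +oo[ (EFin \o (fun t : R => (1 + t ^+ 2)^-1)).
  apply/integrableP; split.
    by apply/measurable_EFinP; apply: measurable_funTS; exact: continuous_measurable_fun.
  under eq_integral do rewrite /= ger0_norm ?invr_ge0 ?addr_ge0 ?sqr_ge0//.
  by rewrite (ge0_FTC2y (@is_derive1_atan R) c1 _ (@cvgy_atan R)) ?ltry// => t _;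
    rewrite invr_ge0 addr_ge0 ?sqr_ge0.
have bnd (t : R) : 0 <= t -> `|sexp (- c) t| <= (2 + 2 / K c) * (1 + t ^+ 2)^-1.
  move=> t0; have d0 : 0 < 1 + t ^+ 2 by rewrite ltr_pwDl ?sqr_ge0.
  rewrite (gtr0_norm (sexp_gt0 _ _)) ler_pdivlMr// sexpN ler_pdivrMl ?sexp_gt0//.
  have K0 := K_gt0 c0; have iK0 : 0 < (K c)^-1 by rewrite invr_gt0.
  have s1 := sexp_ge1 t (ltW c0).
  have [t1|/ltW t1] := leP t 1.
    apply: (@le_trans _ _ (1 * 2)).
      by have t21 : t ^+ 2 <= 1 by [rewrite expr_le1]; lra.
    by rewrite ler_pM// lerDl mulr_ge0 ?(ltW iK0).
  apply: (@le_trans _ _ (K c * t ^+ 2 * (2 / K c))).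
    have -> : K c * t ^+ 2 * (2 / K c) = 2 * t ^+ 2 by field; rewrite gt_eqF.
    by have t21 : 1 <= t ^+ 2 by [exact: exprn_ege1]; lra.
  apply: ler_pM; first by rewrite mulr_ge0 ?sqr_ge0// ltW.
  - by rewrite mulr_ge0// ltW.
  - exact: sexp_ge_sqr.
  - by rewrite lerDr.
apply: (@le_Rintegrable _ _ _ mu _ _ _ (fun t : R => (2 + 2 / K c) * (1 + t ^+ 2)^-1)) => //.
- exact: measurable_funTS.
- by move=> t /=; rewrite in_itv/= andbT; exact: bnd.
- exact: RintegrableZl.
Qed.

End stretched_exponential.

Lemma Rintegral_reflect (R : realType) (G : R -> R) (t : R) : 0 <= t -> continuous G ->
  \int[lebesgue_measure]_(s in `[0, t]) G s = \int[lebesgue_measure]_(s in `[0, t]) G (t - s).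
Proof.
move=> t0 cG.
have dF (s : R) : is_derive s (1:R) (fun s => t - s) (- 1).
  by have := is_deriveB (is_derive_cst t s (1:R)) (is_derive_id s (1:R)); rewrite sub0r.
have dFE : (fun s : R => t - s)^`()%classic = cst (-1).
  by apply/funext => s; rewrite derive1E derive_val.
rewrite /Rintegral; congr fine.
have := @integration_by_substitution_decreasing R (fun s => t - s) G 0 t t0.
rewrite subrr subr0 dFE => ->.
- by apply: eq_integral => s _; rewrite /= opprK mulr1.
- by move=> a b _ _ ab; rewrite ltrD2l ltrN2.
- by move=> s _; exact: cvg_cst.
- exact: is_cvg_cst.
- exact: is_cvg_cst.
- split => //.
  + by apply: cvg_at_right_filter; exact: is_derive_continuous (dF 0).
  + by apply: cvg_at_left_filter; exact: is_derive_continuous (dF t).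
- exact: continuous_subspaceT.
Qed.

Lemma Rintegral_itv_cst (R : realType) (k M : R) : 0 <= M ->
  \int[lebesgue_measure]_(t in `[0, M]) k = k * M.
Proof.
move=> M0; rewrite Rintegral_cst//= lebesgue_measure_itv/=; case: ltP => [_|].
  by rewrite -EFinB /= subr0.
by rewrite lee_fin => M0'; have -> : M = 0 by [apply/le_anti/andP]; rewrite !mulr0.
Qed.

(** * Asymptotics of the second moment of the truncated cosine integral *)

Section second_moment.
Context {R : realType}.
Notation mu := (@lebesgue_measure R).
Variables (l c : R).
Hypotheses (l_gt : 1 / 3 < l) (l_lt1 : l < 1) (c_gt0 : 0 < c).
Context d (T : measurableType d) (P : probability T R) (U : T -> R).
Hypothesis mU : measurable_fun setT U.
Let psi r := \int[P]_w cos (r * U w).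
Hypothesis psi_le : forall r, 0 <= r -> `|psi r| <= stretched_exp l (- c) r.

Let a := stretched_exp l c.
Let l_gt0 : 0 < l. Proof. by apply: lt_trans l_gt; rewrite divr_gt0. Qed.
Let a_gt0 t : 0 < a t. Proof. exact: sexp_gt0. Qed.
Let ca : continuous a. Proof. exact: continuous_sexp. Qed.
Let ma : measurable_fun setT a. Proof. exact: continuous_measurable_fun. Qed.
Let a_le s t : 0 <= s -> s <= t -> a s <= a t.
Proof. by move=> *; apply: sexp_le => //; exact: ltW. Qed.

Let h (u s : R) := a s * cos (s * u).

Let ch u : continuous (h u).
Proof.
move=> s; apply: cvgM; first exact: ca.
apply: continuous_comp; last exact: continuous_cos.
by apply: cvgM; [exact: cvg_id|exact: cvg_cst].
Qed.

Let ih u x y : mu.-integrable `[x, y] (EFin \o h u).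
Proof.
apply: continuous_compact_integrable; first exact: segment_compact.
exact: continuous_subspaceT.
Qed.

Let ia x y : mu.-integrable `[x, y] (EFin \o a).
Proof.
apply: continuous_compact_integrable; first exact: segment_compact.
exact: continuous_subspaceT.
Qed.

Definition trunc_cos_int M u := \int[mu]_(t in `[0, M]) (stretched_exp l c t * cos (t * u)).
Local Notation F := trunc_cos_int.

Lemma trunc_cos_int_le M u : `|F M u| <= \int[mu]_(t in `[0, M]) stretched_exp l c t.
Proof.
apply: (le_trans (le_normr_Rintegral _ _)) => //; first exact: ih.
apply: le_Rintegral; [exact: measurable_itv|exact: integrable_norm (ih _ _ _)|exact: ia|].
by move=> t _; rewrite normrM (gtr0_norm (sexp_gt0 _ _ _)) ler_piMr ?cos_max// ltW// sexp_gt0.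
Qed.

Let A_le M : 0 <= M -> \int[mu]_(t in `[0, M]) a t <= M * a M.
Proof.
move=> M0; rewrite mulrC -(Rintegral_itv_cst _ M0).
apply: le_Rintegral; [exact: measurable_itv|exact: ia| |].
  apply: (@bounded_integrable _ _ _ mu _ _ _ `|a M|);
    [exact: measurable_itv|exact: lebesgue_itv_lty|exact: measurable_cst|].
  by [].
by move=> t /=; rewrite in_itv/= => /andP[t0 tM]; exact: a_le.
Qed.

Let F0 u : F 0 u = 0.
Proof. by rewrite /trunc_cos_int set_itv1 Rintegral_set1. Qed.

Let dF u (t : R) : 0 < t -> is_derive t (1:R) (F ^~ u) (h u t).
Proof.
move=> t0; have tt1 : t < t + 1 by rewrite ltrDl.
have cht : {for t, continuous (h u)} by exact: ch.
have [D E] := continuous_FTC1_closed tt1 (ih u 0 (t + 1)) t0 cht.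
by apply: DeriveDef; [exact: D|rewrite -derive1E].
Qed.

Let F_cont u M : 0 <= M -> {within `[0, M], continuous (F ^~ u)}.
Proof. by move=> M0; apply: parameterized_integral_continuous => //; exact: ih. Qed.

Let F_sqr M u : 0 <= M -> F M u ^+ 2 = \int[mu]_(t in `[0, M]) (2 * h u t * F t u).
Proof.
rewrite le_eqVlt => /predU1P[<-|M0].
  by rewrite F0 expr0n/= set_itv1 Rintegral_set1.
have cF := F_cont (u := u) (ltW M0).
have [cF1 cF2 cF3] := (continuous_within_itvP _ M0).1 cF.
rewrite /Rintegral (@continuous_FTC2 R _ (fun t => F t u ^+ 2) 0 M M0) /=.
- by rewrite F0 expr0n/= subr0.
- move=> t; apply: cvgM; last exact: cF.
  apply: cvgM; first exact: cvg_cst.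
  exact: (continuous_subspaceT (@ch u)).
- split.
  + move=> t /[!in_itv]/= /andP[t0 _]; have D := dF u t0.
    by apply: ex_derive; exact: is_deriveX.
  + by apply: cvgM.
  + by apply: cvgM.
- move=> t /[!in_itv]/= /andP[t0 _]; have D := dF u t0.
  by rewrite derive1E derive_val /GRing.scale /=; ring.
Qed.

(** The domain [0, M] depends on the parameter. For joint measurability it is encoded in the
    integrand, as an indicator evaluated at M - s on the half-line. *)
Let mF : measurable_fun setT (fun z : R * R => F z.1 z.2).
Proof.
rewrite (_ : (fun z => _) = fun z : R * R => \int[mu]_(s in `[0, +oo[)
    (a s * cos (s * z.2) * \1_(`[0, +oo[%classic : set R) (z.1 - s))).
  apply: (measurable_Rintegral_param mu (f := fun y : (R * R) * R =>
    a y.2 * cos (y.2 * y.1.2) * \1_(`[0, +oo[%classic : set R) (y.1.1 - y.2))) => //.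
  have m11 : measurable_fun setT (fun y : (R * R) * R => y.1.1) by exact: (measurableT_comp measurable_fst).
  have m12 : measurable_fun setT (fun y : (R * R) * R => y.1.2) by exact: (measurableT_comp measurable_snd).
  have m2 : measurable_fun setT (fun y : (R * R) * R => y.2) by exact: measurable_snd.
  apply: measurable_funM; first apply: measurable_funM.
  - exact: (measurableT_comp ma).
  - apply: (measurableT_comp (f := cos)).
      by apply: continuous_measurable_fun; exact: continuous_cos.
    exact: measurable_funM.
  - apply: (measurableT_comp (f := (\1_(`[0%R, +oo[%classic : set R) : R -> R))).
      exact: measurable_indic.
    exact: measurable_funB.
apply/funext => z; rewrite /trunc_cos_int Rintegral_mkcond [RHS]Rintegral_mkcond.
apply: eq_Rintegral => s _; rewrite !patchE indicE.
have E (t s' : R) : (s' \in (`[0, t]%classic : set R)) =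
  (s' \in (`[0, +oo[%classic : set R)) && (t - s' \in (`[0, +oo[%classic : set R)).
  by rewrite !mem_setE !in_itv/= !andbT subr_ge0.
by rewrite E; case: (s \in _) => //=; case: (_ \in _); rewrite /= ?mulr1 ?mulr0.
Qed.

Let mcosU t : measurable_fun setT (fun w => cos (t * U w)).
Proof.
apply: (measurableT_comp (f := cos)).
  by apply: continuous_measurable_fun; exact: continuous_cos.
exact: measurable_funM.
Qed.

Let mcosU2 : measurable_fun setT (fun z : R * T => cos (z.1 * U z.2)).
Proof.
apply: (measurableT_comp (f := cos)).
  by apply: continuous_measurable_fun; exact: continuous_cos.
by apply: measurable_funM => //; exact: measurableT_comp.
Qed.

Let mcosU2' : measurable_fun setT (fun z : T * R => cos (z.2 * U z.1)).
Proof.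
apply: (measurableT_comp (f := cos)).
  by apply: continuous_measurable_fun; exact: continuous_cos.
by apply: measurable_funM => //; exact: measurableT_comp.
Qed.

Let mFU2 : measurable_fun setT (fun z : R * T => F z.1 (U z.2)).
Proof.
apply: (measurableT_comp mF (g := fun z : R * T => (z.1, U z.2))).
by apply: measurable_fun_pair => //; exact: measurableT_comp.
Qed.

Let mFU2' : measurable_fun setT (fun z : T * R => F z.2 (U z.1)).
Proof.
apply: (measurableT_comp mF (g := fun z : T * R => (z.2, U z.1))).
by apply: measurable_fun_pair => //; exact: measurableT_comp.
Qed.

Let mFU t : measurable_fun setT (fun w => F t (U w)).
Proof. exact: (measurable_fun_pair2 t mFU2). Qed.

Let F_le M u : 0 <= M -> `|F M u| <= M * a M.
Proof. by move=> M0; apply: (le_trans (trunc_cos_int_le _ _)); exact: A_le. Qed.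

Let icst (k x y : R) : mu.-integrable `[x, y] (EFin \o cst k).
Proof.
apply: (@bounded_integrable _ _ _ mu _ _ _ `|k|);
  [exact: measurable_itv|exact: lebesgue_itv_lty|exact: measurable_cst|by []].
Qed.

Let iPcst (k : R) : P.-integrable setT (EFin \o cst k).
Proof. exact: (finite_measure_integrable_cst P k measurableT). Qed.

Let EcF t := \int[P]_w (2 * cos (t * U w) * F t (U w)).

Let second_moment_int M : 0 <= M ->
  \int[P]_w (F M (U w) ^+ 2) = \int[mu]_(t in `[0, M]) (a t * EcF t).
Proof.
move=> M0; under eq_Rintegral do rewrite F_sqr//.
rewrite (@RFubini _ _ _ _ _ P mu setT measurableT _ (measurable_itv _)
  (fun z => 2 * (a z.2 * cos (z.2 * U z.1)) * F z.2 (U z.1)) (cst (2 * a M * (M * a M))) (cst 1)).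
- apply: eq_Rintegral => t; rewrite inE/= in_itv/= => /andP[t0 tM].
  rewrite -RintegralZl//; first by apply: eq_Rintegral => w _ /=; rewrite mulrCA -!mulrA.
  apply: (@probability_integrable _ _ _ P _ (2 * (t * a t))).
    by apply: measurable_funM; [exact: measurable_funM|exact: mFU].
  move=> w; rewrite !normrM ger0_norm// ler_pM ?mulr_ge0//; last exact: F_le.
  by rewrite ler_piMr// cos_max.
- apply: measurable_funM; last exact: mFU2'.
  apply: measurable_funM => //; apply: measurable_funM; last exact: mcosU2'.
  exact: (measurableT_comp ma).
- exact: iPcst.
- exact: icst.
- move=> w t _ /=; rewrite in_itv/= => /andP[t0 tM].
  rewrite mulr1 !normrM ger0_norm// (gtr0_norm (a_gt0 t)) ler_pM ?mulr_ge0 ?(ltW (a_gt0 t))//.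
    rewrite ler_wpM2l// (le_trans _ (a_le t0 tM))// ler_piMr ?cos_max// ltW//.
  apply: (le_trans (F_le _ t0)).
  by apply: ler_pM; [exact: t0|exact: (ltW (a_gt0 t))|exact: tM|exact: a_le].
Qed.

Let cpsi : continuous psi. Proof. exact: continuous_cf. Qed.

Let EcF_psi t : 0 <= t ->
  EcF t = \int[mu]_(s in `[0, t]) (a s * psi (t - s)) + \int[mu]_(s in `[0, t]) (a s * psi (t + s)).
Proof.
move=> t0.
have i1 b : continuous b -> mu.-integrable `[0, t] (EFin \o (fun s => a s * psi (b s))).
  move=> cb; apply: continuous_compact_integrable; first exact: segment_compact.
  apply: continuous_subspaceT => s; apply: cvgM; first exact: ca.
  by apply: continuous_comp; [exact: cb|exact: cpsi].
have c1 : continuous (fun s : R => t - s) by move=> s; apply: cvgB; [exact: cvg_cst|exact: cvg_id].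
have c2 : continuous (fun s : R => t + s) by move=> s; apply: cvgD; [exact: cvg_cst|exact: cvg_id].
rewrite -RintegralD; [|exact: measurable_itv|exact: i1|exact: i1].
rewrite /EcF.
have E w : 2 * cos (t * U w) * F t (U w) =
    \int[mu]_(s in `[0, t]) (a s * (cos ((t - s) * U w) + cos ((t + s) * U w))).
  rewrite -RintegralZl; [|exact: measurable_itv|exact: ih].
  apply: eq_Rintegral => s _.
  (* Product-to-sum: the factor 2 from differentiating the square is used up here. *)
  have E' (x y b : R) : 2 * cos x * (b * cos y) = b * (cos (x - y) + cos (x + y)).
    by rewrite cosB cosD; ring.
  by rewrite E' mulrBl mulrDl.
under eq_Rintegral do rewrite E.
rewrite (@RFubini _ _ _ _ _ P mu setT measurableT _ (measurable_itv _)
  (fun z => a z.2 * (cos ((t - z.2) * U z.1) + cos ((t + z.2) * U z.1))) (cst (a t * 2)) (cst 1)).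
- apply: eq_Rintegral => s _ /=.
  have iP r : P.-integrable setT (EFin \o (fun w => cos (r * U w))).
    by apply: (@probability_integrable _ _ _ P _ 1) => // w; exact: cos_max.
  by rewrite RintegralZl ?RintegralD// ?mulrDr//; exact: RintegrableD.
- have mc : measurable_fun setT (@cos R).
    by apply: continuous_measurable_fun; exact: continuous_cos.
  apply: measurable_funM; first exact: (measurableT_comp ma).
  apply: measurable_funD; apply: (measurableT_comp mc); apply: measurable_funM.
  + exact: measurable_funB.
  + exact: measurableT_comp.
  + exact: measurable_funD.
  + exact: measurableT_comp.
- exact: iPcst.
- exact: icst.
- move=> w s _ /=; rewrite in_itv/= => /andP[s0 st].
  rewrite mulr1 normrM (gtr0_norm (a_gt0 s)) ler_pM ?(ltW (a_gt0 s))//; first exact: a_le.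
  by rewrite (le_trans (ler_normD _ _))// [leRHS]mulr2n lerD// cos_max.
Qed.

(** After Fubini the integrand is a(t) psi(t): the growth of a is cancelled by the decay of psi, and
    only the length of the interval is left. *)
Lemma mean_trunc_cos_int_le M : 0 <= M -> `|\int[P]_w F M (U w)| <= M.
Proof.
move=> M0; rewrite /trunc_cos_int.
rewrite (@RFubini _ _ _ _ _ P mu setT measurableT _ (measurable_itv _)
  (fun z => a z.2 * cos (z.2 * U z.1)) (cst (a M)) (cst 1)).
- have ip : mu.-integrable `[0, M] (EFin \o (fun t => a t * psi t)).
    apply: continuous_compact_integrable; first exact: segment_compact.
    by apply: continuous_subspaceT => s; apply: cvgM; [exact: ca|exact: cpsi].
  have -> : \int[mu]_(t in `[0, M]) \int[P]_w (a t * cos (t * U w)) =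
      \int[mu]_(t in `[0, M]) (a t * psi t).
    apply: eq_Rintegral => t _; rewrite RintegralZl//.
    by apply: (@probability_integrable _ _ _ P _ 1) => // w; exact: cos_max.
  apply: (le_trans (le_normr_Rintegral _ _)) => //.
  rewrite -[leRHS]mul1r -(Rintegral_itv_cst _ M0).
  apply: le_Rintegral; [exact: measurable_itv|exact: (integrable_norm ip)|exact: icst|].
  move=> t /=; rewrite in_itv/= => /andP[t0 _].
  rewrite normrM (gtr0_norm (a_gt0 t)) -ler_pdivlMl// mulr1.
  by have := psi_le t0; rewrite sexpN.
- apply: measurable_funM; last exact: mcosU2'.
  exact: (measurableT_comp ma).
- exact: iPcst.
- exact: icst.
- move=> w t _ /=; rewrite in_itv/= => /andP[t0 tM].
  rewrite mulr1 normrM (gtr0_norm (a_gt0 t)) (le_trans _ (a_le t0 tM))//.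
  by rewrite ler_piMr ?cos_max// ltW.
Qed.

(** Here l < 1 enters: u <= u^l for u = (t - s)/t gives t^l - (t - s)^l <= s t^(l - 1), which tends
    to 0. The upper bound 1 is monotonicity. *)
Let cvg_a_ratio s : 0 <= s -> a (t - s) / a t @[t --> +oo] --> (1 : R).
Proof.
move=> s0.
apply: (@squeeze_cvgr _ _ _ _ (fun t => expR (- (c * s) * (t `^ (1 - l))^-1)) (cst 1)); last exact: cvg_cst.
  near=> t.
  have t0 : 0 < t by near: t; apply: nbhs_pinfty_gt; exact: num_real.
  have st : s < t by near: t; apply: nbhs_pinfty_gt; exact: num_real.
  have ts0 : 0 < t - s by rewrite subr_gt0.
  apply/andP; split; last first.
    by rewrite ler_pdivrMr ?a_gt0// mul1r a_le ?(ltW ts0)// lerBlDr lerDl.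
  rewrite /a /stretched_exp !gtr0_norm// -expRN -expRD ler_expR.
  have E : (t - s) `^ l = t `^ l * ((t - s) / t) `^ l.
    by rewrite -powRM ?(ltW t0) ?divr_ge0 ?(ltW t0) ?(ltW ts0)// mulrCA divff ?gt_eqF// mulr1.
  have u : (t - s) / t <= ((t - s) / t) `^ l.
    apply: ger1_powR; last exact: ltW.
    by rewrite divr_gt0//= ler_pdivrMr// mul1r lerBlDr lerDl.
  have tl : t `^ l = t * (t `^ (1 - l))^-1.
    rewrite -powRN opprB -{2}(powRr1 (ltW t0)) -powRD; last by rewrite (gt_eqF t0) implybT.
    by rewrite addrC subrK.
  have H : c * (t `^ l * ((t - s) / t)) <= c * (t - s) `^ l.
    by rewrite E !ler_wpM2l ?(ltW c_gt0)// powR_ge0.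
  rewrite lerBrDr; apply: le_trans H.
  rewrite tl le_eqVlt; apply/orP; left; apply/eqP.
  by field; rewrite !gt_eqF// powR_gt0.
rewrite -[X in _ --> X]expR0; apply: continuous_cvg; first exact: continuous_expR.
rewrite -[X in _ --> X](mulr0 (- (c * s))); apply: cvgM; first exact: cvg_cst.
by apply: cvgyV0; apply: cvgy_powR; rewrite subr_gt0.
Unshelve. all: by end_near. Qed.

Let c1 (t : R) : continuous (fun s : R => t - s).
Proof. by move=> s; apply: cvgB; [exact: cvg_cst|exact: cvg_id]. Qed.

(** The reflection s |-> t - s moves t out of psi, and an indicator fixes the domain as the
    half-line. The ratio a(t - s)/a(t) is then at most 1 and tends to 1, so 1/a is a majorant. *)
Let cvg_conv : \int[mu]_(s in `[0, t]) (a s * psi (t - s)) / a t @[t --> +oo] -->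
  \int[mu]_(s in `[0, +oo[) psi s.
Proof.
pose D t := \int[mu]_(s in `[0, +oo[) (a (t - s) / a t * psi s * \1_(`[0, +oo[%classic : set R) (t - s)).
have DE t : 0 <= t -> \int[mu]_(s in `[0, t]) (a s * psi (t - s)) / a t = D t.
  move=> t0; rewrite Rintegral_reflect//; last first.
    move=> s; apply: cvgM; first exact: ca.
    by apply: (@continuous_comp _ _ _ (fun s => t - s) psi); [exact: c1|exact: cpsi].
  rewrite mulrC -RintegralZl; [|exact: measurable_itv|]; last first.
    apply: continuous_compact_integrable; first exact: segment_compact.
    apply: continuous_subspaceT => s; apply: cvgM.
      by apply: continuous_comp; [exact: c1|exact: ca].
    apply: (@continuous_comp _ _ _ (fun s => t - (t - s)) psi); last exact: cpsi.
    by apply: cvgB; [exact: cvg_cst|exact: c1].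
  rewrite /D Rintegral_mkcond [RHS]Rintegral_mkcond.
  apply: eq_Rintegral => s _; rewrite !patchE indicE.
  have E (s' : R) : (s' \in (`[0, t]%classic : set R)) =
    (s' \in (`[0, +oo[%classic : set R)) && (t - s' \in (`[0, +oo[%classic : set R)).
    by rewrite !mem_setE !in_itv/= !andbT subr_ge0.
  have E2 (s' : R) : (a t)^-1 * (a (t - s') * psi (t - (t - s'))) = a (t - s') / a t * psi s'.
    by rewrite opprB addrCA subrr addr0; ring.
  by rewrite E E2; case: (s \in _) => //=; case: (_ \in _); rewrite /= ?mulr1 ?mulr0.
apply: (@cvg_trans _ (D t @[t --> +oo])).
  apply: near_eq_cvg; near=> t.
  have t0 : 0 <= t by near: t; apply: nbhs_pinfty_ge; exact: num_real.
  by rewrite (DE t t0).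
(* Dominated convergence concerns sequences, so the limit is tested along an arbitrary sequence
   tending to infinity. *)
apply/cvg_pinftyP => u uy.
have mind (t : R) : measurable_fun setT (fun s : R => \1_(`[0%R, +oo[%classic : set R) (t - s) : R).
  apply: (measurableT_comp (f := (\1_(`[0%R, +oo[%classic : set R) : R -> R))).
    exact: measurable_indic.
  by apply: continuous_measurable_fun; exact: c1.
apply: (@Rdominated_cvg _ _ _ mu _ (measurable_itv _) _ _ (stretched_exp l (- c))).
- move=> n; apply: measurable_funTS; apply: measurable_funM; last exact: mind.
  apply: continuous_measurable_fun => s; apply: cvgM; last exact: cpsi.
  apply: cvgM; last exact: cvg_cst.
  by apply: (@continuous_comp _ _ _ (fun s => u n - s) a); [exact: c1|exact: ca].
- by apply: measurable_funTS; exact: continuous_measurable_fun.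
- move=> s /=; rewrite in_itv/= andbT => s0.
  apply: (@cvg_comp _ _ _ u (fun t => a (t - s) / a t * psi s * \1_(`[0, +oo[%classic : set R) (t - s))) uy _.
  rewrite -[X in _ `=>` nbhs X]mul1r -[X in _ `=>` nbhs X]mulr1.
  apply: cvgM; first by apply: cvgM; [exact: cvg_a_ratio|exact: cvg_cst].
  apply: (@cvg_trans _ (cst (1:R) t @[t --> +oo])); last exact: cvg_cst.
  apply: near_eq_cvg; near=> t; rewrite indicE mem_setE in_itv/= andbT subr_ge0.
  suff -> : s <= t by [].
  by near: t; apply: nbhs_pinfty_ge; exact: num_real.
- exact: integrable_sexpN.
- move=> n s /=; rewrite in_itv/= andbT => s0.
  rewrite indicE mem_setE in_itv/= andbT; case: (boolP (0 <= u n - s)) => us.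
    rewrite mulr1 normrM -[leRHS]mul1r ler_pM//; last exact: psi_le.
    rewrite normrM normfV !(gtr0_norm (a_gt0 _)) ler_pdivrMr// mul1r a_le//.
    by rewrite lerBlDr lerDl.
  by rewrite mulr0 normr0 ltW// sexp_gt0.
Unshelve. all: by end_near. Qed.

Let cvg_tail : \int[mu]_(s in `[0, t]) (a s * psi (t + s)) / a t @[t --> +oo] --> (0 : R).
Proof.
apply: (@norm_squeeze0 _ _ _ _ _ (fun t => t / a t)); last exact: cvgy_div_sexp.
near=> t.
have t0 : 0 <= t by near: t; apply: nbhs_pinfty_ge; exact: num_real.
rewrite normrM (gtr0_norm (_ : 0 < (a t)^-1)) ?invr_gt0// ler_wpM2r ?invr_ge0 ?(ltW (a_gt0 _))//.
have ip : mu.-integrable `[0, t] (EFin \o (fun s => a s * psi (t + s))).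
  apply: continuous_compact_integrable; first exact: segment_compact.
  apply: continuous_subspaceT => s; apply: cvgM; first exact: ca.
  apply: continuous_comp; last exact: cpsi.
  by apply: cvgD; [exact: cvg_cst|exact: cvg_id].
apply: (le_trans (le_normr_Rintegral _ _)) => //.
rewrite -[leRHS]mul1r -(Rintegral_itv_cst _ t0).
apply: le_Rintegral; [exact: measurable_itv|exact: (integrable_norm ip)|exact: icst|].
move=> s /=; rewrite in_itv/= => /andP[s0 _].
have ts0 : 0 <= t + s by rewrite addr_ge0.
rewrite normrM (gtr0_norm (a_gt0 s)) -ler_pdivlMl// mulr1.
rewrite (le_trans (psi_le ts0))// sexpN lef_pV2 ?posrE ?sexp_gt0// a_le//.
by rewrite lerDr.
Unshelve. all: by end_near. Qed.

Let mEcF : measurable_fun setT EcF.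
Proof.
apply: (measurable_Rintegral_param P (f := fun z : R * T => 2 * cos (z.1 * U z.2) * F z.1 (U z.2))) => //.
by apply: measurable_funM; [exact: measurable_funM|exact: mFU2].
Qed.

(** The integrand a(t) [EcF] t is rewritten as a^2 [rho], where a^2 is again a stretched
    exponential, with parameter 2 c, and [rho] converges; [cvg_stretched_exp_ratio] at 2 c then
    gives the limit and its denominator. *)
Lemma cvg_second_moment :
  (\int[P]_w (F M (U w) ^+ 2)) / (M `^ (1 - l) * a M ^+ 2) @[M --> +oo] -->
  (\int[mu]_(s in `[0, +oo[) psi s) / (2 * c * l).
Proof.
pose rho t := EcF t / a t.
have rhoE t : stretched_exp l (2 * c) t * rho t = a t * EcF t.
  have -> : 2 * c = c + c by ring.
  by rewrite -sexpM /rho -/a mulrCA !mulrA mulfK ?gt_eqF// mulrC.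
have rho_cvg : rho t @[t --> +oo] --> \int[mu]_(s in `[0, +oo[) psi s.
  apply: (@cvg_trans _ (\int[mu]_(s in `[0, t]) (a s * psi (t - s)) / a t +
     \int[mu]_(s in `[0, t]) (a s * psi (t + s)) / a t @[t --> +oo])).
    apply: near_eq_cvg; near=> t.
    have t0 : 0 <= t by near: t; apply: nbhs_pinfty_ge; exact: num_real.
    by rewrite /rho (EcF_psi t0) mulrDl.
  rewrite -[X in _ `=>` nbhs X]addr0.
  by apply: cvgD; [exact: cvg_conv|exact: cvg_tail].
have irho M : mu.-integrable `[0, M] (EFin \o (fun t => stretched_exp l (2 * c) t * rho t)).
  rewrite (_ : (fun t => _) = fun t => a t * EcF t); last by apply/funext => t; exact: rhoE.
  apply: (@bounded_integrable _ _ _ mu _ _ _ (a M * (2 * (M * a M))));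
    [exact: measurable_itv|exact: lebesgue_itv_lty| |].
    by apply: measurable_funTS; exact: measurable_funM.
  move=> t /=; rewrite in_itv/= => /andP[t0 tM].
  rewrite normrM (gtr0_norm (a_gt0 t)) ler_pM ?(ltW (a_gt0 t)) ?a_le//.
  apply: normr_expectation_le.
    by apply: measurable_funM; [exact: measurable_funM|exact: mFU].
  move=> w; rewrite normrM ler_pM//.
    by rewrite normrM ger0_norm// ler_piMr// cos_max.
  apply: (le_trans (F_le _ t0)).
  by apply: ler_pM; [exact: t0|exact: (ltW (a_gt0 t))|exact: tM|exact: a_le].
have c20 : 0 < 2 * c by rewrite mulr_gt0.
have := cvg_stretched_exp_ratio l_gt0 l_lt1 c20 irho rho_cvg.
apply: cvg_trans; apply: near_eq_cvg; near=> M.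
have M0 : 0 <= M by near: M; apply: nbhs_pinfty_ge; exact: num_real.
rewrite (second_moment_int M0); congr (_ / _).
  by apply: eq_Rintegral => t _; exact: rhoE.
by rewrite (_ : 2 * c = c + c) -?sexpM//; ring.
Unshelve. all: by end_near. Qed.

Lemma cvg_sup_trunc_cos_int :
  (\int[mu]_(t in `[0, M]) stretched_exp l c t) / (M `^ (1 - l) * a M) @[M --> +oo] -->
  1 / (c * l).
Proof.
have i1 M : mu.-integrable `[0, M] (EFin \o (fun t => stretched_exp l c t * cst 1 t)).
  rewrite (_ : (fun t => _) = a); first exact: ia.
  by apply/funext => t; rewrite mulr1.
have one_cvg : cst (1:R) (t : R) @[t --> +oo] --> (1:R) by exact: cvg_cst.
have := cvg_stretched_exp_ratio l_gt0 l_lt1 c_gt0 i1 one_cvg.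
apply: cvg_trans; apply: near_eq_cvg; near=> M; congr (_ / _).
by apply: eq_Rintegral => t _; rewrite mulr1.
Unshelve. all: by end_near. Qed.

End second_moment.

(** * The deconvolution estimator *)

Lemma Rintegral_even (R : realType) (G : R -> R) (M : R) : 0 <= M -> continuous G ->
  (forall t, G (- t) = G t) ->
  \int[lebesgue_measure]_(t in `[- M, M]) G t = 2 * \int[lebesgue_measure]_(t in `[0, M]) G t.
Proof.
move=> M0 cG evenG.
have iG (x y : R) : lebesgue_measure.-integrable `[x, y] (EFin \o G).
  apply: continuous_compact_integrable; first exact: segment_compact.
  exact: continuous_subspaceT.
have := @Rintegral_itvB R G (BLeft (- M)) (BRight M) 0 (iG _ _).
rewrite !bnd_simp oppr_le0 => /(_ M0 M0).
rewrite Rintegral_itv_obnd_cbnd; last first.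
  by apply: integrableS (iG 0 M) => //; exact: subset_itv_oc_cc.
move=> /eqP; rewrite subr_eq => /eqP ->.
have -> : \int[lebesgue_measure]_(t in `[- M, 0]) G t = \int[lebesgue_measure]_(t in `[0, M]) G t.
  rewrite /Rintegral; congr fine.
  have := @integration_by_substitution_oppr R G 0 M M0; rewrite oppr0 => ->.
    by apply: eq_integral => t _ /=; rewrite evenG.
  exact: continuous_subspaceT.
by rewrite mulr2n mulrDl mul1r.
Qed.

(** * The estimator as an average of real cosine integrals *)

Section deconvolution.
Context {R : realType}.
Implicit Types (a k : R -> R) (x h : R) (xs : nat -> R).

Let ReZ (r : R) (z : R[i]) : complex.Re (r%:C * z) = r * complex.Re z.
Proof. by case: z => u v /=; rewrite mul0r subr0. Qed.

Let ReD (z w : R[i]) : complex.Re (z + w) = complex.Re z + complex.Re w.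
Proof. by case: z w => [? ?] [? ?]. Qed.

Let expiD (s t : R) : expi (s + t) = expi s * expi t.
Proof. by rewrite /expi cosD sinD; apply/eqP; rewrite eq_complex/= [X in _ && (X == _)]addrC !eqxx. Qed.

Let Re_sum n (z : nat -> R[i]) : complex.Re (\sum_(j < n) z j) = \sum_(j < n) complex.Re (z j).
Proof. by apply: (big_morph (@complex.Re R) ReD). Qed.

Let cM (u v : R) : (u * v)%:C = u%:C * v%:C :> R[i]. Proof. exact: rmorphM. Qed.

Let cV (u : R) : (u^-1)%:C = (u%:C)^-1 :> R[i]. Proof. exact: fmorphV. Qed.

Let cn n : (n%:R : R)%:C = n%:R :> R[i]. Proof. exact: rmorph_nat. Qed.

(** Division by the characteristic function is multiplication by the real function a, so the real
    part keeps only cosines. Evenness folds [-1/h, 1/h] onto [0, 1/h]; the resulting factor 2 turns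
    1/(2 pi) into 1/pi. *)
Lemma sinc_deconvolutionE a k n h xs x : 0 < h -> continuous a -> (forall t, 0 < a t) ->
  (forall t, a (- t) = a t) -> (forall t, fourier k t = ((a t)^-1)%:C) ->
  sinc_deconvolution k n h xs x = n%:R^-1 * \sum_(j < n)
    (\int[lebesgue_measure]_(t in `[0, 1 / h]) (a t * cos (t * (xs j - x))) / pi).
Proof.
move=> h0 ca a0 evena ka; rewrite /sinc_deconvolution /deconvolution ReZ /=.
have E (t : R) : complex.Re (expi (- (t * x)) * (phi_sinc (h * t) * phi_emp n xs t / fourier k t)) =
    n%:R^-1 * \sum_(j < n) (a t * cos (t * (xs j - x))) * \1_(`[- (1 / h), 1 / h]%classic : set R) t.
  have -> : expi (- (t * x)) * (phi_sinc (h * t) * phi_emp n xs t / fourier k t) =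
      (\1_(`[- (1 / h), 1 / h]%classic : set R) t * n%:R^-1 * a t)%:C *
      \sum_(j < n) expi (t * (xs j - x)).
    rewrite ka /phi_sinc /phi_emp cV invrK !cM cV (cn n).
    have -> : \sum_(j < n) expi (t * (xs j - x)) =
        expi (- (t * x)) * \sum_(j < n) expi (t * xs j) :> R[i].
      by rewrite mulr_sumr; apply: eq_bigr => j _; rewrite -expiD mulrBr addrC.
    have -> : \1_(`[- (1 / h), 1 / h]%classic : set R) t = \1_(`[(-1 : R), 1]%classic : set R) (h * t) :> R.
      rewrite !indicE !mem_setE !in_itv/= -(ler_pdivlMl _ _ h0) -(ler_pdivrMl _ _ h0).
      by rewrite mulrN1 mulr1 div1r.
    by ring.
  rewrite ReZ (Re_sum _ (fun j => expi (t * (xs j - x)))) -mulr_suml.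
  have -> : \sum_(j < n) complex.Re (expi (t * (xs j - x))) = \sum_(j < n) cos (t * (xs j - x)).
    exact: eq_bigr.
  by rewrite -mulr_sumr; ring.
under eq_Rintegral do rewrite E.
pose u j := xs j - x.
have cu j : continuous (fun t : R => a t * cos (t * u j)).
  move=> t; apply: cvgM; first exact: ca.
  apply: continuous_comp; last exact: continuous_cos.
  by apply: cvgM; [exact: cvg_id|exact: cvg_cst].
have iu (j : 'I_n) : lebesgue_measure.-integrable `[- (1 / h), 1 / h]
    (EFin \o (fun t => a t * cos (t * u j))).
  apply: continuous_compact_integrable; first exact: segment_compact.
  exact: continuous_subspaceT.
have [isum Esum] := @Rintegral_sum _ _ _ lebesgue_measure _
  (measurable_itv `[- (1 / h), 1 / h]) _ (index_enum 'I_n) _ iu.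
have -> : \int[lebesgue_measure]_t (n%:R^-1 * \sum_(j < n) (a t * cos (t * (xs j - x))) *
    \1_(`[- (1 / h), 1 / h]%classic : set R) t) =
    n%:R^-1 * \sum_(j < n) (2 * \int[lebesgue_measure]_(t in `[0, 1 / h]) (a t * cos (t * u j))).
  transitivity (\int[lebesgue_measure]_(t in `[- (1 / h), 1 / h])
      (n%:R^-1 * \sum_(j < n) (a t * cos (t * u j)))).
    rewrite [RHS]Rintegral_mkcond; apply: eq_Rintegral => t _.
    by rewrite patchE indicE -mulr_suml mulrA; case: (t \in _); rewrite ?mulr1 ?mulr0.
  rewrite RintegralZl//; congr (_ * _); rewrite Esum; apply: eq_bigr => j _.
  apply: Rintegral_even => //; first by rewrite divr_ge0// ltW.
  by move=> t; rewrite evena mulNr cosN.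
rewrite mulrCA; congr (_ * _); rewrite mulr_sumr; apply: eq_bigr => j _.
rewrite -/(u j); set I := Rintegral _ _ _.
by rewrite invfM mulrCA !mulrA divff ?mul1r 1?mulrC.
Qed.

End deconvolution.

Section stable_cf.
Context d (T : measurableType d) (R : realType) (P : probability T R).
Variables (Z : {RV P >-> R}) (k phi : R -> R) (k_dens : has_density Z k).
Hypothesis k_cf : forall t, fourier k t = (phi t)%:C.

(** The imaginary part of [fourier k t] is zero, which removes the sine term of the addition
    formula. *)
Lemma expectation_cos_affine t c :
  \int[P]_w cos (t * (Z w + c)) = phi t * cos (t * c).
Proof.
have [k0 mk Zk] := k_dens.
have [Ecos Esin] : \int[lebesgue_measure]_z (cos (t * z) * k z) = phi t /\
    \int[lebesgue_measure]_z (sin (t * z) * k z) = 0.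
  have /eqP := k_cf t; rewrite eq_complex /= => /andP[/eqP H1 /eqP H2].
  split; [rewrite -H1|rewrite -[RHS]H2].
    by apply: eq_Rintegral => z _ /=; rewrite mulr0 subr0.
  by apply: eq_Rintegral => z _ /=; rewrite mulr0 add0r.
have mc (g : R -> R) : continuous g -> measurable_fun setT (fun z : R => g (t * z)).
  move=> cg; apply: continuous_measurable_fun => z; apply: continuous_comp; last exact: cg.
  by apply: cvgM; [exact: cvg_cst|exact: cvg_id].
have mcos := mc _ (@continuous_cos R); have msin := mc _ (@continuous_sin R).
have iP (g : R -> R) : measurable_fun setT g -> (forall z, `|g z| <= 1) ->
    P.-integrable setT (EFin \o (fun w => g (Z w))).
  by move=> mg g1; apply: (@probability_integrable _ _ _ P _ 1) => //; exact: measurableT_comp.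
have EZ (g : R -> R) : measurable_fun setT g -> (forall z, `|g z| <= 1) ->
    \int[P]_w g (Z w) = \int[lebesgue_measure]_z (g z * k z).
  by move=> mg g1; exact: (Rintegral_density _ _ _ _ mg g1).
have icos := iP _ mcos (fun z => cos_max (t * z)).
have isin := iP _ msin (fun z => sin_max (t * z)).
have <- : \int[P]_w (cos (t * c) * cos (t * Z w)) - \int[P]_w (sin (t * c) * sin (t * Z w)) =
    phi t * cos (t * c).
  rewrite RintegralZl// RintegralZl//.
  rewrite (EZ _ mcos (fun z => cos_max (t * z))) (EZ _ msin (fun z => sin_max (t * z))).
  by rewrite Ecos Esin mulr0 subr0 mulrC.
rewrite -RintegralB//; [|exact: RintegrableZl|exact: RintegrableZl].
by apply: eq_Rintegral => w _; rewrite mulrDr cosD; ring.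
Qed.

End stable_cf.

Lemma expectation_identically_distributed d (T : measurableType d) (R : realType)
    (P : probability T R) (X : nat -> {RV P >-> R}) (F : R -> R) (K : R) j :
  identically_distributed X -> measurable_fun setT F -> (forall x, `|F x| <= K) ->
  \int[P]_w F (X j w) = \int[P]_w F (X 0%N w).
Proof.
move=> Xid mF FK.
have i1 : P.-integrable setT (EFin \o cst (1:R)).
  exact: (finite_measure_integrable_cst P 1 measurableT).
have E (g : T -> R) : \int[P]_w g w = \int[P]_w (cst 1 w * g w).
  by apply: eq_Rintegral => w _; rewrite mul1r.
rewrite (E (fun w => F (X j w))) (E (fun w => F (X 0%N w))).
apply: (Rintegral_transfer i1 i1 _ _ _ mF FK) => // A mA.
by rewrite -!E !Rintegral_indic_comp// [P _](Xid j 0%N).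
Qed.

(** * Central limit theorem for bounded rows *)

Section triangular_array.
Context d (T : measurableType d) (R : realType) (P : probability T R).
Variables (X : nat -> {RV P >-> R}) (X_iid : iid X).
Variables (F : nat -> R -> R) (b : nat -> R) (v : R).
Hypotheses (mF : forall n, measurable_fun setT (F n))
  (Fb : forall n x, `|F n x| <= b n) (b0 : b n @[n --> \oo] --> 0)
  (F0 : forall n, \int[P]_w F n (X 0%N w) = 0)
  (Fv : n%:R * \int[P]_w (F n (X 0%N w) ^+ 2) @[n --> \oo] --> v).

Let S n w := \sum_(j < n) F n (X j w).

Let mS n : measurable_fun setT (S n).
Proof. by apply: measurable_sum => j; exact: measurableT_comp. Qed.

(** The limit law is realised as a random variable to which [levy_continuity] applies: the constant
    0 when v = 0, where [normal_law] is a point mass, and the identity under the normal probability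
    otherwise. *)
Lemma clt_triangular_array : cvg_in_distribution P S (normal_law 0 v).
Proof.
have v0 : 0 <= v.
  rewrite -(cvg_lim _ Fv)//; apply: limr_ge; first by apply/cvg_ex; exists v.
  by apply: nearW => n; rewrite mulr_ge0// Rintegral_ge0// => w _; exact: sqr_ge0.
split=> // y cy.
pose S' n : {RV P >-> R} := mfun_Sub (mem_set (mS n)).
have cfS t c : \int[P]_w cos (t * S' n w + c) @[n --> \oo] --> expR (- (v * t ^+ 2 / 2)) * cos c.
  exact: (clt_cf X_iid mF Fb b0 F0 Fv).
have [v00|vN0] := eqVneq v 0.
  pose N : {RV P >-> R} := cst 0.
  have dE : (fun z => normal_law 0 v `]-oo, z]%classic) = cdf N.
    apply/funext => z; rewrite /normal_law v00 eqxx /cdf /distribution /pushforward preimage_cst diracE.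
    by case: (0 \in _); rewrite ?probability_setT ?measure0.
  have := @levy_continuity _ _ _ P S' _ _ P N _ y.
  rewrite -dE; apply => // t c.
  have -> : \int[P]_w cos (t * N w + c) = expR (- (v * t ^+ 2 / 2)) * cos c.
    rewrite v00 !mul0r oppr0 expR0 mul1r /N /= mulr0 add0r.
    by rewrite Rintegral_cst//= probability_setT mulr1.
  exact: cfS.
have s0 : Num.sqrt v != 0 by rewrite sqrtr_eq0 -ltNge lt_def vN0.
(* The normal probability lives on [measurableTypeR R], so the identity has to be measurable from
   that copy of the line to R. *)
have mN : @measurable_fun _ default_measure_display (measurableTypeR R) R setT idfun.
  by move=> _ A mA; rewrite setTI.
pose N : {RV (normal_prob 0 (Num.sqrt v)) >-> R} :=
  @mfun_Sub _ default_measure_display (measurableTypeR R) R idfun (mem_set mN).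
have dE : (fun z => normal_law 0 v `]-oo, z]%classic) = cdf N.
  by apply/funext => z; rewrite /normal_law (negbTE vN0).
have := @levy_continuity _ _ _ P S' _ _ _ N _ y.
rewrite -dE; apply => // t c.
have -> : \int[normal_prob 0 (Num.sqrt v)]_w cos (t * N w + c) = expR (- (v * t ^+ 2 / 2)) * cos c.
  by rewrite integral_cos_normal_prob// sqr_sqrtr.
exact: cfS.
Qed.
End triangular_array.

Lemma sqr_cvg0 (R : realType) (u : nat -> R) :
  u n ^+ 2 @[n --> \oo] --> (0 : R) -> u n @[n --> \oo] --> (0 : R).
Proof.
move=> u2; apply: (@norm_squeeze0 _ _ _ _ _ (fun n => Num.sqrt (u n ^+ 2))).
  by apply: nearW => n; rewrite sqrtr_sqr.
rewrite -[X in _ --> X](sqrtr0 R); apply: continuous_cvg => //; exact: sqrt_continuous.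
Qed.

(** * Application to the stable deconvolution estimator *)

Section stable_deconvolution.
Context d (T : measurableType d) (R : realType) (P : probability T R).
Variables (mu lambda : R) (k f : R -> R) (X Y Z : nat -> {RV P >-> R}) (h : nat -> R) (x : R).
Hypotheses (mu_gt0 : 0 < mu) (lambda_gt : 1 / 3 < lambda) (lambda_lt1 : lambda < 1)
  (k_cont : continuous k)
  (k_stable : forall t : R, fourier k t = (expR (- (`|t| `^ lambda / mu)))%:C)
  (X_sum : forall (j : nat) (w : T), X j w = Y j w + Z j w) (X_iid : iid X)
  (YZ_indep : forall j : nat, independent2 (Y j) (Z j))
  (Y_density : forall j : nat, has_density (Y j) f)
  (Z_density : forall j : nat, has_density (Z j) k)
  (h_gt0 : forall n : nat, 0 < h n) (h_cvg0 : h n @[n --> \oo] --> (0 : R))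
  (nh_cvgy : n%:R * h n @[n --> \oo] --> +oo).

Let c := mu^-1.
Let c_gt0 : 0 < c. Proof. by rewrite invr_gt0. Qed.
Let a := stretched_exp lambda c.
Let M n := 1 / h n.
Let l_gt0 : 0 < lambda. Proof. by apply: lt_trans lambda_gt; rewrite divr_gt0. Qed.
Let a_gt0 t : 0 < a t. Proof. exact: sexp_gt0. Qed.
Let M_gt0 n : 0 < M n. Proof. exact: divr_gt0. Qed.

Let k_cf t : fourier k t = ((a t)^-1)%:C.
Proof. by rewrite k_stable /a /stretched_exp -expRN [_ / mu]mulrC. Qed.

Let k_cf' t : fourier k t = (stretched_exp lambda (- c) t)%:C.
Proof. by rewrite sexpN -k_cf. Qed.

Let a_even t : a (- t) = a t. Proof. by rewrite /a /stretched_exp normrN. Qed.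

Let cvg_M : M n @[n --> \oo] --> +oo.
Proof.
rewrite (_ : M = fun n => (h n)^-1); last by apply/funext => n; rewrite /M div1r.
by apply/cvgrVy => //; exact: nearW.
Qed.

Let U w := X 0%N w - x.
Let mU : measurable_fun setT U. Proof. exact: measurable_funB. Qed.
Let psi r := \int[P]_w cos (r * U w).

Let psi_le r : 0 <= r -> `|psi r| <= stretched_exp lambda (- c) r.
Proof.
move=> r0; have cfZ := expectation_cos_affine (Z_density 0) k_cf'.
rewrite /psi /U (cf_sum cfZ x (YZ_indep 0) (X_sum 0)) normrM (gtr0_norm (sexp_gt0 _ _ _)).
rewrite ler_piMr ?(ltW (sexp_gt0 _ _ _))// normr_expectation_le// => [|w]; last exact: cos_max.
apply: (measurableT_comp (f := cos)).
  by apply: continuous_measurable_fun; exact: continuous_cos.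
by apply: measurable_funM => //; exact: measurable_funB.
Qed.

Let psi_int : \int[lebesgue_measure]_(t in `[0, +oo[) psi t = pi * convolution k f x.
Proof.
have cfZ := expectation_cos_affine (Z_density 0) k_cf'.
rewrite (convolution_inversion k_cont (Z_density 0) _ _ _ cfZ x (YZ_indep 0) (Y_density 0) (X_sum 0))//.
- by apply: continuous_measurable_fun; exact: continuous_sexp.
- by move=> t; exact: (ltW (sexp_gt0 _ _ _)).
- exact: integrable_sexpN.
Qed.

Let s n := h n `^ ((lambda - 1) / 2) * a (M n).

Let s_gt0 n : 0 < s n. Proof. by rewrite mulr_gt0// powR_gt0. Qed.

Let s_sqr n : s n ^+ 2 = M n `^ (1 - lambda) * a (M n) ^+ 2.
Proof.
rewrite exprMn; congr (_ * _).
rewrite -powR_mulrn ?powR_ge0// -powRrM divfK// /M div1r.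
by rewrite -powR_inv1 ?(ltW (h_gt0 _))// -powRrM mulN1r opprB.
Qed.

Let V n u := trunc_cos_int lambda c (M n) u / pi.
Let A n := \int[lebesgue_measure]_(t in `[0, M n]) a t.
Let m n := \int[P]_w V n (U w).


Let V_le n u : `|V n u| <= A n / pi.
Proof.
rewrite normrM normfV (gtr0_norm (pi_gt0 _)) ler_wpM2r ?invr_ge0 ?pi_ge0//.
exact: trunc_cos_int_le.
Qed.

Let mV n : measurable_fun setT (V n).
Proof.
apply: measurable_funM => //.
apply: (measurable_Rintegral_param lebesgue_measure (f := fun z : R * R => a z.2 * cos (z.2 * z.1))) => //.
apply: measurable_funM.
  apply: (measurableT_comp (f := a)) => //.
  by apply: continuous_measurable_fun; exact: continuous_sexp.
apply: (measurableT_comp (f := cos)); last exact: measurable_funM.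
by apply: continuous_measurable_fun; exact: continuous_cos.
Qed.

Let mVx n : measurable_fun setT (fun y : R => V n (y - x)).
Proof. by apply: (measurableT_comp (mV n)); exact: measurable_funB. Qed.

Let mVX n j : measurable_fun setT (fun w => V n (X j w - x)).
Proof. by apply: (measurableT_comp (mV n)); exact: measurable_funB. Qed.

Let iVX n j : P.-integrable setT (EFin \o (fun w => V n (X j w - x))).
Proof. exact: (@probability_integrable _ _ _ P _ (A n / pi)). Qed.

Let icst (r : R) : P.-integrable setT (EFin \o cst r).
Proof. exact: (finite_measure_integrable_cst P r measurableT). Qed.

Let intcst (r : R) : \int[P]_w (cst r w) = r.
Proof. by rewrite Rintegral_cst//= probability_setT mulr1. Qed.

Let VX n j : \int[P]_w V n (X j w - x) = m n.
Proof.
apply: (@expectation_identically_distributed _ _ _ P X (fun y => V n (y - x)) (A n / pi) j) => //.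
by case: X_iid.
Qed.

(** The norming together with the 1/n of the average: the weight of a single summand. *)
Let r n : R := Num.sqrt n%:R / s n / n%:R.

Let r_ge0 n : 0 <= r n.
Proof. by rewrite !divr_ge0// ?sqrtr_ge0// ltW. Qed.

Let F n y := r n * (V n (y - x) - m n).

Let m_le n : `|m n| <= A n / pi.
Proof. exact: normr_expectation_le (mVX n 0%N) _. Qed.

Let F_le n y : `|F n y| <= r n * (A n / pi + A n / pi).
Proof.
rewrite normrM (ger0_norm (r_ge0 n)) ler_wpM2l//.
by rewrite (le_trans (ler_normB _ _))// lerD.
Qed.

(** By [cvg_sup_trunc_cos_int], A is of the order of B = M^(1 - lambda) a(M), so the bound behaves
    like q = B/(s sqrt n). Its square is M^(1 - lambda)/n, that is M^(- lambda)/(n h), and both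
    factors tend to 0. *)
Let b_cvg0 : r n * (A n / pi + A n / pi) @[n --> \oo] --> (0 : R).
Proof.
pose B n := M n `^ (1 - lambda) * a (M n).
pose q n := Num.sqrt n%:R / n%:R * (B n / s n).
have B0 n : 0 < B n by rewrite mulr_gt0// powR_gt0.
have -> : (fun n => r n * (A n / pi + A n / pi)) = (fun n => 2 / pi * (A n / B n) * q n).
  apply/funext => n; rewrite /r /q; set N := (n%:R)^-1.
  have := lt0r_neq0 (B0 n); have := lt0r_neq0 (s_gt0 n); have := lt0r_neq0 (pi_gt0 R).
  move: (A n) (B n) (s n) N (Num.sqrt _) (@pi R) => A' B' s' N S p p0 s0 b0.
  by field; rewrite p0 s0 b0.
have q0 : q n @[n --> \oo] --> (0 : R).
  apply: sqr_cvg0.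
  have -> : (fun n => q n ^+ 2) = (fun n => (n%:R * h n)^-1 * (M n `^ lambda)^-1).
    apply/funext => n; rewrite /q exprMn !expr_div_n s_sqr sqr_sqrtr// /B exprMn.
    have M1 : M n `^ (1 - lambda) = (h n)^-1 * (M n `^ lambda)^-1.
      rewrite -powRN -div1r -/(M n) -{2}(powRr1 (ltW (M_gt0 n))) -powRD//.
      by rewrite (gt_eqF (M_gt0 n)) implybT.
    have -> : (n%:R * h n)^-1 / M n `^ lambda = n%:R^-1 * M n `^ (1 - lambda).
      by rewrite M1 [in LHS]invfM [RHS]mulrA.
    (* At n = 0 both sides are 0, the inverse of 0 being 0. *)
    case: n {M1} => [|n]; first by rewrite !mul0r invr0 mul0r.
    have M0 : M n.+1 `^ (1 - lambda) != 0 by rewrite gt_eqF// powR_gt0.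
    have a0 := lt0r_neq0 (a_gt0 (M n.+1)).
    have : (n.+1%:R : R) != 0 by rewrite pnatr_eq0.
    by move: (n.+1%:R : R) => N n0; field; rewrite M0 a0 n0.
  rewrite -[X in _ --> X](mulr0 (0:R)); apply: cvgM.
    by apply/gtr0_cvgV0 => //; near=> n; rewrite mulr_gt0// ltr0n; near: n; exact: nbhs_infty_gt.
  apply: (@cvg_comp _ _ _ M (fun t => (t `^ lambda)^-1)); first exact: cvg_M.
  by apply: cvgyV0; exact: cvgy_powR.
rewrite -[X in _ --> X](mulr0 (2 / pi * (1 / (c * lambda)))).
apply: cvgM q0; apply: cvgM; first exact: cvg_cst.
apply: (@cvg_comp _ _ _ M (fun M =>
  (\int[lebesgue_measure]_(t in `[0, M]) a t) / (M `^ (1 - lambda) * a M))); first exact: cvg_M.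
exact: (@cvg_sup_trunc_cos_int R lambda c).
Unshelve. all: by end_near. Qed.

Let F0 n : \int[P]_w F n (X 0%N w) = 0.
Proof.
rewrite RintegralZl//; last by apply: RintegrableB => //; exact: (icst (m n)).
rewrite RintegralB//; last exact: (icst (m n)).
by rewrite (intcst (m n)) subrr mulr0.
Qed.

Let var_V n : \int[P]_w (V n (U w) - m n) ^+ 2 = \int[P]_w (V n (U w) ^+ 2) - m n ^+ 2.
Proof.
have i2 : P.-integrable setT (EFin \o (fun w => V n (U w) ^+ 2)).
  apply: (@probability_integrable _ _ _ P _ ((A n / pi) ^+ 2)).
    by apply: measurable_funX; exact: mVX.
  by move=> w; rewrite normrX lerXn2r ?nnegrE// (le_trans _ (V_le n 0)).
have i1 : P.-integrable setT (EFin \o (fun w => 2 * m n * V n (U w))).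
  by apply: RintegrableZl => //; exact: iVX.
have E (v u : R) : (v - u) ^+ 2 = v ^+ 2 - (2 * u * v - u ^+ 2) by ring.
under eq_Rintegral do rewrite E.
rewrite RintegralB//; last by apply: RintegrableB => //; exact: (icst (m n ^+ 2)).
rewrite RintegralB//; last exact: (icst (m n ^+ 2)).
rewrite RintegralZl//; last exact: iVX.
by rewrite (intcst (m n ^+ 2)) -/(m n); ring.
Qed.

(** As n r^2 = 1/s^2 for n > 0, the quantity is the variance of V over s^2. The second moment
    supplies the limit; the squared mean is of order M^2, negligible against s^2, which contains
    a(M)^2. *)
Let Fv : n%:R * \int[P]_w (F n (X 0%N w) ^+ 2) @[n --> \oo] -->
  1 / (2 * pi) * (mu / lambda) * convolution k f x.
Proof.
pose J M := \int[P]_w (trunc_cos_int lambda c M (U w) ^+ 2).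
pose D n := J (M n) / (M n `^ (1 - lambda) * a (M n) ^+ 2) * (pi ^+ 2)^-1 - m n ^+ 2 / s n ^+ 2.
apply: (@cvg_trans _ (D n @[n --> \oo])).
  apply: near_eq_cvg; near=> n.
  have n0 : (n%:R : R) != 0.
    by rewrite pnatr_eq0 -lt0n; near: n; exact: nbhs_infty_gt.
  have -> : \int[P]_w F n (X 0%N w) ^+ 2 = r n ^+ 2 * \int[P]_w (V n (U w) - m n) ^+ 2.
    rewrite -RintegralZl; [|exact: measurableT|]; last first.
      apply: (@probability_integrable _ _ _ P _ ((A n / pi + A n / pi) ^+ 2)).
        by apply: measurable_funX; apply: measurable_funB => //; exact: mVX.
      move=> w; rewrite normrX lerXn2r ?nnegrE//.
        by rewrite (le_trans _ (lerD (V_le n 0) (V_le n 0)))// addr_ge0.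
      by rewrite (le_trans (ler_normB _ _))// lerD.
    by apply: eq_Rintegral => w _; rewrite exprMn.
  rewrite var_V /D.
  have -> : \int[P]_w (V n (U w) ^+ 2) = J (M n) * (pi ^+ 2)^-1.
    rewrite mulrC /J -RintegralZl//; last first.
      apply: (@probability_integrable _ _ _ P _ (A n ^+ 2)).
        apply: measurable_funX.
        apply: eq_measurable_fun (measurable_funM (mVX n 0%N) (measurable_cst (pi : R))).
        by move=> w _; rewrite /V /= divfK// gt_eqF// pi_gt0.
      move=> w; rewrite normrX lerXn2r ?nnegrE//; last exact: trunc_cos_int_le.
      exact: (le_trans (normr_ge0 (trunc_cos_int lambda c (M n) 0)) (trunc_cos_int_le _ _ _ _)).
    by apply: eq_Rintegral => w _; rewrite /V expr_div_n mulrC.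
  rewrite -s_sqr mulrA; have -> : n%:R * r n ^+ 2 = (s n ^+ 2)^-1.
    rewrite /r !expr_div_n sqr_sqrtr//.
    by field; rewrite n0 lt0r_neq0.
  by rewrite mulrBr; ring.
(* With c = 1/mu, the limit pi g(x)/(2 c lambda) of [cvg_second_moment] is divided by pi^2, from the
   factor 1/pi in [V]; the subtracted 0 is the limit of the squared means. *)
have -> : 1 / (2 * pi) * (mu / lambda) * convolution k f x =
    pi * convolution k f x / (2 * c * lambda) * (pi ^+ 2)^-1 - 0.
  rewrite subr0 /c; have := lt0r_neq0 (pi_gt0 R); have := lt0r_neq0 mu_gt0.
  have := lt0r_neq0 l_gt0; move: (@pi R) => p l0 mu0 p0.
  by field; rewrite p0 l0 mu0.
apply: cvgB.
  apply: cvgM; last exact: cvg_cst.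
  apply: (@cvg_comp _ _ _ M (fun M => J M / (M `^ (1 - lambda) * a M ^+ 2))); first exact: cvg_M.
  rewrite -psi_int; exact: cvg_second_moment.
(* The majorant combines |m| <= M/pi with s^2 = M^(1 - lambda) a(M)^2. *)
apply: (@norm_squeeze0 _ _ _ _ _ (fun n => (M n / a (M n)) ^+ 2 * (M n `^ (1 - lambda))^-1 * (pi ^+ 2)^-1)).
  apply: nearW => n; rewrite s_sqr ger0_norm; last first.
    by rewrite divr_ge0 ?sqr_ge0// mulr_ge0 ?powR_ge0 ?sqr_ge0.
  have mM : m n ^+ 2 <= M n ^+ 2 * (pi ^+ 2)^-1.
    rewrite -expr_div_n -real_normK ?num_real// lerXn2r ?nnegrE//.
      by rewrite divr_ge0 ?pi_ge0// ltW.
    have E : \int[P]_w trunc_cos_int lambda c (M n) (U w) = pi * m n.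
      rewrite -RintegralZl//; last exact: (iVX n 0%N).
      by apply: eq_Rintegral => w _; rewrite /V mulrC divfK// gt_eqF// pi_gt0.
    rewrite ler_pdivlMr ?pi_gt0//.
    have := mean_trunc_cos_int_le lambda_gt c_gt0 mU psi_le (ltW (M_gt0 n)).
    by rewrite E normrM (gtr0_norm (pi_gt0 _)) mulrC.
  apply: (@le_trans _ _ (M n ^+ 2 * (pi ^+ 2)^-1 / (M n `^ (1 - lambda) * a (M n) ^+ 2))).
    by rewrite ler_wpM2r// invr_ge0 mulr_ge0 ?powR_ge0 ?sqr_ge0.
  have E (p q r' s' : R) : p * q * (r' * s') = p * s' * r' * q by ring.
  by rewrite (expr_div_n (M n) (a (M n))) (invfM (M n `^ (1 - lambda))) E.
apply: (@cvg_comp _ _ _ M (fun t => (t / a t) ^+ 2 * (t `^ (1 - lambda))^-1 * (pi ^+ 2)^-1)).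
  exact: cvg_M.
rewrite -[X in _ `=>` nbhs X](mul0r (pi ^+ 2)^-1); apply: cvgM; last exact: cvg_cst.
rewrite -[X in _ `=>` nbhs X](mul0r (0 : R)); apply: cvgM.
  have ta : t / a t @[t --> +oo] --> (0 : R) by exact: cvgy_div_sexp.
  rewrite (_ : (fun t => _) = (fun t => t / a t * (t / a t))); last first.
    by apply/funext => t; rewrite expr2.
  by rewrite -[X in _ `=>` nbhs X](mul0r (0 : R)); apply: cvgM.
by apply: cvgyV0; apply: cvgy_powR; rewrite subr_gt0.
Unshelve. all: by end_near. Qed.

Theorem stable_deconvolution_clt :
  let g := convolution k f in
  let fnh := fun (n : nat) (w : T) =>
    sinc_deconvolution k n (h n) (fun j : nat => X j w) x in
  let sigma2 := 1 / (2 * pi) * (mu / lambda) * g x in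
  cvg_in_distribution P
    (fun (n : nat) (w : T) =>
      Num.sqrt n%:R /
        (h n `^ ((lambda - 1) / 2) * expR ((1 / h n) `^ lambda / mu)) *
      (fnh n w - fine ('E_P[fnh n])%E))
    (normal_law 0 sigma2).
Proof.
move=> g fnh sigma2.
have fnhE n w : fnh n w = n%:R^-1 * \sum_(j < n) V n (X j w - x).
  rewrite /fnh (sinc_deconvolutionE _ _ _ (h_gt0 n) _ a_gt0 a_even k_cf)//.
  exact: continuous_sexp.
have Efnh n : fine ('E_P[fnh n])%E = n%:R^-1 * \sum_(j < n) m n.
  rewrite unlock (_ : fnh n = fun w => n%:R^-1 * \sum_(j < n) V n (X j w - x)); last first.
    by apply/funext => w; exact: fnhE.
  rewrite -[LHS]/(\int[P]_w (n%:R^-1 * \sum_(j < n) V n (X j w - x))).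
  have [isum Esum] := @Rintegral_sum _ _ _ P _ measurableT _ (index_enum 'I_n)
    (fun j w => V n (X j w - x)) (fun j => iVX n j).
  rewrite RintegralZl; [|exact: measurableT|exact: isum].
  congr (_ * _).
  apply: (etrans Esum).
  apply: eq_bigr => j _.
  exact: (VX n j).
rewrite (_ : (fun n w => _) = fun n w => \sum_(j < n) F n (X j w)); last first.
  apply/funext => n; apply/funext => w.
  rewrite fnhE Efnh -mulrBr -sumrB mulrA mulr_sumr; apply: eq_bigr => j _.
  by rewrite /F /r /s /a /stretched_exp gtr0_norm// [_ / mu]mulrC.
apply: (clt_triangular_array X_iid _ F_le b_cvg0 F0 Fv) => n.
by apply: measurable_funM => //; exact: measurable_funB.
Qed.

End stable_deconvolution.

Theorem theorem2p3 (R : realType) (d : measure_display) (T : measurableType d)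
    (P : probability T R) (mu lambda : R) (k f : R -> R)
    (X Y Z : nat -> {RV P >-> R}) (h : nat -> R) (x : R)
    (mu_gt0 : 0 < mu) (lambda_gt : 1 / 3 < lambda) (lambda_lt1 : lambda < 1)
    (k_cont : continuous k)
    (k_stable : forall t : R,
      fourier k t = (expR (- (`|t| `^ lambda / mu)))%:C)
    (X_sum : forall (j : nat) (w : T), X j w = Y j w + Z j w)
    (X_iid : iid X)
    (YZ_indep : forall j : nat, independent2 (Y j) (Z j))
    (Y_density : forall j : nat, has_density (Y j) f)
    (Z_density : forall j : nat, has_density (Z j) k)
    (h_gt0 : forall n : nat, 0 < h n)
    (h_cvg0 : h n @[n --> \oo] --> 0)
    (nh_cvgy : n%:R * h n @[n --> \oo] --> +oo) :
  let g := convolution k f in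
  let fnh := fun (n : nat) (w : T) =>
    sinc_deconvolution k n (h n) (fun j : nat => X j w) x in
  let sigma2 := 1 / (2 * pi) * (mu / lambda) * g x in
  cvg_in_distribution P
    (fun (n : nat) (w : T) =>
      Num.sqrt n%:R /
        (h n `^ ((lambda - 1) / 2) * expR ((1 / h n) `^ lambda / mu)) *
      (fnh n w - fine ('E_P[fnh n])%E))
    (normal_law 0 sigma2).
Proof.
exact: (stable_deconvolution_clt x mu_gt0 lambda_gt lambda_lt1 k_cont k_stable X_sum X_iid
  YZ_indep Y_density Z_density h_gt0 h_cvg0 nh_cvgy).
Qed.
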